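(* Let $\omega$ be a continuous non-decreasing function on $[0,+\infty)$ with $\omega(0)=0$. Suppose that $\omega(2\delta)<2\omega(\delta)$ for all sufficiently small $\delta>0$. Let $\chi^{-1}$ be the function inverse to $\chi(\delta)=\delta\,\omega(\delta)$. Then there exists a nowhere linear real function $\varphi\in C^{1,\omega}(\mathbb T)$ such that (i) $$\|e^{i\lambda\varphi}\|_{A(\mathbb T)}\leq c\,\frac{|\lambda|}{\log|\lambda|}\,\chi^{-1}\bigg(\frac{(\log|\lambda|)^2}{|\lambda|}\bigg),\qquad \lambda\in\mathbb R,\quad|\lambda|\geq 2,$$ and (ii) for all $p$ with $1<p<2$, $$\|e^{i\lambda\varphi}\|_{A_p(\mathbb T)}\leq c_p\bigg(\int_1^{|\lambda|}(\chi^{-1}(1/\tau))^p\,d\tau\bigg)^{1/p},\qquad \lambda\in\mathbb R,\quad|\lambda|\geq 2.$$ Here the positive constants $c,c_p$ are independent of $\lambda$.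
   Context: A function is called nowhere linear if it is not linear (i.e. not of the form $at+b$) on any interval. $\mathbb T=\mathbb R/2\pi\mathbb Z$; functions on $\mathbb T$ are identified with $2\pi$-periodic functions on $\mathbb R$. Fourier coefficients: $\widehat f(k)=\frac1{2\pi}\int_0^{2\pi}f(t)e^{-ikt}\,dt$, $k\in\mathbb Z$. $A_1(\mathbb T)=A(\mathbb T)$ is the space of continuous functions $f$ on $\mathbb T$ with $\{\widehat f(k)\}\in l^1$; for $1<p\le 2$, $A_p(\mathbb T)$ is the space of integrable functions $f$ on $\mathbb T$ with $\{\widehat f(k)\}\in l^p$. The norm is $\|f\|_{A_p(\mathbb T)}=\big(\sum_{k\in\mathbb Z}|\widehat f(k)|^p\big)^{1/p}$. $C^{1,\omega}(\mathbb T)$ is the class of $2\pi$-periodic differentiable functions $g$ on $\mathbb R$ such that $\sup_{|t_1-t_2|\le\delta}|g'(t_1)-g'(t_2)|=O(\omega(\delta))$ as $\delta\to+0$. *)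

(* Defs.v *)
From HB Require Import structures.
From mathcomp Require Import all_boot all_order all_algebra.
From mathcomp Require Import complex.
From mathcomp Require Import all_classical all_reals all_analysis.

Set Implicit Arguments.
Unset Strict Implicit.
Unset Printing Implicit Defensive.

Import Order.TTheory GRing.Theory Num.Theory.
Import numFieldNormedType.Exports.

Local Open Scope classical_set_scope.
Local Open Scope ring_scope.

Definition nowhere_linear (R : realType) (f : R -> R) : Prop :=
  forall u v : R, u < v ->
    ~ exists a b : R, forall t, t \in `]u, v[ -> f t = a * t + b.

(* The supremum is taken in the extended reals: a supremum in [R] would
   silently be 0 for an unbounded set. *)
Definition modulus_of_continuity (R : realType) (g : R -> R) (d : R) : \bar R :=
  ereal_sup [set (`|g t.1 - g t.2|)%:E | t in [set t : R * R | `|t.1 - t.2| <= d]].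

Definition C1_omega (R : realType) (omega : R -> R) (g : R -> R) : Prop :=
  [/\ periodic g (2 * pi),
      forall t, derivable g t 1 &
      exists C : R, \forall d \near 0^'+,
        (modulus_of_continuity (derive1 g) d <= (C * omega d)%:E)%E].

Definition chi (R : realType) (omega : R -> R) (d : R) : R := d * omega d.

(* Inverse of the restriction of [chi omega] to [0, +oo[; its values outside
   the image of that half-line are irrelevant. *)
Definition chi_inv (R : realType) (omega : R -> R) : R -> R :=
  'pinv_(fun=> 0) `[0, +oo[ (chi omega).

(* e^{i x} *)
Definition cis (R : realType) (x : R) : R[i] := (cos x +i* sin x)%C.

Definition fourier_coef (R : realType) (f : R -> R[i]) (k : int) : R[i] :=
  let h t := f t * cis (- (k%:~R * t)) in
  ((2 * pi)^-1%:C *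
   ((\int[lebesgue_measure]_(t in `[0, 2 * pi]) complex.Re (h t))
    +i* (\int[lebesgue_measure]_(t in `[0, 2 * pi]) complex.Im (h t))))%C.

(* Extended-real valued: [+oo] when the coefficients are not in l^p. *)
Definition A_norm (R : realType) (p : R) (f : R -> R[i]) : \bar R :=
  ((\esum_(k in [set: int]) (ComplexField.Normc.normc (fourier_coef f k) `^ p)%:E)
     `^ p^-1)%E.

(* Functions on the circle are 2pi-periodic functions on the line; integrable
   functions are not identified modulo null sets. *)
Definition in_A (R : realType) (p : R) (f : R -> R[i]) : Prop :=
  [/\ periodic f (2 * pi),
      if p == 1 then
        continuous (fun t => complex.Re (f t)) /\
        continuous (fun t => complex.Im (f t))
      else
        lebesgue_measure.-integrable `[0, 2 * pi]
          (fun t => (complex.Re (f t))%:E) /\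
        lebesgue_measure.-integrable `[0, 2 * pi]
          (fun t => (complex.Im (f t))%:E) &
      (A_norm p f < +oo)%E].

(* Main.v *)
(* The function is a sum of blocks, each a second difference of a staircase
   primitive, whose slopes oscillate by at most omega(w) over distances w.

   With w_m = d0 / 2^m, choose heights h_m comparable to omega(w_m) such that
   h_(m+1) is h_m or h_m / 2; the condition omega(2d) < 2 omega(d) makes this
   possible.  Refining the jump h_m of a step function into two jumps h_m / 2 at
   distance w_(m+1) each time the height is halved gives Cantor-like staircases,
   and their primitives are C^1 with derivative of modulus O(omega).  At scale
   n >= m such a primitive is affine up to h_m / h_n short pieces of length w_n.

   Let f be exp(i mu block) and let mu h_n w_n >= 1.  At scale n, the sum of the
   weights 1 / (1 + w_n^2 xi^2) over the distances xi of a frequency to the slopes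
   is bounded; integrating by parts over the affine pieces one finds that outside
   O(h_m / (h_n w_n)) frequencies the energy of f is O((h_m / h_n) w_n).  Passing
   from scale to scale and using Hoelder's inequality at each of them bounds the
   l^p sums of Fourier coefficients by sums of (h_m / h_j) w_j^(p-1).

   Blocks are inserted one after the other, each inside a rational interval on
   which the sum so far is affine, and so small that later ones cannot restore
   affinity.  An inserted block modifies exp(i lambda phi) by a frequency-shifted
   copy of exp(i lambda block) - 1, so by Minkowski's inequality the costs of the
   blocks add up. *)

Require Import Defs.
From HB Require Import structures.
From mathcomp Require Import all_boot all_order all_algebra.
From mathcomp Require Import complex.
From mathcomp Require Import all_classical all_reals all_analysis.
From mathcomp Require Import ring lra zify.

Import Order.TTheory GRing.Theory Num.Theory.
Import numFieldNormedType.Exports.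

Local Open Scope classical_set_scope.
Local Open Scope ring_scope.

Set Implicit Arguments.
Unset Strict Implicit.
Unset Printing Implicit Defensive.

(** A block inserted where the sum has slope [A] is seen at frequencies moved by [lambda * A], in
    general not an integer; hence every spectral bound below is uniform in a real translation [a] of
    the integer frequencies. All bounds are over finite duplicate-free lists [D] of frequencies. For
    such a list a difference quotient can replace a derivative, the limit over layers is taken with
    [D] fixed, and [A_norm] is recovered as a supremum. With x the product of [lambda], amplitude,
    height and width of a block, a block with small x is treated as a single piece, at a cost of
    order sqrt x. The quantities x decrease geometrically from one block to the next, so these costs
    form a lacunary sum. A block with large x is resolved scale by scale, and its cost is
    proportional to its height, at most 2^-j for the j-th block; so both families are summable
    uniformly in [lambda]. For p = 1 the scales have no decaying factor w^(p-1). There are O(log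
    |lambda|) of them, and stopping when x has dropped to order (log |lambda|)^2 balances their
    number against the remaining tail; this is the origin of the argument of [chi_inv] in (i). *)

Section segment_integral.
Variable R : realType.
Local Notation mu := (@lebesgue_measure R).
Implicit Types (f g F : R -> R) (a b c s : R).

(** * Continuity and integrals on a segment *)

Lemma contD f g : continuous f -> continuous g -> continuous (fun t => f t + g t).
Proof. by move=> cf cg t; apply: cvgD; [exact: cf|exact: cg]. Qed.
Lemma contB f g : continuous f -> continuous g -> continuous (fun t => f t - g t).
Proof. by move=> cf cg t; apply: cvgB; [exact: cf|exact: cg]. Qed.
Lemma contM f g : continuous f -> continuous g -> continuous (fun t => f t * g t).
Proof. by move=> cf cg t; apply: cvgM; [exact: cf|exact: cg]. Qed.
Lemma contN f : continuous f -> continuous (fun t => - f t).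
Proof. by move=> cf t; apply: cvgN; exact: cf. Qed.
Lemma contC c : continuous (fun _ : R => c).
Proof. by move=> t; exact: cvg_cst. Qed.
Lemma contI : continuous (fun t : R => t).
Proof. by move=> t; exact: cvg_id. Qed.
Lemma cont_sum (I : Type) (s : seq I) (P : pred I) (F : I -> R -> R) :
  (forall i, continuous (F i)) -> continuous (fun t => \sum_(i <- s | P i) F i t).
Proof.
move=> cF; elim: s => [|i s IH].
  by under eq_fun do rewrite big_nil; exact: contC.
under eq_fun do rewrite big_cons.
by case: (P i) => //; exact: contD.
Qed.

Definition sint a b f : R := \int[mu]_(t in `[a, b]) f t.

Lemma cont_integrable a b f : continuous f -> mu.-integrable `[a, b] (EFin \o f).
Proof.
move=> cf; apply: continuous_compact_integrable; first exact: segment_compact.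
exact: continuous_subspaceT.
Qed.

Lemma sint_ge0 a b f : (forall t, 0 <= f t) -> 0 <= sint a b f.
Proof. by move=> f0; apply: Rintegral_ge0. Qed.

Lemma le_sint a b f g : continuous f -> continuous g -> (forall t, t \in `[a, b] -> f t <= g t) ->
  sint a b f <= sint a b g.
Proof.
by move=> cf cg fg; apply: le_Rintegral => //; exact: cont_integrable.
Qed.

Lemma eq_sint a b f g : (forall t, t \in `[a, b] -> f t = g t) -> sint a b f = sint a b g.
Proof. by move=> fg; apply: eq_Rintegral => t; rewrite inE /=; exact: fg. Qed.

Lemma sintD a b f g : continuous f -> continuous g ->
  sint a b (fun t => f t + g t) = sint a b f + sint a b g.
Proof. by move=> cf cg; apply: RintegralD => //; exact: cont_integrable. Qed.

Lemma sintB a b f g : continuous f -> continuous g ->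
  sint a b (fun t => f t - g t) = sint a b f - sint a b g.
Proof. by move=> cf cg; apply: RintegralB => //; exact: cont_integrable. Qed.

Lemma sintZ a b c f : continuous f -> sint a b (fun t => c * f t) = c * sint a b f.
Proof. by move=> cf; apply: RintegralZl => //; exact: cont_integrable. Qed.

Lemma sint_cst a b c : a <= b -> sint a b (fun=> c) = c * (b - a).
Proof.
move=> ab; rewrite /sint Rintegral_cst//= lebesgue_measure_itv/= lte_fin.
by case: ltgtP ab => //= -> _; rewrite subrr.
Qed.

Lemma sint_point a f : sint a a f = 0.
Proof. by rewrite /sint set_itv1 Rintegral_set1. Qed.

Lemma sint_split a c b f : continuous f -> a <= c <= b ->
  sint a b f = sint a c f + sint c b f.
Proof.
move=> cf /andP[ac cb].
have := @Rintegral_itvB _ f (BLeft a) (BRight b) c (cont_integrable a b cf).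
rewrite !bnd_simp => /(_ ac cb) /(canRL (subrK _)) H.
rewrite /sint [LHS]H addrC; congr +%R.
rewrite Rintegral_itv_obnd_cbnd//.
apply: (integrableS _ _ _ (cont_integrable c b cf)) => //.
by apply: subset_itvr; rewrite bnd_simp.
Qed.

Lemma sint_FTC a b f F : a <= b -> continuous f -> (forall x, is_derive x (1 : R) F (f x)) ->
  sint a b f = F b - F a.
Proof.
rewrite le_eqVlt => /predU1P[<- _ _|ab cf dF]; first by rewrite sint_point subrr.
have cF : continuous F.
  by move=> x; apply: differentiable_continuous; apply/derivable1_diffP; case: (dF x).
rewrite /sint /Rintegral (@continuous_FTC2 _ _ F)//.
- exact: continuous_subspaceT.
- split.
  + by move=> x _; case: (dF x).
  + exact/cvg_at_right_filter/cF.
  + exact/cvg_at_left_filter/cF.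
- by move=> x _; rewrite derive1E derive_val.
Qed.

Lemma sint_shift a b s f : continuous f -> a <= b ->
  sint a b (fun t => f (t + s)) = sint (a + s) (b + s) f.
Proof.
move=> cf ab.
have D1 : ((fun t : R => t + s)^`() = cst 1)%classic.
  by apply/funext => t; rewrite derive1E deriveD// derive_id derive_cst addr0.
rewrite /sint /Rintegral (@integration_by_substitution_increasing _ (fun t => t + s))//.
- congr fine; apply: eq_integral => t _; congr EFin.
  rewrite !fctE D1 /=; by rewrite mulr1.
- by move=> x y _ _; rewrite ltrD2r.
- by rewrite D1 => ? _; exact: cvg_cst.
- by rewrite D1; exact: is_cvg_cst.
- by rewrite D1; exact: is_cvg_cst.
- have c : continuous (fun t : R => t + s) by move=> t; apply: cvgD; [exact: cvg_id|exact: cvg_cst].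
  split => //.
  + exact/cvg_at_right_filter/c.
  + exact/cvg_at_left_filter/c.
- exact: continuous_subspaceT.
Qed.

Lemma sint_eq0 a b f : (forall t, t \in `[a, b] -> f t = 0) -> sint a b f = 0.
Proof.
move=> f0; rewrite (@eq_sint _ _ _ (fun=> 0))// /sint.
by rewrite Rintegral_cst// mul0r.
Qed.

Lemma sint_bump a b u v f C : continuous f -> 0 <= C -> a <= u -> u <= v -> v <= b ->
  (forall t, f t <= C) -> (forall t, t < u \/ v < t -> f t = 0) ->
  sint a b f <= C * (v - u).
Proof.
move=> cf C0 au uv vb fC f0.
have fu : f u <= C by [].
have f0' t : t <= u -> t < u \/ t = u.
  by rewrite le_eqVlt => /orP[/eqP ->|]; [right|left].
rewrite (@sint_split _ u)//; last by rewrite au (le_trans uv).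
rewrite (@sint_split u v)//; last by rewrite uv vb.
have Ic x y : x <= y -> (forall t, t \in `[x, y] -> t < u \/ v < t) -> sint x y f = 0.
  by move=> xy H; apply: sint_eq0 => t /H /f0.
(* [f] is known to vanish only strictly outside [[u, v]], so the end point, a null set, is dropped
   first. *)
have H1 : sint a u f = 0.
  rewrite /sint -Rintegral_itv_bndo_bndc.
    rewrite (@eq_Rintegral _ _ _ _ _ (fun=> 0)); first by rewrite Rintegral_cst// mul0r.
    by move=> t; rewrite inE /= in_itv /= => /andP[_ tu]; apply: f0; left.
  apply: (integrableS _ _ _ (cont_integrable a u cf)) => //.
  by apply: subset_itvl; rewrite bnd_simp.
have H2 : sint v b f = 0.
  rewrite /sint -Rintegral_itv_obnd_cbnd.
    rewrite (@eq_Rintegral _ _ _ _ _ (fun=> 0)); first by rewrite Rintegral_cst// mul0r.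
    by move=> t; rewrite inE /= in_itv /= => /andP[tu _]; apply: f0; right.
  apply: (integrableS _ _ _ (cont_integrable v b cf)) => //.
  by apply: subset_itvr; rewrite bnd_simp.
rewrite H1 H2 add0r addr0 -(@sint_cst u v)//.
by apply: le_sint => //; exact: cst_continuous.
Qed.

End segment_integral.

Local Notation cRe := (@complex.Re _).
Local Notation cIm := (@complex.Im _).
Local Notation normc := (@ComplexField.Normc.normc _).
Local Notation rc := (@real_complex _).

(** * Squared modulus and unimodular exponentials *)

Section complex_basics.
Variable R : realType.
Implicit Types (z w : R[i]) (x y t : R).

Lemma sqr_mono (a b : R) : 0 <= a -> a <= b -> a ^+ 2 <= b ^+ 2.
Proof. nra. Qed.
Lemma sqr_mono_abs (a b : R) : `|a| <= `|b| -> a ^+ 2 <= b ^+ 2.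
Proof.
by move=> /(sqr_mono (normr_ge0 _)); rewrite -!normrX !ger0_norm ?sqr_ge0.
Qed.

Definition nsq z : R := complex.Re z ^+ 2 + complex.Im z ^+ 2.

Lemma cReM z w : cRe (z * w) = cRe z * cRe w - cIm z * cIm w.
Proof. by case: z; case: w. Qed.
Lemma cImM z w : cIm (z * w) = cRe z * cIm w + cIm z * cRe w.
Proof. by case: z; case: w. Qed.
Lemma cReD z w : cRe (z + w) = cRe z + cRe w.
Proof. by case: z; case: w. Qed.
Lemma cImD z w : cIm (z + w) = cIm z + cIm w.
Proof. by case: z; case: w. Qed.
Lemma cReN z : cRe (- z) = - cRe z. Proof. by case: z. Qed.
Lemma cImN z : cIm (- z) = - cIm z. Proof. by case: z. Qed.
Lemma complex_eq z w : cRe z = cRe w -> cIm z = cIm w -> z = w.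
Proof. by case: z => a b; case: w => c d /= -> ->. Qed.

Lemma normc_ge0 z : 0 <= normc z. Proof. by case: z => a b; exact: sqrtr_ge0. Qed.
Lemma nsqE z : nsq z = normc z ^+ 2.
Proof. by case: z => a b; rewrite /nsq /= sqr_sqrtr// addr_ge0// sqr_ge0. Qed.
Lemma nsq_ge0 z : 0 <= nsq z. Proof. by rewrite nsqE sqr_ge0. Qed.
Lemma nsqM z w : nsq (z * w) = nsq z * nsq w.
Proof. by rewrite !nsqE ComplexField.Normc.normcM exprMn. Qed.
Lemma nsqD_le z w : nsq (z + w) <= 2 * (nsq z + nsq w).
Proof.
rewrite /nsq !cReD !cImD.
have := sqr_ge0 (cRe z - cRe w); have := sqr_ge0 (cIm z - cIm w); nra.
Qed.
Lemma nsq_le z (a : R) : 0 <= a -> normc z <= a -> nsq z <= a ^+ 2.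
Proof. by move=> a0 za; rewrite nsqE lerXn2r// nnegrE normc_ge0. Qed.
Lemma normc_le z (a : R) : 0 <= a -> nsq z <= a ^+ 2 -> normc z <= a.
Proof. by move=> a0; rewrite nsqE => h; have := normc_ge0 z; nra. Qed.
Lemma le_normcB z w : normc (z - w) <= normc z + normc w.
Proof. by rewrite -[normc w]normcN le_normcD. Qed.
Lemma normc_real x : normc (rc x) = `|x|.
Proof. by rewrite /= expr0n addr0 sqrtr_sqr. Qed.
Lemma normc_sum (I : Type) (s : seq I) (P : pred I) (F : I -> R[i]) :
  normc (\sum_(i <- s | P i) F i) <= \sum_(i <- s | P i) normc (F i).
Proof.
elim/big_rec2: _ => [|i y z _ H]; first by rewrite ComplexField.Normc.normc0.
exact: le_trans (le_normcD _ _) (lerD _ H).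
Qed.

Lemma cisD x y : cis (x + y) = cis x * cis y.
Proof. by rewrite /cis cosD sinD; apply: complex_eq; rewrite ?cReM ?cImM /= //; ring. Qed.
Lemma cis0 : cis 0 = 1 :> R[i].
Proof. by rewrite /cis cos0 sin0. Qed.
Lemma normc_cis x : normc (cis x) = 1.
Proof. by rewrite /= cos2Dsin2 sqrtr1. Qed.
Lemma cisN x : cis x * cis (- x) = 1.
Proof. by rewrite -cisD subrr cis0. Qed.

Lemma abs_sin_le x : `|sin x| <= `|x|.
Proof.
wlog x0 : x / 0 <= x => [H|].
  by have [|/ltW x0] := leP 0 x; [exact: H|rewrite -normrN -sinN -(normrN x) H// oppr_ge0].
have cs : {within `[0, x], continuous (@sin R)}.
  by apply: continuous_subspaceT; exact: continuous_sin.
have [c _ /=] := MVT_segment x0 (fun y _ => is_derive_sin y) cs.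
rewrite sin0 !subr0 => ->; rewrite normrM.
by rewrite ler_piMl// ler_norml cos_geN1 cos_le1.
Qed.

Lemma nsq_cisB1 x : nsq (cis x - 1) = 4 * sin (x / 2) ^+ 2.
Proof.
have E : x = x / 2 + x / 2 by field.
rewrite {1}E /nsq /cis /= cosD sinD.
have := cos2Dsin2 (x / 2); move: (cos _) (sin _) => c s; rewrite subr0 => h.
have {}h : c ^+ 2 = 1 - s ^+ 2 by rewrite -h; ring.
have -> : (c * c - s * s - 1) ^+ 2 + (s * c + c * s) ^+ 2 =
  (c ^+ 2 - s ^+ 2 - 1) ^+ 2 + 4 * s ^+ 2 * c ^+ 2 by ring.
by rewrite h; ring.
Qed.

Lemma normc_cisB x y : normc (cis x - cis y) <= `|x - y|.
Proof.
have -> : cis x - cis y = cis y * (cis (x - y) - 1).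
  by rewrite mulrBr -cisD mulr1; congr (cis _ - _); ring.
rewrite ComplexField.Normc.normcM normc_cis mul1r; apply: normc_le => //.
rewrite nsq_cisB1 -[leRHS]normrX ger0_norm ?sqr_ge0//.
have := abs_sin_le ((x - y) / 2); move: (x - y) => u.
by move=> /sqr_mono_abs; rewrite exprMn; lra.
Qed.

(** Since sin has derivative 1 at 0, |sin (x / 2)| is at least |x| / 4 near 0. A translation by s
    multiplies a coefficient by [cis (xi * s)], and this bound recovers the multiplier xi^2 from the
    energy of a difference. *)
Lemma nsq_cisB1_ge : exists2 e : R, 0 < e & forall x, `|x| <= e -> x ^+ 2 / 4 <= nsq (cis x - 1).
Proof.
have H : (fun h : R => h^-1 *: (sin (h + 0) - sin 0)) @ 0^' --> (1 : R).
  have [+ _] : is_derive (0 : R) (1 : R) sin (cos 0) := is_derive_sin _.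
  move=> /cvg_ex [l hl].
  have : 'D_1 sin (0 : R) = 1 by rewrite derive_val cos0.
  rewrite /derive => e1; rewrite -e1.
  suff -> : (fun h : R => h^-1 *: (sin (h + 0) - sin 0)) =
    (fun h : R => h^-1 *: ((sin \o shift 0) (h *: 1) - sin 0)).
    by apply/cvg_ex; exists l.
  by apply/funext => h /=; rewrite /GRing.scale /= mulr1.
have /H : nbhs (1 : R) [set y | 1 / 2 <= y].
  exists (1 / 2) => //= y /=; rewrite ltr_distlC => /andP[h _] /=; lra.
rewrite nbhs_simpl /= => -[e /= e0 He].
exists e => // x xe; rewrite nsq_cisB1.
have [->|x0] := eqVneq x 0; first by rewrite expr0n !mul0r mulr_ge0// sqr_ge0.
have := He (x / 2); rewrite /ball /= sub0r normrN => /(_ _ _)/=.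
rewrite /GRing.scale /= addr0 sin0 subr0 => h.
have {}h : 1 / 2 <= (x / 2)^-1 * sin (x / 2).
  apply: h.
    rewrite normrM; apply: lt_le_trans xe.
    rewrite -[ltRHS]mulr1 ltr_pM2l ?normr_gt0// gtr0_norm; lra.
  by rewrite mulf_neq0// invr_neq0.
have h12 : 0 <= (1 / 2 : R) by lra.
have {}h := sqr_mono h12 h; rewrite [leRHS]exprMn exprVn in h.
have q0 : 0 < (x / 2) ^+ 2 by rewrite exprn_even_gt0//= mulf_neq0// invr_neq0.
move: h; rewrite (mulrC (_ ^- 2)) ler_pdivlMr// !exprMn; lra.
Qed.

End complex_basics.

(** * Complex integrals and Fourier coefficients at real frequencies *)

Section complex_integral.
Variable R : realType.
Implicit Types (f g : R -> R[i]) (z w : R[i]) (x y t : R).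

Definition ccont f := continuous (fun t => cRe (f t)) /\ continuous (fun t => cIm (f t)).

Lemma ccont_cst z : ccont (fun=> z).
Proof. by split; exact: cst_continuous. Qed.
Lemma ccontD f g : ccont f -> ccont g -> ccont (fun t => f t + g t).
Proof.
move=> [f1 f2] [g1 g2]; split=> t.
  by under eq_fun do rewrite cReD; apply: cvgD; [exact: f1|exact: g1].
by under eq_fun do rewrite cImD; apply: cvgD; [exact: f2|exact: g2].
Qed.
Lemma ccontM f g : ccont f -> ccont g -> ccont (fun t => f t * g t).
Proof.
move=> [f1 f2] [g1 g2]; split=> t.
  under eq_fun do rewrite cReM.
  by apply: cvgB; apply: cvgM; [exact: f1|exact: g1|exact: f2|exact: g2].
under eq_fun do rewrite cImM.
by apply: cvgD; apply: cvgM; [exact: f1|exact: g2|exact: f2|exact: g1].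
Qed.
Lemma ccontN f : ccont f -> ccont (fun t => - f t).
Proof.
move=> [f1 f2]; split=> t.
  by under eq_fun do rewrite cReN; apply: cvgN; exact: f1.
by under eq_fun do rewrite cImN; apply: cvgN; exact: f2.
Qed.
Lemma ccontB f g : ccont f -> ccont g -> ccont (fun t => f t - g t).
Proof. by move=> cf cg; apply: ccontD => //; exact: ccontN. Qed.
Lemma ccont_cis (g : R -> R) : continuous g -> ccont (fun t => cis (g t)).
Proof.
move=> cg; split=> t /=.
  exact: (continuous_comp (cg t) (@continuous_cos _ _)).
exact: (continuous_comp (cg t) (@continuous_sin _ _)).
Qed.
Lemma ccont_real (g : R -> R) : continuous g -> ccont (fun t => rc (g t)).
Proof. by move=> cg; split=> //= t; exact: cvg_cst. Qed.
Lemma ccont_sum (I : Type) (s : seq I) (P : pred I) (F : I -> R -> R[i]) :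
  (forall i, ccont (F i)) -> ccont (fun t => \sum_(i <- s | P i) F i t).
Proof.
move=> cF; elim: s => [|i s IH].
  by under eq_fun do rewrite big_nil; exact: ccont_cst.
under eq_fun do rewrite big_cons.
by case: (P i) => //; exact: ccontD.
Qed.
Lemma ccont_comp f (g : R -> R) : ccont f -> continuous g -> ccont (fun t => f (g t)).
Proof.
move=> [f1 f2] cg; split=> t.
  exact: (continuous_comp (cg t) (@f1 _)).
exact: (continuous_comp (cg t) (@f2 _)).
Qed.
Lemma cont_affine (a b : R) : continuous (fun t : R => a * t + b).
Proof.
by move=> t; apply: cvgD; [apply: cvgM; [exact: cvg_cst|exact: cvg_id]|exact: cvg_cst].
Qed.
Lemma cont_lin (a : R) : continuous (fun t : R => a * t).
Proof. by move=> t; apply: cvgM; [exact: cvg_cst|exact: cvg_id]. Qed.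
Lemma cont_nsq f : ccont f -> continuous (fun t => nsq (f t)).
Proof.
move=> [f1 f2] t; rewrite /nsq.
under eq_fun do rewrite !expr2.
by apply: cvgD; apply: cvgM; [exact: f1|exact: f1|exact: f2|exact: f2].
Qed.

Local Notation tau := (2 * @pi R).
Definition cint f : R[i] :=
  ((sint 0 tau (fun t => cRe (f t))) +i* (sint 0 tau (fun t => cIm (f t))))%C.

Lemma tau_gt0 : 0 < tau. Proof. by rewrite mulr_gt0// pi_gt0. Qed.

Lemma eq_cint f g : (forall t, t \in `[0, tau] -> f t = g t) -> cint f = cint g.
Proof. by move=> fg; rewrite /cint; congr (_ +i* _)%C; apply: eq_sint => t /fg ->. Qed.
Lemma cintD f g : ccont f -> ccont g -> cint (fun t => f t + g t) = cint f + cint g.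
Proof.
move=> [f1 f2] [g1 g2]; apply: complex_eq; rewrite ?cReD ?cImD /= -sintD//.
  by apply: eq_sint => t _; rewrite cReD.
by apply: eq_sint => t _; rewrite cImD.
Qed.
Lemma cintZ z f : ccont f -> cint (fun t => z * f t) = z * cint f.
Proof.
move=> [f1 f2]; apply: complex_eq; rewrite ?cReM ?cImM /=.
  rewrite -!sintZ// -sintB; first by apply: eq_sint => t _; rewrite cReM.
    by move=> t; apply: cvgM; [exact: cvg_cst|exact: f1].
  by move=> t; apply: cvgM; [exact: cvg_cst|exact: f2].
rewrite -!sintZ// -sintD; first by apply: eq_sint => t _; rewrite cImM.
  by move=> t; apply: cvgM; [exact: cvg_cst|exact: f2].
by move=> t; apply: cvgM; [exact: cvg_cst|exact: f1].
Qed.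
Lemma cint0 : cint (fun=> 0) = 0.
Proof. by rewrite /cint; apply: complex_eq => /=; apply: sint_eq0. Qed.
Lemma cintN f : ccont f -> cint (fun t => - f t) = - cint f.
Proof.
by move=> cf; rewrite -mulN1r -cintZ//; apply: eq_cint => t _; rewrite mulN1r.
Qed.
Lemma cintB f g : ccont f -> ccont g -> cint (fun t => f t - g t) = cint f - cint g.
Proof. by move=> cf cg; rewrite cintD ?cintN//; exact: ccontN. Qed.
Lemma cint_sum (I : Type) (s : seq I) (P : pred I) (F : I -> R -> R[i]) :
  (forall i, ccont (F i)) ->
  cint (fun t => \sum_(i <- s | P i) F i t) = \sum_(i <- s | P i) cint (F i).
Proof.
move=> cF; elim: s => [|i s IH].
  by under eq_fun do rewrite big_nil; rewrite cint0 big_nil.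
under eq_fun do rewrite big_cons; rewrite big_cons.
by case: (P i) => //; rewrite cintD ?IH//; exact: ccont_sum.
Qed.
Lemma cint_FTC f (F : R -> R[i]) : ccont f ->
  (forall t, is_derive t (1 : R) (fun t => cRe (F t)) (cRe (f t))) ->
  (forall t, is_derive t (1 : R) (fun t => cIm (F t)) (cIm (f t))) ->
  cint f = F tau - F 0.
Proof.
move=> [f1 f2] d1 d2; have t0 := ltW tau_gt0.
rewrite /cint (sint_FTC t0 f1 d1) (sint_FTC t0 f2 d2).
by apply: complex_eq; rewrite /= ?cReD ?cImD ?cReN ?cImN.
Qed.

(* The frequency [xi] need not be an integer: multiplying [f] by the exponential
   of a linear function only translates [coef f]. *)
Definition coef f (xi : R) : R[i] := rc tau^-1 * cint (fun t => f t * cis (- (xi * t))).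

Lemma ccont_osc f (xi : R) : ccont f -> ccont (fun t => f t * cis (- (xi * t))).
Proof.
move=> cf; apply: ccontM => //; apply: ccont_cis.
by move=> t; apply: cvgN; exact: cont_lin.
Qed.
Lemma eq_coef f g xi : (forall t, t \in `[0, tau] -> f t = g t) -> coef f xi = coef g xi.
Proof. by move=> fg; congr (_ * _); apply: eq_cint => t /fg ->. Qed.
Lemma coefD f g xi : ccont f -> ccont g -> coef (fun t => f t + g t) xi = coef f xi + coef g xi.
Proof.
move=> cf cg; rewrite /coef -mulrDr -cintD; [|exact: ccont_osc..].
by congr (_ * _); apply: eq_cint => t _; rewrite mulrDl.
Qed.
Lemma coefZ z f xi : ccont f -> coef (fun t => z * f t) xi = z * coef f xi.
Proof.
move=> cf; rewrite /coef mulrCA -(cintZ z (ccont_osc xi cf)).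
by congr (_ * _); apply: eq_cint => t _; rewrite mulrA.
Qed.
Lemma coefN f xi : ccont f -> coef (fun t => - f t) xi = - coef f xi.
Proof.
by move=> cf; rewrite -mulN1r -coefZ//; apply: eq_coef => t _; rewrite mulN1r.
Qed.
Lemma coefB f g xi : ccont f -> ccont g -> coef (fun t => f t - g t) xi = coef f xi - coef g xi.
Proof. by move=> cf cg; rewrite coefD ?coefN//; exact: ccontN. Qed.
Lemma coef_sum (I : Type) (s : seq I) (P : pred I) (F : I -> R -> R[i]) xi :
  (forall i, ccont (F i)) ->
  coef (fun t => \sum_(i <- s | P i) F i t) xi = \sum_(i <- s | P i) coef (F i) xi.
Proof.
move=> cF; rewrite /coef -mulr_sumr -cint_sum; last by move=> i; exact: ccont_osc.
by congr (_ * _); apply: eq_cint => t _; rewrite mulr_suml.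
Qed.
Lemma coef_modulate f (a b : R) xi : ccont f ->
  coef (fun t => cis (a * t + b) * f t) xi = cis b * coef f (xi - a).
Proof.
move=> cf; rewrite /coef mulrCA -(cintZ _ (ccont_osc (xi - a) cf)).
congr (_ * _); apply: eq_cint => t _.
have -> : a * t + b = b + a * t by rewrite addrC.
have -> : - ((xi - a) * t) = a * t + - (xi * t) by ring.
by rewrite !cisD; ring.
Qed.

Lemma cis_int_tau (k : int) : cis (k%:~R * tau) = 1 :> R[i].
Proof.
have nat_case (n : nat) : cis (n%:R * tau) = 1 :> R[i].
  elim: n => [|n IH]; first by rewrite mul0r cis0.
  rewrite -natr1 mulrDl mul1r cisD IH mul1r mulr_natl /cis cos2pi sin2pi.
  exact: complex_eq.
case: k => n; first exact: nat_case.
rewrite NegzE mulrNz mulNr -[LHS]mul1r -{1}(nat_case n.+1).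
exact: cisN.
Qed.

Lemma is_derive_linear (a t : R) : is_derive t (1 : R) (fun t : R => a * t) a.
Proof.
have H := is_deriveM (is_derive_cst a t 1) (is_derive_id t (1 : R)).
by apply: is_derive_eq; rewrite scaler0 addr0 /GRing.scale /= mulr1.
Qed.

Lemma is_derive_cos_lin (a t : R) : is_derive t (1 : R) (fun t => cos (a * t)) (- (a * sin (a * t))).
Proof.
have H := is_derive1_comp (is_derive_cos (a * t)) (is_derive_linear a t).
by apply: is_derive_eq; rewrite mulNr mulrC.
Qed.

Lemma is_derive_sin_lin (a t : R) : is_derive t (1 : R) (fun t => sin (a * t)) (a * cos (a * t)).
Proof.
have H := is_derive1_comp (is_derive_sin (a * t)) (is_derive_linear a t).
by apply: is_derive_eq; rewrite mulrC.
Qed.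

Lemma cint_cis_int (k : int) : k != 0 -> cint (fun t => cis (k%:~R * t)) = 0.
Proof.
move=> k0; have k0' : (k%:~R : R) != 0 by rewrite intr_eq0.
have cf : ccont (fun t => cis (k%:~R * t)) by apply: ccont_cis; exact: cont_lin.
pose F (t : R) : R[i] := (((k%:~R)^-1 * sin (k%:~R * t)) +i* (- ((k%:~R)^-1 * cos (k%:~R * t))))%C.
apply: (etrans (@cint_FTC _ F cf _ _)) => /=.
- move=> t; have H := is_deriveM (is_derive_cst ((k%:~R)^-1 : R) t (1 : R)) (is_derive_sin_lin k%:~R t).
  by apply: is_derive_eq; rewrite scaler0 addr0 /GRing.scale /= mulKf.
- move=> t; have H := is_deriveN (is_deriveM (is_derive_cst ((k%:~R)^-1 : R) t (1 : R)) (is_derive_cos_lin k%:~R t)).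
  by apply: is_derive_eq; rewrite scaler0 addr0 /GRing.scale /= mulrN opprK mulKf.
- have [c s] : cos (k%:~R * tau) = 1 /\ sin (k%:~R * tau) = 0.
    by have := cis_int_tau k; rewrite /cis => -[-> ->].
  by rewrite /F c s !mulr0 sin0 cos0 mulr0 subrr.
Qed.

Lemma cint_cst z : cint (fun=> z) = rc tau * z.
Proof.
rewrite /cint !sint_cst ?(ltW tau_gt0)// subr0.
by apply: complex_eq; rewrite ?cReM ?cImM /=; ring.
Qed.

End complex_integral.

Ltac cont := repeat first [assumption | exact: contC | exact: contI | exact: cont_lin
  | apply: contD | apply: contB | apply: contM | apply: contN].

(** * Bessel's inequality, transforms of ramps, Cauchy weights and interpolation *)

Section fourier_tools.
Variable R : realType.
Implicit Types (f g : R -> R[i]) (z w : R[i]) (x y t : R) (D : seq int).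
Local Notation tau := (2 * @pi R).

Lemma coef_cis_int (a : R) (k l : int) :
  coef (fun t => cis ((k%:~R - a) * t)) (l%:~R - a) = (k == l)%:R.
Proof.
rewrite /coef (@eq_cint _ _ (fun t => cis ((k - l)%:~R * t))); last first.
  by move=> t _; rewrite -cisD; congr cis; rewrite intrD mulrNz; ring.
have [->|kl] := eqVneq k l.
  rewrite subrr (@eq_cint _ _ (fun=> 1)) ?cint_cst; last by move=> t _; rewrite mul0r cis0.
  by rewrite mulr1 -rmorphM /= mulVf ?rmorph1// gt_eqF// tau_gt0.
by rewrite cint_cis_int ?mulr0// subr_eq0.
Qed.

Lemma nsqB_cis z w x : nsq (z - w * cis x) =
  nsq z + nsq w - 2 * (cRe w * cRe (z * cis (- x)) + cIm w * cIm (z * cis (- x))).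
Proof.
rewrite /nsq /cis cosN sinN ?cReD ?cImD ?cReN ?cImN ?cReM ?cImM /=.
have := cos2Dsin2 x; move: (cos x) (sin x) => c s h.
have -> : cRe w ^+ 2 + cIm w ^+ 2 = (c ^+ 2 + s ^+ 2) * (cRe w ^+ 2 + cIm w ^+ 2).
  by rewrite h mul1r.
ring.
Qed.

Lemma sint_Re_coef f xi : sint 0 tau (fun t => cRe (f t * cis (- (xi * t)))) = tau * cRe (coef f xi).
Proof. by rewrite /coef cReM /= mul0r subr0 mulrA mulfV ?mul1r// gt_eqF// tau_gt0. Qed.
Lemma sint_Im_coef f xi : sint 0 tau (fun t => cIm (f t * cis (- (xi * t)))) = tau * cIm (coef f xi).
Proof. by rewrite /coef cImM /= mul0r addr0 mulrA mulfV ?mul1r// gt_eqF// tau_gt0. Qed.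

Lemma sint_comb (n u v : R -> R) (d b c : R) : continuous n -> continuous u -> continuous v ->
  sint 0 tau (fun t => n t + d - 2 * (b * u t + c * v t)) =
  sint 0 tau n + tau * d - 2 * (b * sint 0 tau u + c * sint 0 tau v).
Proof.
move=> cn cu cv.
rewrite sintB; [|by cont..].
rewrite sintZ; last by cont.
rewrite sintD; [|by cont..].
rewrite sintD; [|by cont..].
by rewrite !sintZ// sint_cst ?(ltW (tau_gt0 _))// subr0 (mulrC d).
Qed.

(** Induction on the list: subtracting the projection on one exponential lowers the energy by its
    squared coefficient and leaves the other coefficients unchanged. Orthogonality needs only
    integer differences of frequencies, so the common shift [a] is harmless. *)
Lemma bessel D a f : ccont f -> uniq D ->
  \sum_(k <- D) nsq (coef f (k%:~R - a)) <= tau^-1 * sint 0 tau (fun t => nsq (f t)).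
Proof.
move=> + uD; elim: D uD f => [_ f cf|k D IH /= /andP[kD uD] f cf].
  by rewrite big_nil mulr_ge0// ?invr_ge0 ?(ltW (tau_gt0 _))// sint_ge0// => t; exact: nsq_ge0.
rewrite big_cons; pose c := coef f (k%:~R - a).
have ce : ccont (fun t => cis ((k%:~R - a) * t)) by apply: ccont_cis; exact: cont_lin.
have cce : ccont (fun t => c * cis ((k%:~R - a) * t)) by apply: ccontM => //; exact: ccont_cst.
pose f1 t := f t - c * cis ((k%:~R - a) * t).
have cf1 : ccont f1 by exact: ccontB.
have -> : \sum_(l <- D) nsq (coef f (l%:~R - a)) = \sum_(l <- D) nsq (coef f1 (l%:~R - a)).
  apply: eq_big_seq => l lD; rewrite /f1 coefB// coefZ// coef_cis_int.
  by case: eqVneq lD kD => [-> ->//|_ _ _]; rewrite mulr0 subr0.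
apply: le_trans (lerD (lexx _) (IH uD _ cf1)) _.
have [r1 r2] := ccont_osc (k%:~R - a) cf.
have H : sint 0 tau (fun t => nsq (f1 t)) = sint 0 tau (fun t => nsq (f t)) - tau * nsq c.
  rewrite (@eq_sint _ _ _ _ (fun t => (nsq (f t) + nsq c) -
     2 * (cRe c * cRe (f t * cis (- ((k%:~R - a) * t))) +
          cIm c * cIm (f t * cis (- ((k%:~R - a) * t)))))); last first.
    by move=> t _; rewrite /f1 nsqB_cis.
  rewrite (sint_comb (nsq c) (cRe c) (cIm c) (cont_nsq cf) r1 r2) sint_Re_coef sint_Im_coef.
  by rewrite -/c /nsq; ring.
rewrite H mulrBr mulrA mulVf ?gt_eqF ?tau_gt0// mul1r addrC subrK//.
Qed.

(* Vanishing near the end points replaces the periodicity of [f]. *)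
Lemma coef_shift f s xi : ccont f -> 0 <= s -> s <= tau ->
  (forall t, t <= s \/ tau <= t -> f t = 0) ->
  coef (fun t => f (t + s)) xi = cis (xi * s) * coef f xi.
Proof.
move=> cf s0 st f0; have cg := ccont_osc xi cf; have [g1 g2] := cg.
rewrite /coef mulrCA; congr (_ * _).
pose g t := f t * cis (- (xi * t)).
have cs : continuous (fun t : R => t + s) by move=> t; apply: cvgD; [exact: cvg_id|exact: cvg_cst].
rewrite -[cint _ in RHS]/(cint g).
have -> : cint g = cint (fun t => g (t + s)).
  have key (h : R -> R) : continuous h -> (forall t, t <= s \/ tau <= t -> h t = 0) ->
      sint 0 tau h = sint 0 tau (fun t => h (t + s)).
    move=> ch h0; rewrite (sint_shift _ ch)// ?add0r ?(ltW (tau_gt0 _))//.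
    rewrite (@sint_split _ 0 s)//; last by rewrite s0.
    rewrite [RHS](@sint_split _ s tau)//; last by rewrite st lerDl.
    rewrite (@sint_eq0 _ 0 s) ?(@sint_eq0 _ tau (tau + s)) ?add0r ?addr0//.
      by move=> t; rewrite in_itv /= => /andP[? _]; apply: h0; right.
    by move=> t; rewrite in_itv /= => /andP[_ ?]; apply: h0; left.
  rewrite /cint; congr (_ +i* _)%C; apply: key => // t ht; rewrite /g f0//.
    by rewrite mul0r.
  by rewrite mul0r.
rewrite -(cintZ _ (ccont_comp cg cs)); apply: eq_cint => t _.
have -> : - (xi * t) = xi * s + - (xi * (t + s)) by ring.
by rewrite cisD; ring.
Qed.

Definition lip (h : R -> R) K := forall s t, `|h s - h t| <= K * `|s - t|.
Lemma lip_cont h K : lip h K -> continuous h.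
Proof.
move=> hK t; apply/cvgrPdist_lt => e e0.
have K0 : 0 < `|K| + 1 by rewrite ltr_wpDl.
near=> s; apply: le_lt_trans (hK _ _) _.
apply: (@le_lt_trans _ _ ((`|K| + 1) * `|t - s|)).
  by rewrite ler_wpM2r// (le_trans (ler_norm _))// lerDl.
rewrite mulrC -ltr_pdivlMr//; near: s.
by apply: cvgr_dist_lt => //; rewrite divr_gt0.
Unshelve. all: by end_near. Qed.

Definition ramp x t : R := Num.max (t - x) 0.
Lemma ramp_lip x : lip (ramp x) 1.
Proof. move=> s t; rewrite /ramp mul1r.
have h1 := ler_norm (s - t); have h2 := ler_norm (t - s); rewrite distrC in h2.
by rewrite ler_norml; case: (leP (s - x)) => h3; case: (leP (t - x)) => h4; apply/andP; split; lra. Qed.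
Lemma ramp0 x t : t <= x -> ramp x t = 0.
Proof. by rewrite /ramp => h; case: leP => h'; lra. Qed.
Lemma rampE x t : x <= t -> ramp x t = t - x.
Proof. by rewrite /ramp => h; case: leP => h'; lra. Qed.

(** Integration by parts. [Z1] and [Z2] collect the contributions of the end point [tau], which do
    not cancel because [zeta] is not an integer; they enter through a function affine in [x], which
    disappears from a difference of two step ramps of equal length. *)
Lemma cint_ramp zeta : zeta != 0 -> exists Z1 Z2 : R[i], forall x, 0 <= x -> x <= tau ->
  cint (fun t => rc (ramp x t) * cis (- (zeta * t))) =
    rc (tau - x) * Z1 + Z2 - rc (zeta ^- 2) * cis (- (zeta * x)).
Proof.
move=> z0.
exists ((zeta^-1 * sin (zeta * tau)) +i* (zeta^-1 * cos (zeta * tau)))%C.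
exists ((zeta ^- 2 * cos (zeta * tau)) +i* (- (zeta ^- 2 * sin (zeta * tau))))%C => x x0 xt.
have key (h H : R -> R) : continuous h ->
   (forall t, is_derive t (1 : R) H ((t - x) * h t)) ->
   sint 0 tau (fun t => ramp x t * h t) = H tau - H x.
  move=> ch dH.
  have c1 : continuous (fun t => ramp x t * h t).
    by apply: contM => //; exact: (lip_cont (@ramp_lip x)).
  have c2 : continuous (fun t => (t - x) * h t).
    by cont.
  rewrite (@sint_split _ 0 x)//; last by rewrite x0.
  rewrite (@sint_eq0 _ 0 x) ?add0r; last first.
    by move=> t; rewrite in_itv /= => /andP[_ ?]; rewrite ramp0// mul0r.
  rewrite -(sint_FTC xt c2 dH); apply: eq_sint => t; rewrite in_itv /= => /andP[? _].
  by rewrite rampE.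
have dB t : is_derive t (1 : R) (fun t : R => t - x) 1.
  have H := is_deriveB (is_derive_id t (1 : R)) (is_derive_cst x t (1 : R)).
  by apply: is_derive_eq; rewrite subr0.
have K1 := key (fun t => cos (zeta * t)) (fun t => (t - x) * (zeta^-1 * sin (zeta * t)) + zeta ^- 2 * cos (zeta * t)).
have K2 := key (fun t => - sin (zeta * t)) (fun t => (t - x) * (zeta^-1 * cos (zeta * t)) - zeta ^- 2 * sin (zeta * t)).
have E1 : sint 0 tau (fun t => cRe (rc (ramp x t) * cis (- (zeta * t)))) =
   sint 0 tau (fun t => ramp x t * cos (zeta * t)).
  by apply: eq_sint => t _; rewrite cReM /= mul0r subr0 cosN.
have E2 : sint 0 tau (fun t => cIm (rc (ramp x t) * cis (- (zeta * t)))) =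
   sint 0 tau (fun t => ramp x t * - sin (zeta * t)).
  by apply: eq_sint => t _; rewrite cImM /= mul0r addr0 sinN.
have dsin (w t : R) : continuous (fun t => sin (w * t)).
  by move=> u; exact: (continuous_comp (@cont_lin _ _ _) (@continuous_sin _ _)).
have dcos (w t : R) : continuous (fun t => cos (w * t)).
  by move=> u; exact: (continuous_comp (@cont_lin _ _ _) (@continuous_cos _ _)).
have {}K1 := K1 (dcos _ 0).
have T1 : forall t, is_derive t (1 : R) (fun t => (t - x) * (zeta^-1 * sin (zeta * t)) + zeta ^- 2 * cos (zeta * t)) ((t - x) * cos (zeta * t)).
  move=> t.
  have H1 := is_deriveM (is_derive_cst (zeta^-1) t (1 : R)) (is_derive_sin_lin zeta t).
  have H2 := is_deriveM (is_derive_cst (zeta^-2) t (1 : R)) (is_derive_cos_lin zeta t).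
  have H := is_deriveD (is_deriveM (dB t) H1) H2.
  by apply: is_derive_eq; rewrite !scaler0 !addr0 !fctE /cst /GRing.scale /=; field.
have {}K2 := K2 (contN (dsin _ 0)).
have T2 : forall t, is_derive t (1 : R) (fun t => (t - x) * (zeta^-1 * cos (zeta * t)) - zeta ^- 2 * sin (zeta * t)) ((t - x) * - sin (zeta * t)).
  move=> t.
  have H1 := is_deriveM (is_derive_cst (zeta^-1) t (1 : R)) (is_derive_cos_lin zeta t).
  have H2 := is_deriveM (is_derive_cst (zeta^-2) t (1 : R)) (is_derive_sin_lin zeta t).
  have H := is_deriveB (is_deriveM (dB t) H1) H2.
  by apply: is_derive_eq; rewrite !scaler0 !addr0 !fctE /cst /GRing.scale /=; field.
rewrite /cint E1 E2 (K1 T1) (K2 T2).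
apply: complex_eq; rewrite ?cReD ?cImD ?cReN ?cImN ?cReM ?cImM /= ?cosN ?sinN subrr;
    ring.
Qed.

Definition step_ramp (l y t : R) : R := l^-1 * (ramp y t - ramp (y + l) t).

(** After the affine parts cancel, four unimodular terms remain, of total size at most 4, and 4 <=
    [tau]. *)
Lemma normc_coef_trapezoid zeta (l y y' : R) : zeta != 0 -> 0 < l ->
  0 <= y -> y + l <= tau -> 0 <= y' -> y' + l <= tau ->
  normc (coef (fun t => rc (step_ramp l y t - step_ramp l y' t)) zeta) <= (l * zeta ^+ 2)^-1.
Proof.
move=> z0 l0 y0 yt y'0 y't.
have [Z1 [Z2 HZ]] := cint_ramp z0.
have cr x : ccont (fun t => rc (ramp x t)) by apply: ccont_real; exact: (lip_cont (@ramp_lip x)).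
pose J x : R[i] := cint (fun t => rc (ramp x t) * cis (- (zeta * t))).
have -> : coef (fun t => rc (step_ramp l y t - step_ramp l y' t)) zeta =
  rc (tau^-1 * l^-1) * (J y - J (y + l) - (J y' - J (y' + l))).
  rewrite /coef rmorphM -mulrA; congr (_ * _).
  have co x : ccont (fun t => rc (ramp x t) * cis (- (zeta * t))) by exact: ccont_osc.
  rewrite /J -!cintB//; try exact: ccontB.
  rewrite -cintZ; last by apply: ccontB; exact: ccontB.
  apply: eq_cint => t _; rewrite /step_ramp.
  have -> : l^-1 * (ramp y t - ramp (y + l) t) - l^-1 * (ramp y' t - ramp (y' + l) t) =
    l^-1 * (ramp y t - ramp (y + l) t - (ramp y' t - ramp (y' + l) t)) by ring.
  by rewrite rmorphM !rmorphB; ring.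
rewrite /J !HZ//; try lra.
set c := cis _; set c1 := cis _; set c2 := cis _; set c3 := cis _.
have -> : rc (tau - y) * Z1 + Z2 - rc (zeta ^- 2) * c -
      (rc (tau - (y + l)) * Z1 + Z2 - rc (zeta ^- 2) * c1) -
      (rc (tau - y') * Z1 + Z2 - rc (zeta ^- 2) * c2 -
       (rc (tau - (y' + l)) * Z1 + Z2 - rc (zeta ^- 2) * c3)) =
  rc (zeta ^- 2) * ((c1 - c) + (c2 - c3)).
  have -> : rc (tau - (y + l)) = rc (tau - y) - rc l by rewrite -rmorphB; congr rc; ring.
  have -> : rc (tau - (y' + l)) = rc (tau - y') - rc l by rewrite -rmorphB; congr rc; ring.
  ring.
have n4 : normc ((c1 - c) + (c2 - c3)) <= 4.
  apply: le_trans (le_normcD _ _) _.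
  have := le_normcB c1 c; have := le_normcB c2 c3.
  rewrite !normc_cis; lra.
rewrite !ComplexField.Normc.normcM !normc_real.
have t4 : 4 <= tau by have := @pi_ge2 R; lra.
have t0 := @tau_gt0 R.
rewrite !normrM !normfV normrX real_normK ?num_real// (gtr0_norm t0) (gtr0_norm l0).
have z2 : 0 < zeta ^+ 2 by rewrite exprn_even_gt0.
rewrite (invfM l).
have -> : tau^-1 / l * ((zeta ^+ 2)^-1 * normc (c1 - c + (c2 - c3))) =
  (normc (c1 - c + (c2 - c3)) / tau) * (l^-1 / zeta ^+ 2) by ring.
rewrite ler_piMl//; last by rewrite ler_pdivrMr// mul1r; lra.
by rewrite mulr_ge0// invr_ge0 ltW.
Qed.

Lemma sum_uniq_nat (g : nat -> R) (G : R) (s : seq nat) : (forall n, 0 <= g n) ->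
  (forall N, \sum_(n < N) g n <= G) -> uniq s -> \sum_(n <- s) g n <= G.
Proof.
move=> g0 gG us; have [N sN] : exists N, forall n, n \in s -> (n < N)%N.
  exists (\max_(n <- s) n.+1) => n ns; exact: (@leq_bigmax_seq _ _ xpredT (fun n => n.+1)).
apply: le_trans (gG N); rewrite -(big_mkord xpredT g) /index_iota subn0.
have P : perm_eq s [seq n <- iota 0 N | n \in s].
  apply: uniq_perm => //; first by rewrite filter_uniq// iota_uniq.
  move=> n; rewrite mem_filter mem_iota /= add0n.
  by case ns: (n \in s) => //=; rewrite sN.
rewrite (perm_big _ P) /= big_filter big_mkcond /=.
by apply: ler_sum => n _; case: ifP.
Qed.

(** A weight of width [r] with total mass O([r]) on translates of the integers. For |zeta| >= 1 / w,
    the bound 1 / (w zeta^2) of a trapezoid is comparable to w times the weight of width 1 / w at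
    zeta. *)
Definition cauchy_wt (r x : R) : R := (1 + (x / r) ^+ 2)^-1.
Lemma cauchy_wt_gt0 r x : 0 < cauchy_wt r x.
Proof. by rewrite invr_gt0 ltr_pwDl// sqr_ge0. Qed.

(** The telescoping majorant is 4 r^2 / ((r + n) (r + n + 1)): as r >= 1, the denominator is at most
    2 (r + n)^2, hence at most 4 (r^2 + n^2). *)
Lemma sum_cauchy_wt_nat (r : R) : 1 <= r -> forall N, \sum_(n < N) cauchy_wt r n%:R <= 4 * r.
Proof.
move=> r1 N; have r0 : 0 < r by lra.
have H : \sum_(n < N) cauchy_wt r n%:R <= 4 * r ^+ 2 * (r^-1 - (r + N%:R)^-1).
  elim: N => [|N IH]; first by rewrite big_ord0 addr0 subrr mulr0.
  rewrite big_ord_recr /= (le_trans (lerD IH (lexx _)))//.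
  have -> : N.+1%:R = N%:R + 1 :> R by rewrite natr1.
  have : 0 <= N%:R :> R by []; move: (N%:R) => n n0.
  rewrite /cauchy_wt exprMn exprVn.
  have r2 : 0 < r ^+ 2 by rewrite exprn_gt0.
  have -> : 1 + n ^+ 2 / r ^+ 2 = (r ^+ 2 + n ^+ 2) / r ^+ 2 by field; lra.
  rewrite invf_div -lerBrDl -mulrBr.
  have -> : r^-1 - (r + (n + 1))^-1 - (r^-1 - (r + n)^-1) = ((r + n) * (r + (n + 1)))^-1.
    field; apply/andP; split; lra.
  rewrite ler_pdivrMr ?ltr_wpDr ?sqr_ge0// -mulrA mulrC mulrAC -mulrA ler_pdivlMl; last first.
    by rewrite mulr_gt0//; lra.
  have -> : 4 * r ^+ 2 * (r ^+ 2 + n ^+ 2) = 4 * (r ^+ 2 + n ^+ 2) * r ^+ 2 by ring.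
  rewrite ler_pM2r//.
  have : 0 <= (r - n) ^+ 2 by exact: sqr_ge0.
  have : 0 <= (r - 1) * (r + n) by rewrite mulr_ge0; lra.
  nra.
apply: le_trans H _; rewrite expr2 mulrA -mulrA ler_piMr//; first lra.
rewrite mulrBr mulfV ?gt_eqF// gerBl mulr_ge0// ?invr_ge0; [lra|].
by rewrite addr_ge0// ltW.
Qed.

Lemma cauchy_wt_mono (r x y : R) : 0 < r -> `|y| <= `|x| -> cauchy_wt r x <= cauchy_wt r y.
Proof.
move=> r0 h; rewrite lef_pV2 ?posrE ?ltr_pwDl ?sqr_ge0// lerD2l !exprMn ler_wpM2r ?sqr_ge0//.
exact: sqr_mono_abs.
Qed.

Lemma sum_cauchy_wt (r b : R) D : 1 <= r -> uniq D ->
  \sum_(k <- D) cauchy_wt r (k%:~R - b) <= 8 * r.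
Proof.
move=> r1 uD; have r0 : 0 < r by lra.
(* The integers on each side of [b] are sent injectively to [nat] by their distance to [z] or to
   [z - 1], which is at most their distance to [b]. *)
pose z := Num.floor b + 1.
have bz : b < z%:~R := floorD1_gt b.
have zb : (z - 1)%:~R <= b by rewrite /z addrK floor_le.
have S (s : seq int) (f : int -> nat) : uniq s -> {in s &, injective f} ->
    (forall k, k \in s -> `|(f k)%:R : R| <= `|k%:~R - b|) ->
    \sum_(k <- s) cauchy_wt r (k%:~R - b) <= 4 * r.
  move=> us fi fle; apply: (@le_trans _ _ (\sum_(k <- s) cauchy_wt r (f k)%:R)).
    by rewrite big_seq [leRHS]big_seq; apply: ler_sum => k ks; apply: cauchy_wt_mono => //; exact: fle.
  rewrite -(big_map f xpredT (fun n => cauchy_wt r n%:R)).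
  apply: sum_uniq_nat; [by move=> n; exact/ltW/cauchy_wt_gt0|exact: sum_cauchy_wt_nat|].
  by rewrite map_inj_in_uniq.
have -> : 8 * r = 4 * r + 4 * r by ring.
move: zb; move: bz; move: z => z bz zb.
rewrite (bigID (fun k : int => z <= k)) /=; apply: lerD; rewrite -big_filter.
- have H1 : {in [seq i <- D | z <= i] &, injective (fun k : int => absz (k - z)%R)}.
    by move=> k l; rewrite !mem_filter => /andP[hk _] /andP[hl _]; lia.
  apply: (S _ _ (filter_uniq _ uD) H1) => k.
  rewrite mem_filter => /andP[zk _].
  rewrite normr_nat pmulrn gez0_abs ?subr_ge0// intrD mulrNz.
  have zk' : z%:~R <= k%:~R :> R by rewrite ler_int.
  by rewrite ger0_norm; lra.
- have H1 : {in [seq i <- D | ~~ (z <= i)] &, injective (fun k : int => absz (z - 1 - k)%R)}.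
    by move=> k l; rewrite !mem_filter => /andP[hk _] /andP[hl _]; lia.
  apply: (S _ _ (filter_uniq _ uD) H1) => k.
  rewrite mem_filter => /andP[zk _].
  have zk1 : k <= z - 1 by lia.
  rewrite normr_nat pmulrn gez0_abs ?subr_ge0// intrD mulrNz.
  have zk' : k%:~R <= (z - 1)%:~R :> R by rewrite ler_int.
  by rewrite distrC ger0_norm; lra.
Qed.

(** A pointwise substitute for Hoelder's inequality, to be summed with a known energy c^2 r and a
    summable 1 / r. If c <= s / r the second term suffices, as (1 / r)^p <= 1 / r; otherwise c^(p-2)
    <= (s / r)^(p-2) and r^(2-p) <= r. *)
Lemma powR_interp (c s r p : R) : 1 <= p <= 2 -> 0 <= c -> 0 < s -> 1 <= r ->
  c `^ p <= s `^ (p - 2) * c ^+ 2 * r + s `^ p / r.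
Proof.
move=> /andP[p1 p2] c0 s0 r1; have r0 : 0 < r by lra.
have [cs|cs] := leP c (s / r).
  apply: (@le_trans _ _ (s `^ p / r)); last first.
    by rewrite lerDr !mulr_ge0 ?powR_ge0 ?sqr_ge0// ltW.
  apply: (@le_trans _ _ ((s / r) `^ p)).
    by apply: ge0_ler_powR; rewrite ?nnegrE//; [lra|rewrite divr_ge0// ltW].
  have -> : (s / r) `^ p = s `^ p * r^-1 `^ p by rewrite powRM ?invr_ge0 ?ltW.
  apply: ler_wpM2l; first exact: powR_ge0.
  by apply: ge1r_powR => //; rewrite invr_gt0 r0 invf_le1.
have sr : 0 < s / r by rewrite divr_gt0.
have cp : 0 < c by apply: lt_trans cs.
apply: (@le_trans _ _ (s `^ (p - 2) * c ^+ 2 * r)); last first.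
  by rewrite lerDl divr_ge0 ?powR_ge0// ltW.
have -> : c `^ p = c ^+ 2 / c `^ (2 - p).
  have <- : c `^ 2%:R = c ^+ 2 by rewrite powR_mulrn.
  rewrite -powRN -powRD ?(gt_eqF cp) ?implybT//; congr (_ `^ _); ring.
have q0 : 0 <= 2 - p by lra.
have Hc : (s / r) `^ (2 - p) <= c `^ (2 - p).
  by apply: ge0_ler_powR => //; rewrite ?nnegrE ltW.
apply: (@le_trans _ _ (c ^+ 2 / (s / r) `^ (2 - p))).
  by rewrite ler_wpM2l ?sqr_ge0// lef_pV2 ?posrE ?powR_gt0.
have -> : ((s / r) `^ (2 - p))^-1 = s `^ (p - 2) * r `^ (2 - p).
  rewrite powRM ?invr_ge0 ?ltW// invfM -!powRN opprB; congr (_ * _).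
  by rewrite -[r^-1]powR_inv1 ?ltW// -powRrM; congr (_ `^ _); ring.
rewrite mulrA (mulrC (c ^+ 2)); apply: ler_wpM2l.
  by rewrite mulr_ge0 ?sqr_ge0 ?powR_ge0.
by apply: ler1_powR => //; lra.
Qed.

End fourier_tools.

(** * Energy of sums of functions with disjoint supports *)

Section disjoint_pieces.
Variable R : realType.
Implicit Types (f g : R -> R[i]) (z : R[i]) (x y t s : R) (D : seq int).
Local Notation tau := (2 * @pi R).

Lemma nsq0 : nsq (0 : R[i]) = 0. Proof. by rewrite /nsq /= expr0n addr0. Qed.

Lemma nsq_sum_disjoint (I : finType) (P : pred I) (F : I -> R[i]) :
  (forall i j, P i -> P j -> i != j -> F i = 0 \/ F j = 0) ->
  nsq (\sum_(i | P i) F i) <= \sum_(i | P i) nsq (F i).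
Proof.
move=> dis; have [/existsP[i /andP[Pi Fi]]|/existsPn nF] := boolP [exists i, P i && (F i != 0)].
  rewrite (bigD1 i)//= big1 ?addr0; last first.
    move=> j /andP[Pj ji]; have [//|Fi0] := dis j i Pj Pi ji.
    by rewrite Fi0 eqxx in Fi.
  by rewrite (bigD1 i)//= lerDl sumr_ge0// => j _; exact: nsq_ge0.
rewrite big1 ?nsq0; first by rewrite sumr_ge0// => j _; exact: nsq_ge0.
by move=> i Pi; have := nF i; rewrite Pi /= negbK => /eqP.
Qed.

(** At most one [F i] and one [G j] are nonzero, so at most two summands survive; this costs the
    factor 2. It is applied to a sum and its translate, whose pieces may overlap each other. *)
Lemma nsq_sumB_disjoint (I : finType) (F G : I -> R[i]) :
  (forall i j, i != j -> F i = 0 \/ F j = 0) ->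
  (forall i j, i != j -> G i = 0 \/ G j = 0) ->
  nsq (\sum_i (F i - G i)) <= 2 * \sum_i nsq (F i - G i).
Proof.
move=> dF dG.
have s0 (P : pred I) : 0 <= \sum_(i | P i) nsq (F i - G i).
  by rewrite sumr_ge0// => j _; exact: nsq_ge0.
have [/existsP[i Fi]|/existsPn nF] := boolP [exists i, F i != 0].
  have F0 j : j != i -> F j = 0.
    by move=> ji; have [//|Fi0] := dF j i ji; rewrite Fi0 eqxx in Fi.
  rewrite (bigD1 i)//= (le_trans (nsqD_le _ _))// [X in _ <= 2 * X](bigD1 i)//= ler_wpM2l//.
  rewrite lerD2l; apply: nsq_sum_disjoint => j k ji ki jk.
  by rewrite !F0// !sub0r; have [->|->] := dG j k jk; rewrite oppr0; [left|right].
have F0 i : F i = 0 by apply/eqP; have := nF i; rewrite negbK.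
apply: (@le_trans _ _ (\sum_i nsq (F i - G i))); last by have := s0 xpredT; lra.
apply: nsq_sum_disjoint => j k _ _ jk.
by rewrite !F0 !sub0r; have [->|->] := dG j k jk; rewrite oppr0; [left|right].
Qed.

Lemma pos_lower_bound (l : seq R) : (forall x, x \in l -> 0 < x) ->
  exists2 s : R, 0 < s & forall x, x \in l -> s <= x.
Proof.
elim: l => [_|a l IH al]; first by exists 1.
have [|s s0 sl] := IH; first by move=> x xl; apply: al; rewrite inE xl orbT.
exists (Num.min a s).
  by rewrite lt_min s0 al// mem_head.
move=> x; rewrite inE => /predU1P[->|/sl sx]; first by rewrite ge_min lexx.
by rewrite ge_min sx orbT.
Qed.

Section pieces.
Variables (M : nat) (y : 'I_M -> R) (w : R) (H : 'I_M -> R -> R[i]) (A B : R).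
Hypothesis w0 : 0 < w.
Hypothesis y0 : forall i, 0 < y i.
Hypothesis ytau : forall i, y i + w <= tau.
Hypothesis ysep : forall i j : 'I_M, (i < j)%N -> y i + w <= y j.
Hypothesis H0 : forall i t, t <= y i \/ y i + w <= t -> H i t = 0.
Hypothesis A0 : 0 <= A.
Hypothesis B0 : 0 <= B.
Hypothesis HA : forall i t, nsq (H i t) <= A.
Hypothesis HB : forall i s t, nsq (H i s - H i t) <= B * (s - t) ^+ 2.
Hypothesis cH : forall i, ccont (H i).

Lemma pieces_disjoint t i j : i != j -> H i t = 0 \/ H j t = 0.
Proof.
move=> ij; wlog ltij : i j ij / (i < j)%N => [W|].
  have [/W|ji] := ltnP i j; first exact.
  have : (j < i)%N by rewrite ltn_neqAle ji andbT eq_sym.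
  by move=> /W; rewrite eq_sym => /(_ ij)[]; [right|left].
have := ysep ltij; have [h|h] := leP t (y j); first by right; apply: H0; left.
by move=> h2; left; apply: H0; right; lra.
Qed.

Lemma sint_sum (I : Type) (r : seq I) (a b : R) (F : I -> R -> R) :
  (forall i, continuous (F i)) ->
  sint a b (fun t => \sum_(i <- r) F i t) = \sum_(i <- r) sint a b (F i).
Proof.
move=> cF; elim: r => [|i r IH].
  by rewrite big_nil; apply: sint_eq0 => t _; rewrite big_nil.
rewrite big_cons -IH -sintD//; last exact: cont_sum.
by apply: eq_sint => t _; rewrite big_cons.
Qed.

Let cS : ccont (fun t => \sum_i H i t). Proof. exact: ccont_sum. Qed.

Lemma pieces_energy D a : uniq D ->
  \sum_(k <- D) nsq (coef (fun t => \sum_i H i t) (k%:~R - a)) <= M%:R * w * A.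
Proof.
move=> uD; have t0 := @tau_gt0 R; have p2 := @pi_ge2 R.
apply: le_trans (bessel a cS uD) _.
have cn i : continuous (fun t => nsq (H i t)) by exact: cont_nsq.
apply: (@le_trans _ _ (tau^-1 * sint 0 tau (fun t => \sum_i nsq (H i t)))).
  rewrite ler_wpM2l ?invr_ge0 ?(ltW t0)//.
  apply: le_sint; [exact: cont_nsq|exact: cont_sum|].
  by move=> t _; apply: nsq_sum_disjoint => i j _ _; exact: pieces_disjoint.
rewrite ler_pdivrMl// sint_sum//.
apply: (@le_trans _ _ (\sum_(i < M) A * w)).
  apply: ler_sum => i _.
  have -> : w = y i + w - y i by ring.
  have i0 := y0 i; have it := ytau i.
  apply: sint_bump => //; [exact: ltW|by rewrite lerDl ltW|].
  by move=> t h; rewrite H0 ?nsq0//; case: h => h; [left|right]; lra.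
rewrite sumr_const card_ord -[leLHS]mulr_natl (mulrC A) mulrA.
by rewrite ler_peMl ?mulr_ge0 ?(ltW w0)//; lra.
Qed.

(** A Plancherel bound for the derivative without differentiating: Bessel's inequality is applied to
    a difference of step [s], small enough for all frequencies of the finite list, and the powers of
    [s] cancel in the result. *)
Lemma pieces_energy_derivative D a : uniq D ->
  \sum_(k <- D) nsq (coef (fun t => \sum_i H i t) (k%:~R - a)) * (k%:~R - a) ^+ 2 <=
    4 * M%:R * w * B.
Proof.
move=> uD; have t0 := @tau_gt0 R; have p2 := @pi_ge2 R.
have [e e0 He] := nsq_cisB1_ge R.
(* [s] has to lie below the width, below each [y i] so that the translate stays within the period,
   and in the range of [nsq_cisB1_ge] for each frequency of [D]. *)
pose l := w :: ([seq y i | i <- enum 'I_M] ++ [seq e / (1 + `|k%:~R - a|) | k <- D]).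
have [|s s0 sl] := @pos_lower_bound l.
  move=> x; rewrite /l inE mem_cat => /orP[/eqP ->//|/orP[/mapP[i _ ->]//|/mapP[k _ ->]]].
  by rewrite divr_gt0// ltr_pwDl.
have sw : s <= w by apply: sl; rewrite mem_head.
have sy i : s <= y i.
  by apply: sl; rewrite inE mem_cat map_f ?orbT// mem_enum.
have sk k : k \in D -> `|(k%:~R - a) * s| <= e.
  move=> kD; have : s <= e / (1 + `|k%:~R - a|).
    by apply: sl; rewrite inE mem_cat (map_f (fun k => e / (1 + `|k%:~R - a|)) kD) !orbT.
  rewrite ler_pdivlMr ?ltr_pwDl// mulrC normrM (gtr0_norm s0) => h.
  by apply: le_trans h; rewrite ler_wpM2r ?(ltW s0)// lerDr.
pose S t := \sum_i H i t.
have cSs : ccont (fun t => S (t + s)).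
  by apply: (ccont_comp cS); apply: contD; [exact: contI|exact: contC].
have cB : ccont (fun t => S (t + s) - S t) by exact: ccontB.
have Ssupp t : t <= s \/ tau <= t -> S t = 0.
  move=> h; rewrite /S big1// => i _; apply: H0.
  by have := sy i; have := ytau i; case: h => h h1 h2; [left|right]; lra.
have [M0|M0] := posnP M.
  rewrite big1 ?mulr_ge0 ?(ltW w0)// => k _.
  rewrite (@eq_coef _ _ (fun=> 0)); last first.
    by move=> t _; rewrite big1// => i _; have := leq_ltn_trans (leq0n _) (ltn_ord i); rewrite [X in (_ < X)%N]M0.
  have c0 := @ccont_cst R 0.
  rewrite (@eq_coef _ _ (fun=> 0 * 0)); last by move=> t _; rewrite mul0r.
  by rewrite coefZ// mul0r nsq0 mul0r.
have stau : s <= tau by have := sy (Ordinal M0); have := ytau (Ordinal M0); lra.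
have E k : coef (fun t => S (t + s) - S t) (k%:~R - a) =
    (cis ((k%:~R - a) * s) - 1) * coef S (k%:~R - a).
  by rewrite coefB// coef_shift ?(ltW s0)//; ring.
have s2 : 0 < s ^+ 2 by rewrite exprn_gt0.
have L : \sum_(k <- D) nsq (coef S (k%:~R - a)) * (k%:~R - a) ^+ 2 <=
   4 / s ^+ 2 * \sum_(k <- D) nsq (coef (fun t => S (t + s) - S t) (k%:~R - a)).
  rewrite mulr_sumr big_seq [leRHS]big_seq; apply: ler_sum => k kD.
  rewrite E nsqM; have := He _ (sk _ kD); rewrite exprMn.
  have n0 := nsq_ge0 (coef S (k%:~R - a)).
  move: (nsq (coef _ _)) n0 (nsq (cis _ - 1)) => u u0 v h.
  have -> : 4 / s ^+ 2 * (v * u) = u * (4 / s ^+ 2 * v) by ring.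
  apply: ler_wpM2l => //.
  rewrite mulrAC ler_pdivlMr//; lra.
apply: le_trans L _.
(* The factor 4 / s^2 inverts the multiplier, the first 2 is the cost of overlaps, and 2 w bounds
   the length w + s of the support of a difference; 4 <= [tau] absorbs the rest. *)
apply: (@le_trans _ _ (4 / s ^+ 2 * (tau^-1 * (2 * (M%:R * (2 * B * s ^+ 2 * w)))))); last first.
  have -> : 4 / s ^+ 2 * (tau^-1 * (2 * (M%:R * (2 * B * s ^+ 2 * w)))) =
    (4 * M%:R * w * B) * (4 / tau) by field; apply/andP; split; lra.
  rewrite ler_piMr ?mulr_ge0 ?(ltW w0)//; rewrite ler_pdivrMr//; lra.
rewrite ler_wpM2l ?divr_ge0 ?(ltW s2)//.
apply: le_trans (bessel a cB uD) _.
rewrite ler_wpM2l ?invr_ge0 ?(ltW t0)//.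
have cH2 i : ccont (fun t => H i (t + s) - H i t).
  by apply: ccontB => //; apply: (ccont_comp (cH i)); apply: contD; [exact: contI|exact: contC].
have cn i : continuous (fun t => nsq (H i (t + s) - H i t)) by exact: cont_nsq.
apply: (@le_trans _ _ (sint 0 tau (fun t => 2 * \sum_i nsq (H i (t + s) - H i t)))).
  apply: le_sint; [exact: cont_nsq|by apply: contM; [exact: contC|exact: cont_sum]|].
  move=> t _; rewrite /S -sumrB; apply: nsq_sumB_disjoint => i j; exact: pieces_disjoint.
rewrite sintZ; last exact: cont_sum.
rewrite ler_wpM2l// sint_sum//.
apply: (@le_trans _ _ (\sum_(i < M) (B * s ^+ 2) * (y i + w - (y i - s)))).
  apply: ler_sum => i _.
  have i0 := y0 i; have it := ytau i; have iss := sy i.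
  apply: sint_bump => //.
  - by rewrite mulr_ge0// ltW.
  - by rewrite subr_ge0.
  - lra.
  - by move=> t; have := HB i (t + s) t; rewrite (addrC t) addrK.
  - move=> t h; rewrite !H0 ?subrr ?nsq0//; case: h => h; [left|right|left|right]; lra.
have E2 i : B * s ^+ 2 * (y i + w - (y i - s)) = B * s ^+ 2 * (w + s) by ring.
under eq_bigr do rewrite E2.
rewrite sumr_const card_ord -[leLHS]mulr_natl ler_wpM2l//.
have : B * s ^+ 2 * s <= B * s ^+ 2 * w by rewrite ler_wpM2l// mulr_ge0// ltW.
lra.
Qed.

Lemma pieces_weighted_energy D a K : uniq D -> 0 < K ->
  \sum_(k <- D) nsq (coef (fun t => \sum_i H i t) (k%:~R - a)) * (1 + ((k%:~R - a) / K) ^+ 2) <=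
    M%:R * w * (A + 4 * B / K ^+ 2).
Proof.
move=> uD K0; have K2 : 0 < K ^+ 2 by rewrite exprn_gt0.
under eq_bigr do rewrite mulrDr mulr1 exprMn mulrA exprVn.
rewrite big_split /= -mulr_suml.
have h1 := pieces_energy a uD; have h2 := pieces_energy_derivative a uD.
have -> : M%:R * w * (A + 4 * B / K ^+ 2) = M%:R * w * A + (4 * M%:R * w * B) / K ^+ 2 by ring.
by apply: lerD => //; rewrite ler_wpM2r// invr_ge0 ltW.
Qed.

End pieces.
End disjoint_pieces.

(** * Limits of sequences with telescoping error *)

Section limits.
Variable R : realType.
Implicit Types (u v e : nat -> R) (l c : R).

Lemma lim_le_cst u l c N : u @ \oo --> l -> (forall n, (N <= n)%N -> u n <= c) -> l <= c.
Proof.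
move=> ul uc; apply: (ler_cvg_to ul (cvg_cst c)).
by exists N => // n /= Nn; exact: uc.
Qed.
Lemma lim_ge_cst u l c N : u @ \oo --> l -> (forall n, (N <= n)%N -> c <= u n) -> c <= l.
Proof.
move=> ul uc; apply: (ler_cvg_to (cvg_cst c) ul).
by exists N => // n /= Nn; exact: uc.
Qed.

(** The sequences u - e and u + e are monotone in opposite directions and bounded; u is half their
    sum, and its limit is trapped between them. *)
Lemma telescoping_cvg u e : (forall n, 0 <= e n) ->
  (forall n, `|u n.+1 - u n| <= e n - e n.+1) ->
  u @ \oo --> limn u /\ forall n, `|u n - limn u| <= e n.
Proof.
move=> e0 ue.
have B n k : `|u (n + k)%N - u n| <= e n - e (n + k)%N.
  elim: k => [|k IH]; first by rewrite addn0 !subrr normr0.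
  rewrite addnS (le_trans (ler_distD (u (n + k)%N) _ _))//.
  have := ue (n + k)%N; lra.
have up : {homo (fun n => u n - e n) : n m / (n <= m)%N >-> n <= m}.
  move=> n m /subnKC <-; have := B n (m - n)%N; rewrite ler_norml => /andP[]; lra.
have dn : {homo (fun n => u n + e n) : n m / (n <= m)%N >-> m <= n}.
  move=> n m /subnKC <-; have := B n (m - n)%N; rewrite ler_norml => /andP[]; lra.
have B0 n : `|u n - u 0%N| <= e 0%N.
  have := B 0%N n; rewrite add0n; have := e0 n; lra.
have eB n : e n <= e 0%N.
  have := B 0%N n; rewrite add0n => /(le_trans (normr_ge0 _)); lra.
have c1 : cvgn (fun n => u n - e n).
  apply: nondecreasing_is_cvgn => //; exists (u 0%N + e 0%N) => _ [n _ <-].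
  have := B0 n; have := e0 n; rewrite ler_norml => ? /andP[]; lra.
have c2 : cvgn (fun n => u n + e n).
  apply: nonincreasing_is_cvgn => //; exists (u 0%N - e 0%N) => _ [n _ <-].
  have := B0 n; have := e0 n; rewrite ler_norml => ? /andP[]; lra.
have cu : cvgn u.
  have -> : u = (fun n => 2^-1 * ((u n - e n) + (u n + e n))).
    by apply/funext => n; field.
  apply/cvg_ex; exists (2^-1 * (limn (fun n => u n - e n) + limn (fun n => u n + e n))).
  by apply: cvgM; [exact: cvg_cst|exact: cvgD].
split=> // n; rewrite ler_norml; apply/andP; split.
  have : limn u <= u n + e n; last lra.
  apply: (lim_le_cst (N := n)) cu _ => m /dn; have := e0 m; lra.
have : u n - e n <= limn u; last lra.
apply: (lim_ge_cst (N := n)) cu _ => m /up; have := e0 m; lra.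
Qed.

Lemma lim_uniq u l l' : u @ \oo --> l -> u @ \oo --> l' -> l = l'.
Proof. exact: cvg_unique. Qed.

Lemma cvg_eventually_eq u v l : u @ \oo --> l -> (forall n, v n.+1 = u n) -> v @ \oo --> l.
Proof.
move=> ul vu; rewrite -cvg_shiftS; suff -> : [sequence v n.+1]_n = u by [].
by apply/funext => n; exact: vu.
Qed.
End limits.

(** * Cantor-like staircases and their primitives *)

Section cascade.
Variable R : realType.
Variables (w h : nat -> R) (halve : nat -> bool).
Hypothesis w_gt0 : forall m, 0 < w m.
Hypothesis wS : forall m, w m.+1 = w m / 2.
Hypothesis h_gt0 : forall m, 0 < h m.
Hypothesis hS : forall m, h m.+1 = if halve m then h m / 2 else h m.
Implicit Types (m n d : nat) (s t : R).

Lemma w_le m d : w (m + d) <= w m.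
Proof.
elim: d => [|d IH]; first by rewrite addn0.
by rewrite addnS wS; have := w_gt0 (m + d); lra.
Qed.
Lemma h_le m d : h (m + d) <= h m.
Proof.
elim: d => [|d IH]; first by rewrite addn0.
by rewrite addnS hS; have := h_gt0 (m + d); case: (halve _); lra.
Qed.

(* When [halve m], the jump [h m] at [0] splits into two jumps [h m.+1] at distance
   [w m.+1]: [stair] rises from [0] to [h m] on [[0, w m]] and [prim] is its primitive. *)
Fixpoint casc (base : nat -> R -> R) n m t : R :=
  if n is n'.+1 then
    if halve m then casc base n' m.+1 t + casc base n' m.+1 (t - w m.+1)
    else casc base n' m.+1 t
  else base m t.

Definition stair_approx := casc (fun m t => h m * (0 <= t)%R%:R).
Definition prim_approx := casc (fun m t => h m * Num.max t 0).

Lemma stair_approxS n m t : stair_approx n.+1 m t =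
  if halve m then stair_approx n m.+1 t + stair_approx n m.+1 (t - w m.+1)
  else stair_approx n m.+1 t.
Proof. by []. Qed.
Lemma stair_approx0 m t : stair_approx 0 m t = if 0 <= t then h m else 0.
Proof. by rewrite /stair_approx /=; case: (0 <= t); rewrite ?mulr1 ?mulr0. Qed.
Lemma prim_approxS n m t : prim_approx n.+1 m t =
  if halve m then prim_approx n m.+1 t + prim_approx n m.+1 (t - w m.+1)
  else prim_approx n m.+1 t.
Proof. by []. Qed.
Lemma prim_approx0 m t : prim_approx 0 m t = h m * Num.max t 0.
Proof. by []. Qed.

Lemma stair_approx_lt0 n m t : t < 0 -> stair_approx n m t = 0.
Proof.
elim: n m t => [|n IH] m t t0; first by rewrite stair_approx0 lt_geF.
rewrite stair_approxS; case: (halve m); last exact: IH.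
by rewrite !IH ?addr0//; have := w_gt0 m.+1; lra.
Qed.

Lemma stair_approx_ge n m t : w m <= t -> stair_approx n m t = h m.
Proof.
elim: n m t => [|n IH] m t tw.
  by rewrite stair_approx0 (le_trans (ltW (w_gt0 m)) tw).
rewrite stair_approxS.
have w1 := w_gt0 m.+1; have w2 := wS m; have := hS m.
by case: (halve m) => h1; rewrite !IH; lra.
Qed.

Lemma stair_approx_bounds n m t : 0 <= stair_approx n m t <= h m.
Proof.
elim: n m t => [|n IH] m t.
  by rewrite stair_approx0; have := h_gt0 m; case: ifP => _; lra.
rewrite stair_approxS; have := hS m; case: (halve m) => h1; last by rewrite -h1.
by have := IH m.+1 t; have := IH m.+1 (t - w m.+1); lra.
Qed.

(** At each point at least one of the two half-staircases is constant in [n], being either not begun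
    or complete. So the change is that of a single copy and does not double through the
    recursion. *)
Lemma stair_approx_step n m t :
  `|stair_approx n.+1 m t - stair_approx n m t| <= h (m + n) - h (m + n).+1.
Proof.
elim: n m t => [|n IH] m t.
  rewrite addn0 stair_approxS !stair_approx0; have := hS m; have h0 := h_gt0 m.
  have w1 := w_gt0 m.+1.
  case: (halve m) => -> ; last by rewrite !subrr normr0.
  rewrite ler_norml; case: (leP 0 t) => h1; case: (leP 0 (t - w m.+1)) => h2; lra.
rewrite addnS -addSn (stair_approxS n.+1 m) (stair_approxS n m).
case: (halve m); last exact: IH.
have [tw|tw] := ltP t (w m.+1).
  have tw' : t - w m.+1 < 0 by lra.
  by rewrite (stair_approx_lt0 n.+1 m.+1 tw') (stair_approx_lt0 n m.+1 tw') !addr0.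
rewrite (stair_approx_ge n.+1 tw) (stair_approx_ge n tw).
by have := IH m.+1 (t - w m.+1); rewrite opprD addrACA subrr add0r.
Qed.


(* A window that sticks out of [0, w m] meets only one end of the staircase;
   this keeps the bound from doubling when a window straddles the two halves. *)
Lemma stair_approx_window d m n s t : (d <= n)%N -> 0 <= s <= w (m + d) ->
  stair_approx n m (t + s) - stair_approx n m t <= 2 * h (m + d) /\
  (t < 0 \/ w m <= t + s -> stair_approx n m (t + s) - stair_approx n m t <= h (m + d)).
Proof.
elim: d m n t => [|d IH] m n t dn /andP[s0 sw].
  rewrite addn0; have := stair_approx_bounds n m t.
  by have := stair_approx_bounds n m (t + s); have := h_gt0 m; split=> *; lra.
case: n dn => // n dn.
have w1 := w_gt0 m.+1; have w2 := wS m.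
have sw1 : s <= w m.+1 by apply: le_trans sw _; rewrite addnS -addSn; exact: w_le.
have sw' : 0 <= s <= w (m.+1 + d) by rewrite s0 addSn -addnS.
have [A1 A2] := IH m.+1 n t dn sw'.
have [B1 B2] := IH m.+1 n (t - w m.+1) dn sw'.
rewrite addnS -addSn !stair_approxS.
case: (halve m); last first.
  by split=> // -[h1|h1]; apply: A2; [left|right; lra].
have E : t - w m.+1 + s = t + s - w m.+1 by ring.
rewrite E in B1 B2.
have h0 := h_gt0 (m.+1 + d).
have [h1|h1] := ltP (t + s) (w m.+1).
  rewrite !(@stair_approx_lt0 n m.+1 (_ - _)) ?addr0; [|lra..].
  by split=> // -[h2|h2]; apply: A2; [left|lra].
have [h2|h2] := leP (w m.+1) t.
  rewrite (@stair_approx_ge n m.+1 t)// (@stair_approx_ge n m.+1 (t + s))// opprD addrACA subrr add0r.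
  by split=> // -[h3|h3]; [lra|apply: B2; right; lra].
have {}A2 := A2 (or_intror h1).
have {}B2 : stair_approx n m.+1 (t + s - w m.+1) - stair_approx n m.+1 (t - w m.+1) <= h (m.+1 + d).
  by apply: B2; left; lra.
rewrite opprD addrACA; split; first lra.
by case=> h3; lra.
Qed.

Lemma prim_approx_le0 n m t : t <= 0 -> prim_approx n m t = 0.
Proof.
elim: n m t => [|n IH] m t t0; first by rewrite prim_approx0 max_r// mulr0.
rewrite prim_approxS; case: (halve m); last exact: IH.
by rewrite !IH ?addr0//; have := w_gt0 m.+1; lra.
Qed.

Lemma prim_approx_ge n m t : w m <= t ->
  prim_approx n m t = prim_approx n m (w m) + h m * (t - w m).
Proof.
elim: n m t => [|n IH] m t tw.
  have w1 := w_gt0 m; rewrite !prim_approx0 !max_l; [|lra..]; ring.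
rewrite !prim_approxS.
have w1 := w_gt0 m.+1; have w2 := wS m; have := hS m.
have wm : w m.+1 <= w m by lra.
have wt : w m.+1 <= t by lra.
case: (halve m) => h1.
  have wm1 : w m.+1 <= w m - w m.+1 by lra.
  have wt1 : w m.+1 <= t - w m.+1 by lra.
  by rewrite (IH _ _ wm) (IH _ _ wt) (IH _ _ wm1) (IH _ _ wt1) h1; field.
by rewrite (IH _ _ wm) (IH _ _ wt) h1; ring.
Qed.

(** A halving step reproduces this bound exactly; a step that keeps the height completes the whole
    rise in the left half of [[0, w m]], which gives more. The bound is what makes a block visibly
    non-affine. *)
Lemma prim_approx_w n m : h m * w m / 2 <= prim_approx n m (w m).
Proof.
elim: n m => [|n IH] m.
  have w1 := w_gt0 m; have h1 := h_gt0 m; rewrite prim_approx0 max_l; last lra.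
  by have := mulr_gt0 h1 w1; lra.
rewrite prim_approxS.
have w1 := w_gt0 m.+1; have w2 := wS m; have h2 := hS m; have h1 := h_gt0 m.
have wm : w m.+1 <= w m by lra.
have := IH m.+1; rewrite (prim_approx_ge _ wm).
have -> : w m - w m.+1 = w m.+1 by lra.
have hw := mulr_gt0 h1 w1.
by have -> : w m = 2 * w m.+1 by [lra]; move: h2; case: (halve m) => ->; lra.
Qed.

(** The staircase is nondecreasing and is the slope of its primitive. This integrated form passes to
    the limit, where no derivative of [prim] needs to be computed. *)
Lemma prim_approx_slope n m s t : 0 <= s ->
  s * stair_approx n m t <= prim_approx n m (t + s) - prim_approx n m t <= s * stair_approx n m (t + s).
Proof.
elim: n m t => [|n IH] m t s0.
  rewrite !stair_approx0 !prim_approx0 -mulrBr; have h0 := h_gt0 m.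
  have [h1|h1] := leP 0 t; have [h2|h2] := leP 0 (t + s); try lra.
  - rewrite subr0 mulr0 mulr_ge0 ?(ltW h0)//= (mulrC s).
    by apply: ler_wpM2l; lra.
have := IH m.+1 t s0; have := IH m.+1 (t - w m.+1) s0.
have -> : t - w m.+1 + s = t + s - w m.+1 by ring.
rewrite !stair_approxS !prim_approxS; case: (halve m) => //.
rewrite !mulrDr; lra.
Qed.

Lemma prim_approx_step n m t :
  `|prim_approx n.+1 m t - prim_approx n m t| <= h m * w (m + n).
Proof.
elim: n m t => [|n IH] m t.
  rewrite addn0 prim_approxS !prim_approx0; have := hS m; have h0 := h_gt0 m.
  have w1 := w_gt0 m.+1; have w2 := wS m; have hw := mulr_gt0 h0 w1.
  have hw2 : h m * w m = 2 * (h m * w m.+1) by rewrite w2; field.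
  case: (halve m) => -> ; last by rewrite !subrr normr0; lra.
  have [h1|h1] := leP t 0; have [h2|h2] := leP (t - w m.+1) 0; rewrite ler_norml; try lra.
    have := mulr_gt0 h0 h1; have : h m * t <= h m * w m.+1 by apply: ler_wpM2l; lra.
    lra.
rewrite addnS -addSn (prim_approxS n.+1 m) (prim_approxS n m).
have := hS m; case: (halve m) => h1; last by rewrite -h1; exact: IH.
have := IH m.+1 t; have := IH m.+1 (t - w m.+1).
rewrite !ler_norml h1; lra.
Qed.

Definition stair m t : R := limn (fun n => stair_approx n m t).
Definition prim m t : R := limn (fun n => prim_approx n m t).

Lemma stair_cvg m t : (fun n => stair_approx n m t) @ \oo --> stair m t.
Proof.
have [|n|//] := @telescoping_cvg R (fun n => stair_approx n m t) (fun n => h (m + n)).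
  by move=> n; exact: ltW.
by rewrite addnS; exact: stair_approx_step.
Qed.

Lemma prim_cvg m t : (fun n => prim_approx n m t) @ \oo --> prim m t.
Proof.
have [|n|//] := @telescoping_cvg R (fun n => prim_approx n m t) (fun n => 2 * h m * w (m + n)).
  by move=> n; rewrite !mulr_ge0// ltW.
rewrite addnS wS; have := prim_approx_step n m t; lra.
Qed.

Lemma primS m t : prim m t =
  if halve m then prim m.+1 t + prim m.+1 (t - w m.+1) else prim m.+1 t.
Proof.
apply: (lim_uniq (@prim_cvg m t)).
apply: (@cvg_eventually_eq _ (fun n => prim_approx n.+1 m t)) => //.
rewrite (_ : (fun n => _) = fun n => if halve m then prim_approx n m.+1 t +
   prim_approx n m.+1 (t - w m.+1) else prim_approx n m.+1 t) //.
case: (halve m); last exact: prim_cvg.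
by apply: cvgD; exact: prim_cvg.
Qed.

Lemma prim_le0 m t : t <= 0 -> prim m t = 0.
Proof.
move=> t0; apply: (lim_uniq (@prim_cvg m t)).
rewrite (_ : (fun n => _) = fun=> 0); first exact: cvg_cst.
by apply/funext => n; rewrite prim_approx_le0.
Qed.

Lemma prim_ge m t : w m <= t -> prim m t = prim m (w m) + h m * (t - w m).
Proof.
move=> t0; apply: (lim_uniq (@prim_cvg m t)).
rewrite (_ : (fun n => _) = fun n => prim_approx n m (w m) + h m * (t - w m)); last first.
  by apply/funext => n; rewrite prim_approx_ge.
by apply: cvgD; [exact: prim_cvg|exact: cvg_cst].
Qed.

Lemma prim_w m : h m * w m / 2 <= prim m (w m).
Proof. by apply: (lim_ge_cst (N := 0%N)) (@prim_cvg m _) _ => n _; exact: prim_approx_w. Qed.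

Lemma stair_bounds m t : 0 <= stair m t <= h m.
Proof.
apply/andP; split.
  by apply: (lim_ge_cst (N := 0%N)) (@stair_cvg m _) _ => n _; case/andP: (stair_approx_bounds n m t).
by apply: (lim_le_cst (N := 0%N)) (@stair_cvg m _) _ => n _; case/andP: (stair_approx_bounds n m t).
Qed.

Lemma prim_slope m s t : 0 <= s ->
  s * stair m t <= prim m (t + s) - prim m t <= s * stair m (t + s).
Proof.
move=> s0; have cB : (fun n => prim_approx n m (t + s) - prim_approx n m t) @ \oo --> prim m (t + s) - prim m t.
  by apply: cvgB; exact: prim_cvg.
have cM u : (fun n => s * stair_approx n m u) @ \oo --> s * stair m u.
  by apply: cvgM; [exact: cvg_cst|exact: stair_cvg].
by apply/andP; split; [apply: (ler_cvg_to (cM _) cB)|apply: (ler_cvg_to cB (cM _))];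
  exists 0%N => // n _ /=; case/andP: (prim_approx_slope n m t s0).
Qed.

Lemma prim_lip m : lip (prim m) (h m).
Proof.
move=> s t; wlog st : s t / s <= t => [W|].
  by have [/W//|/ltW/W] := leP s t; rewrite distrC (distrC t).
have s0 : 0 <= t - s by lra.
have := prim_slope m s s0; rewrite subrKC.
have := stair_bounds m s; have := stair_bounds m t => /andP[_ h1] /andP[h2 _] /andP[h3 h4].
have h5 := mulr_ge0 s0 h2.
have h6 : (t - s) * stair m t <= (t - s) * h m by rewrite ler_wpM2l.
by rewrite distrC (distrC s) ger0_norm ?(ger0_norm s0); lra.
Qed.

Lemma stair_window d m s t : 0 <= s <= w (m + d) -> stair m (t + s) - stair m t <= 2 * h (m + d).
Proof.
move=> sw.
have cB : (fun n => stair_approx n m (t + s) - stair_approx n m t) @ \oo --> stair m (t + s) - stair m t.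
  by apply: cvgB; exact: stair_cvg.
apply: (lim_le_cst (N := d)) cB _ => n dn.
by have [] := stair_approx_window t dn sw.
Qed.

Fixpoint offsets d m : seq R :=
  if d is d'.+1 then
    if halve m then offsets d' m.+1 ++ [seq x + w m.+1 | x <- offsets d' m.+1]
    else offsets d' m.+1
  else [:: 0].

Lemma size_offsets d m : (size (offsets d m))%:R * h (m + d) = h m.
Proof.
elim: d m => [|d IH] m; first by rewrite addn0 mul1r.
rewrite addnS -addSn /=; have := hS m; have := IH m.+1.
case: (halve m) => h1 h2; last by rewrite h1.
by rewrite size_cat size_map natrD mulrDl h1 h2; field.
Qed.

Lemma offsets_bounds d m x : x \in offsets d m -> 0 <= x <= w m - w (m + d).
Proof.
elim: d m x => [|d IH] m x; first by rewrite inE => /eqP ->; rewrite addn0 subrr lexx.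
rewrite addnS -addSn /=; have w1 := w_gt0 m.+1; have w2 := wS m.
case: (halve m); last by move=> /IH; lra.
by rewrite mem_cat => /orP[/IH|/mapP[z /IH hz ->]]; lra.
Qed.

Lemma offsets_sep d m : pairwise (fun x y => x + w (m + d) <= y) (offsets d m).
Proof.
elim: d m => [|d IH] m //; rewrite addnS -addSn /=.
case: (halve m); last exact: IH.
rewrite pairwise_cat IH /= pairwise_map.
apply/andP; split; last first.
  by apply: sub_pairwise (IH m.+1) => x y /=; lra.
apply/allrelP => x y /offsets_bounds h1 /mapP[z /offsets_bounds h2 ->]; lra.
Qed.

Lemma prim_offsets d m t : prim m t = \sum_(x <- offsets d m) prim (m + d) (t - x).
Proof.
elim: d m t => [|d IH] m t; first by rewrite big_seq1 subr0 addn0.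
rewrite primS addnS -addSn /=; case: (halve m); last exact: IH.
rewrite big_cat big_map /= -IH; congr (_ + _); rewrite IH.
by apply: eq_bigr => x _; congr prim; ring.
Qed.

End cascade.

(** * Spectrum of the exponential of a function affine between short nodes *)

Section node_decomposition.
Variable R : realType.
Implicit Types (z : R[i]) (x t s : R) (D : seq int).
Local Notation tau := (2 * @pi R).

Definition clip (f : R -> R[i]) K := forall s t, normc (f s - f t) <= K * `|s - t|.

Lemma clip_cis (g : R -> R) K : lip g K -> clip (fun t => cis (g t)) K.
Proof. by move=> gK s t; apply: le_trans (gK s t); exact: normc_cisB. Qed.
Lemma clipB f g K L : clip f K -> clip g L -> clip (fun t => f t - g t) (K + L).
Proof.
move=> fK gL s t; rewrite mulrDl; apply: le_trans (lerD (fK s t) (gL s t)).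
by apply: le_trans (le_normcB _ _); rewrite (_ : f s - g s - (f t - g t) = f s - f t - (g s - g t))//; ring.
Qed.
Lemma clip_cst z : clip (fun=> z) 0.
Proof. by move=> s t; rewrite subrr mul0r ComplexField.Normc.normc0. Qed.
Lemma clipM f g K L A B : (forall t, normc (f t) <= A) -> (forall t, normc (g t) <= B) ->
  clip f K -> clip g L -> clip (fun t => f t * g t) (A * L + B * K).
Proof.
move=> fA gB fK gL s t; have -> : f s * g s - f t * g t = f s * (g s - g t) + g t * (f s - f t).
  by ring.
apply: le_trans (le_normcD _ _) _; rewrite !ComplexField.Normc.normcM mulrDl -!mulrA.
by apply: lerD; apply: ler_pM; rewrite ?normc_ge0.
Qed.
Lemma clip_le f K L : K <= L -> clip f K -> clip f L.
Proof. by move=> KL fK s t; apply: le_trans (fK s t) _; rewrite ler_wpM2r. Qed.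
Lemma clip_real (g : R -> R) K : lip g K -> clip (fun t => rc (g t)) K.
Proof. by move=> gK s t; rewrite -rmorphB normc_real; exact: gK. Qed.

Lemma lipZ (g : R -> R) (c K : R) : lip g K -> lip (fun t => c * g t) (`|c| * K).
Proof. by move=> gK s t; rewrite -mulrBr normrM -mulrA ler_wpM2l. Qed.
Lemma lip_affine (a b : R) : lip (fun t => a * t + b) `|a|.
Proof. by move=> s t; rewrite opprD addrACA subrr addr0 -mulrBr normrM. Qed.

Lemma step_ramp_le0 (l y t : R) : 0 < l -> t <= y -> step_ramp l y t = 0.
Proof. by move=> l0 ty; rewrite /step_ramp !ramp0 ?subrr ?mulr0//; lra. Qed.
Lemma step_ramp_ge1 (l y t : R) : 0 < l -> y + l <= t -> step_ramp l y t = 1.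
Proof.
move=> l0 ty; rewrite /step_ramp !rampE//; last lra.
by have -> : t - y - (t - (y + l)) = l by [ring]; rewrite mulVf// gt_eqF.
Qed.
Lemma step_ramp_bounds (l y t : R) : 0 < l -> 0 <= step_ramp l y t <= 1.
Proof.
move=> l0; have [h1|h1] := leP t y; first by rewrite step_ramp_le0// lexx ler01.
have [h2|h2] := leP (y + l) t; first by rewrite step_ramp_ge1// lexx ler01.
rewrite /step_ramp rampE ?(ltW h1)// ramp0 ?(ltW h2)// subr0 mulr_ge0 ?invr_ge0 ?(ltW l0)//=; last lra.
rewrite ler_pdivrMl//; lra.
Qed.
Lemma step_ramp_lip (l y : R) : 0 < l -> lip (step_ramp l y) (2 / l).
Proof.
move=> l0 s t; rewrite /step_ramp -mulrBr normrM gtr0_norm ?invr_gt0// (mulrC 2) -mulrA.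
rewrite ler_wpM2l ?invr_ge0 ?(ltW l0)//.
have h1 := ramp_lip y s t; have h2 := ramp_lip (y + l) s t.
have := ler_normB (ramp y s - ramp y t) (ramp (y + l) s - ramp (y + l) t).
have -> : ramp y s - ramp (y + l) s - (ramp y t - ramp (y + l) t) =
  ramp y s - ramp y t - (ramp (y + l) s - ramp (y + l) t) by ring.
lra.
Qed.

Variables (M : nat) (y q : nat -> R) (w hh c0 N mu : R) (B : R -> R).
Hypothesis M_gt0 : (0 < M)%N.
Hypothesis w_gt0 : 0 < w.
Hypothesis w_le1 : w <= 1.
Hypothesis hh_gt0 : 0 < hh.
Hypothesis N_ge1 : 1 <= N.
Hypothesis MN : M%:R <= 3 * N.
Hypothesis y0 : forall i, (i < M)%N -> 0 < y i.
Hypothesis ytau : forall i, (i < M)%N -> y i + w <= tau.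
Hypothesis ysep : forall i j, (i < j)%N -> (j < M)%N -> y i + w <= y j.
Hypothesis B_le0 : forall t, t <= 0 -> B t = 0.
Hypothesis B_ge : forall t, w <= t -> B t = hh * t + c0.
Hypothesis B_lip : lip B hh.
Hypothesis q_le2 : forall i, `|q i| <= 2.
Let sl i : R := \sum_(l < i) q l.
Let beta i : R := \sum_(l < i) q l * (c0 - hh * y l).
Hypothesis sl_le : forall i, (i < M)%N -> `|sl i| <= N.
Hypothesis slM : sl M = 0.
Hypothesis betaM : beta M = 0.
Hypothesis sl_spread : forall b : R, \sum_(i < M) cauchy_wt 1 (b - sl i) <= 24.
Hypothesis mu_large : 1 <= w * (`|mu| * hh).

(* To the left of the node [y i], the exponent [mu * psi] is the affine function
   [mu * L i], with exponential [e i].  The term [H i], supported in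
   [[y i, y i + w]], is the error made when the transition from [e i] to [e i.+1]
   is replaced by the ramp [th i]. *)
Let psi t := \sum_(l < M) q l * B (t - y l).
Let L i t := hh * sl i * t + beta i.
Let e i t : R[i] := cis (mu * hh * sl i * t + mu * beta i).
Let th i t := step_ramp w (y i) t.
Let lin i t := mu * q i * hh * t + mu * q i * (c0 - hh * y i).
Let H (i : 'I_M) t : R[i] :=
  e i t * (cis (mu * q i * B (t - y i)) - 1 - rc (th i t) * (cis (lin i t) - 1)).
Let K := `|mu| * hh * N.

Lemma node_eS i t : e i.+1 t = e i t * cis (lin i t).
Proof.
rewrite /e /lin -cisD /sl /beta !big_ord_recr /=; congr cis; ring.
Qed.

Lemma node_psi t i : (i <= M)%N -> (forall l, (l < i)%N -> y l + w <= t) ->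
  \sum_(l < i) q l * B (t - y l) = L i t.
Proof.
move=> iM yt; rewrite /L /sl /beta mulr_sumr mulr_suml -big_split /=.
by apply: eq_bigr => l _; rewrite B_ge; [ring|have := yt l (ltn_ord l); lra].
Qed.

(** Telescoping over the partial sums of the exponent. Before [y i] the increment vanishes; after it
    the earlier transitions are complete, by the separation of the nodes, and the previous partial
    exponential is exactly [e i]. *)
Lemma node_split t : cis (mu * psi t) - 1 =
  \sum_(i < M) H i t + \sum_(i < M) rc (th i t) * (e i.+1 t - e i t).
Proof.
pose E i : R[i] := cis (mu * \sum_(l < i) q l * B (t - y l)).
have -> : cis (mu * psi t) - 1 = \sum_(i < M) (E i.+1 - E i).
  have -> : 1 = E 0%N by rewrite /E big_ord0 mulr0 cis0.
  rewrite -[cis _]/(E M); elim: (M) => [|n IH]; first by rewrite big_ord0 subrr.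
  by rewrite big_ord_recr /= -IH; ring.
rewrite -big_split /=; apply: eq_bigr => i _; rewrite node_eS /H.
have -> : E i.+1 = E i * cis (mu * q i * B (t - y i)).
  by rewrite /E -cisD big_ord_recr /=; congr cis; ring.
have [h|h] := leP t (y i); first by rewrite B_le0 ?mulr0 ?cis0 /th ?step_ramp_le0//; [ring|lra].
have -> : E i = e i t.
  rewrite /E (@node_psi t i (ltnW (ltn_ord i))); first by rewrite /L /e; congr cis; ring.
  by move=> l li; apply: le_trans (ltW h); exact: ysep.
ring.
Qed.

Lemma node_H0 (i : 'I_M) t : t <= y i \/ y i + w <= t -> H i t = 0.
Proof.
rewrite /H => -[h|h].
  by rewrite B_le0 ?mulr0 ?cis0 /th ?step_ramp_le0//; [ring|lra].
rewrite /th step_ramp_ge1// B_ge; last lra.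
have -> : mu * q i * (hh * (t - y i) + c0) = lin i t by rewrite /lin; ring.
by rewrite rmorph1; ring.
Qed.

Let normc_cisB1 x : normc (cis x - 1) <= 2.
Proof. by have := le_normcB (cis x) 1; rewrite normc_cis ComplexField.Normc.normc1; lra. Qed.

Let K_ge : `|mu| * hh <= K.
Proof. by rewrite /K -[leLHS]mulr1 ler_wpM2l// mulr_ge0// ltW. Qed.
Let winv : w^-1 <= `|mu| * hh.
Proof. by rewrite -[w^-1]mul1r ler_pdivrMr// mulrC. Qed.
Let K_ge1 : 1 <= K.
Proof. by apply: le_trans K_ge; apply: le_trans winv; rewrite invf_ge1. Qed.

Lemma node_Om_le (i : 'I_M) t :
  normc (cis (mu * q i * B (t - y i)) - 1 - rc (th i t) * (cis (lin i t) - 1)) <= 4.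
Proof.
apply: le_trans (le_normcB _ _) _; rewrite ComplexField.Normc.normcM normc_real.
have := normc_cisB1 (mu * q i * B (t - y i)); have h := normc_cisB1 (lin i t).
have /andP[h0 h1] := step_ramp_bounds (y i) t w_gt0; rewrite /th (ger0_norm h0).
have : step_ramp w (y i) t * normc (cis (lin i t) - 1) <= 1 * 2.
  by apply: ler_pM => //; exact: normc_ge0.
lra.
Qed.

Lemma node_H_le (i : 'I_M) t : nsq (H i t) <= 16.
Proof.
have -> : 16 = 4 ^+ 2 :> R by rewrite expr2; lra.
by apply: nsq_le => //; rewrite ComplexField.Normc.normcM normc_cis mul1r; exact: node_Om_le.
Qed.

Lemma clip_cisB1 (g : R -> R) (k : R) : lip g k -> clip (fun t => cis (g t) - 1) k.
Proof. by move=> gk; rewrite -[k]addr0; apply: clipB (clip_cis gk) (@clip_cst 1). Qed.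

Lemma lip_le (g : R -> R) (k l : R) : k <= l -> lip g k -> lip g l.
Proof. by move=> kl gk s t; apply: le_trans (gk s t) _; rewrite ler_wpM2r. Qed.

Lemma node_H_clip (i : 'I_M) : clip (H i) (12 * K).
Proof.
have mh0 : 0 <= `|mu| * hh by rewrite mulr_ge0// ltW.
have q2 : `|mu * q i| * hh <= 2 * (`|mu| * hh).
  by rewrite normrM mulrAC mulrC ler_wpM2r.
have Bl : lip (fun t => B (t - y i)) hh.
  by move=> s t; have -> : s - t = (s - y i) - (t - y i) by [ring]; exact: B_lip.
have c1 := clip_cisB1 (lip_le q2 (lipZ (mu * q i) Bl)).
have Ll : lip (lin i) (2 * (`|mu| * hh)).
  apply: lip_le (@lip_affine _ _).
  by rewrite normrM (gtr0_norm hh_gt0).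
have c2 := clip_cisB1 Ll.
have th1 t : normc (rc (th i t)) <= 1.
  by rewrite normc_real; have /andP[h0 h1] := step_ramp_bounds (y i) t w_gt0; rewrite ger0_norm.
have c3 := clipM th1 (fun t => normc_cisB1 (lin i t)) (clip_real (step_ramp_lip (y i) w_gt0)) c2.
have el : lip (fun t => mu * hh * sl i * t + mu * beta i) K.
  apply: lip_le (@lip_affine _ _).
  by rewrite !normrM (gtr0_norm hh_gt0) ler_wpM2l// sl_le.
have e1 t : normc (e i t) <= 1 by rewrite normc_cis.
(* Of the 12 K, 4 K come from [e i] times the bound 4, 2 K from each of the two phases, and 4 K from
   the ramp: its slope 2 / w is at most 2 K because [mu_large] gives 1 / w <= K. *)
apply: clip_le (clipM e1 (@node_Om_le i) (clip_cis el) (clipB c1 c3)).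
have := K_ge; have := winv; lra.
Qed.

Lemma node_H_cont (i : 'I_M) : ccont (H i).
Proof.
have cl : continuous (lin i) by exact: cont_affine.
apply: ccontM; first by apply: ccont_cis; exact: cont_affine.
apply: ccontB; first apply: ccontB; [apply: ccont_cis|exact: ccont_cst|].
  apply: contM; first exact: contC.
  move=> t; apply: (@continuous_comp _ _ _ (fun t => t - y i) B); last exact: (lip_cont B_lip).
  by apply: contB; [exact: contI|exact: contC].
apply: ccontM; first by apply: ccont_real; exact: (lip_cont (step_ramp_lip (y i) w_gt0)).
by apply: ccontB; [exact: ccont_cis|exact: ccont_cst].
Qed.

Lemma abel_cyclic n (th' e' : nat -> R[i]) : e' n.+1 = e' 0%N ->
  \sum_(i < n.+1) th' i * (e' i.+1 - e' i) =
  \sum_(i < n.+1) e' i * (th' (if val i is j.+1 then j else n) - th' i).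
Proof.
move=> en; under eq_bigr do rewrite mulrBr.
under [RHS]eq_bigr do rewrite mulrBr.
rewrite !sumrB; congr (_ - _); last by apply: eq_bigr => i _; rewrite mulrC.
rewrite big_ord_recr [RHS]big_ord_recl /= en addrC mulrC; congr (_ + _).
by apply: eq_bigr => i _; rewrite mulrC.
Qed.

Let prv i := if i is j.+1 then j else M.-1.
Let T i t : R[i] := e i t * rc (th (prv i) t - th i t).
Let zeta i xi := xi - mu * hh * sl i.

(** Summation by parts regroups the sum by slope: each exponential now multiplies a difference of
    two ramps, which has coefficients of order zeta^-2. There is no boundary term, since by [slM]
    and [betaM] the exponent is again 0 after the last node and the sum is cyclic. *)
Lemma node_abel t : \sum_(i < M) rc (th i t) * (e i.+1 t - e i t) = \sum_(i < M) T i t.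
Proof.
have eM : e M t = e 0%N t.
  by rewrite /e slM betaM /sl /beta !big_ord0 !mulr0 mul0r addr0.
have -> : \sum_(i < M) T i t = \sum_(i < M) e i t * (rc (th (prv i) t) - rc (th i t)).
  by apply: eq_bigr => i _; rewrite /T rmorphB.
rewrite /prv; move: M_gt0 eM; case: (M) => // n _ /(@abel_cyclic n (fun i => rc (th i t)) (e^~ t)) ->.
by [].
Qed.

Lemma node_T_cont i : ccont (T i).
Proof.
apply: ccontM; first by apply: ccont_cis; exact: cont_affine.
by apply: ccont_real; apply: contB; exact: (lip_cont (step_ramp_lip _ w_gt0)).
Qed.

Lemma node_T_coef (i : 'I_M) xi : zeta i xi != 0 -> normc (coef (T i) xi) <= (w * zeta i xi ^+ 2)^-1.
Proof.
move=> z0; have pM : (prv i < M)%N.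
  by rewrite /prv; case: i {z0} => -[|j] /= h; [rewrite prednK|exact: ltnW].
rewrite coef_modulate; last first.
  by apply: ccont_real; apply: contB; exact: (lip_cont (step_ramp_lip _ w_gt0)).
rewrite ComplexField.Normc.normcM normc_cis mul1r.
by apply: normc_coef_trapezoid => //; [exact/ltW/y0|exact: ytau|exact/ltW/y0|exact: ytau].
Qed.

(** Frequencies within 1 / w of a slope, where the trapezoid bound says nothing; [Xi] measures the
    proximity to all the slopes together. *)
Let bad xi := [exists i : 'I_M, w * `|zeta i xi| < 1].
Let Xi xi : R := \sum_(i < M) cauchy_wt w^-1 (zeta i xi).

Lemma node_Xi_ge0 xi : 0 <= Xi xi.
Proof. by apply: sumr_ge0 => i _; exact/ltW/cauchy_wt_gt0. Qed.

(** By [mu_large] the unit |mu| hh of the slopes is at least 1 / w, so weights of width 1 / w are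
    dominated by weights of that unit width, and [sl_spread] applies after rescaling. *)
Lemma node_Xi_le xi : Xi xi <= 24.
Proof.
apply: le_trans (sl_spread (xi / (mu * hh))); apply: ler_sum => i _.
rewrite lef_pV2 ?posrE ?ltr_pwDl ?sqr_ge0// lerD2l divr1 invrK.
have m0 : mu * hh != 0.
  apply/eqP => h; move: mu_large; rewrite -(gtr0_norm hh_gt0) -normrM h normr0 mulr0; lra.
have [mu0 h0] : mu != 0 /\ hh != 0 by apply/andP; rewrite -negb_or -mulf_eq0.
have -> : xi / (mu * hh) - sl i = zeta i xi / (mu * hh) by rewrite /zeta; field; rewrite mu0 h0.
rewrite exprMn exprVn [leRHS]exprMn ler_wpM2l ?sqr_ge0//.
rewrite -[leLHS]mul1r ler_pdivrMr; last by rewrite exprn_even_gt0.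
apply: (@le_trans _ _ ((w * (`|mu| * hh)) ^+ 2)); first by rewrite exprn_ege1.
by rewrite !exprMn real_normK ?num_real.
Qed.

Lemma node_Xi_sum D a : uniq D -> \sum_(k <- D) Xi (k%:~R - a) <= M%:R * (8 / w).
Proof.
move=> uD; rewrite exchange_big /=.
apply: (@le_trans _ _ (\sum_(i < M) 8 / w)); last by rewrite sumr_const card_ord -[leLHS]mulr_natl.
apply: ler_sum => i _.
under eq_bigr do rewrite /zeta -addrA -opprD.
by apply: sum_cauchy_wt => //; rewrite invf_ge1.
Qed.

Lemma node_bad_Xi xi : bad xi -> 1 / 2 <= Xi xi.
Proof.
move=> /existsP[i hi]; rewrite /Xi (bigD1 i)//=.
apply: (@le_trans _ _ (cauchy_wt w^-1 (zeta i xi))); last first.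
  by rewrite lerDl sumr_ge0// => j _; exact/ltW/cauchy_wt_gt0.
rewrite div1r lef_pV2 ?posrE ?ltr_pwDl ?sqr_ge0// invrK.
have : (zeta i xi * w) ^+ 2 <= 1 ^+ 2.
  by apply: sqr_mono_abs; rewrite normr1 normrM (gtr0_norm w_gt0) mulrC ltW.
rewrite expr1n; lra.
Qed.

(** Chebyshev's inequality: a bad frequency has [Xi] at least 1 / 2, while [Xi] sums to at most 24 N
    / w. *)
Lemma node_bad_count D a : uniq D ->
  (count (fun k : int => bad (k%:~R - a)) D)%:R <= 48 * N / w.
Proof.
move=> uD; have h := node_Xi_sum a uD.
have : (count (fun k : int => bad (k%:~R - a)) D)%:R <= 2 * \sum_(k <- D) Xi (k%:~R - a).
  rewrite -sum1_count natr_sum mulr_sumr big_mkcond /=; apply: ler_sum => k _.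
  case: ifP => [/node_bad_Xi|_]; first lra.
  by have := node_Xi_ge0 (k%:~R - a); lra.
have : M%:R * (8 / w) <= 3 * N * (8 / w) by rewrite ler_wpM2r// divr_ge0// ltW.
have -> : 48 * N / w = 2 * (3 * N * (8 / w)) by ring.
lra.
Qed.

Let G t := \sum_(i < M) T i t.

(** When w |zeta| >= 1, 1 / (w zeta^2) <= 2 w / (1 + w^2 zeta^2). *)
Lemma node_G_coef xi : ~~ bad xi -> normc (coef G xi) <= 2 * w * Xi xi.
Proof.
move=> nb; rewrite coef_sum; last exact: node_T_cont.
apply: le_trans (normc_sum _ _ _) _; rewrite /Xi mulr_sumr; apply: ler_sum => i _.
have z1 : 1 <= w * `|zeta i xi|.
  by rewrite leNgt; apply: contra nb => h; apply/existsP; exists i.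
have z0 : zeta i xi != 0 by apply/eqP => h; move: z1; rewrite h normr0 mulr0; lra.
apply: le_trans (node_T_coef z0) _.
have z2 : 1 <= w ^+ 2 * zeta i xi ^+ 2.
  by rewrite -(real_normK (num_real (zeta i xi))) -exprMn exprn_ege1.
have p2 : 0 < zeta i xi ^+ 2 by rewrite exprn_even_gt0.
rewrite /cauchy_wt invrK ler_pdivlMr ?ltr_pwDl ?sqr_ge0// exprMn.
have wp : 0 < w * zeta i xi ^+ 2 by rewrite mulr_gt0.
rewrite ler_pdivrMl//.
have -> : w * zeta i xi ^+ 2 * (2 * w) = 2 * (w ^+ 2 * zeta i xi ^+ 2) by ring.
rewrite (mulrC (zeta i xi ^+ 2)); lra.
Qed.

(** The slopes are at most K in absolute value, so beyond 2 K the distance to each of them is at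
    least |xi| / 2. *)
Lemma node_G_coef_far xi : 2 * K < `|xi| -> normc (coef G xi) <= 4 * M%:R / (w * xi ^+ 2).
Proof.
move=> xK; rewrite coef_sum; last exact: node_T_cont.
apply: le_trans (normc_sum _ _ _) _.
have x0 : 0 < `|xi| by have := K_ge1; lra.
have x2 : 0 < xi ^+ 2 by rewrite -(real_normK (num_real xi)) exprn_gt0.
apply: (@le_trans _ _ (\sum_(i < M) 4 / (w * xi ^+ 2))); last first.
  by rewrite sumr_const card_ord -[leLHS]mulr_natl; rewrite [leLHS](_ : _ = 4 * M%:R / (w * xi ^+ 2))//; ring.
apply: ler_sum => i _.
have zx : `|xi| / 2 <= `|zeta i xi|.
  have := lerB_dist xi (mu * hh * sl i); rewrite -/(zeta i xi).
  have : `|mu * hh * sl i| <= K by rewrite !normrM (gtr0_norm hh_gt0) ler_wpM2l ?sl_le// mulr_ge0// ltW.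
  lra.
have z0 : zeta i xi != 0 by rewrite -normr_gt0; lra.
apply: le_trans (node_T_coef z0) _.
have := sqr_mono _ zx; rewrite real_normK ?num_real// exprMn real_normK ?num_real// => /(_ _) h.
have {}h : xi ^+ 2 / 4 <= zeta i xi ^+ 2 by have := h ltac:(lra); lra.
have -> : 4 / (w * xi ^+ 2) = (w * (xi ^+ 2 / 4))^-1.
  have xn : xi != 0 by rewrite -normr_gt0.
  by field; rewrite xn gt_eqF.
rewrite lef_pV2 ?posrE; first by rewrite ler_pM2l.
  by rewrite mulr_gt0// exprn_even_gt0.
by rewrite mulr_gt0// divr_gt0.
Qed.

(** Used with u = xi^2 and v = K^2. Cleared of denominators it is the square of 4 (v + u) <= 5 u,
    that is 4 v <= u. *)
Lemma far_arith (u v : R) : 0 < v -> 4 * v <= u ->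
  16 * ((v + u) / v) / u ^+ 2 <= 25 / (v ^+ 2 * ((v + u) / v)).
Proof.
move=> v0 vu; have u0 : 0 < u by lra.
have s0 : 0 < v + u by lra.
have -> : 16 * ((v + u) / v) / u ^+ 2 = 16 * (v + u) ^+ 2 / (v * u ^+ 2 * (v + u)).
  by field; rewrite !gt_eqF.
have -> : 25 / (v ^+ 2 * ((v + u) / v)) = 25 * u ^+ 2 / (v * u ^+ 2 * (v + u)).
  by field; rewrite !gt_eqF.
apply: ler_wpM2r; last nra.
by rewrite invr_ge0; apply/ltW; rewrite !mulr_gt0 ?exprn_gt0.
Qed.

Lemma node_cK0 : 0 <= 25 * M%:R ^+ 2 / (w ^+ 2 * K ^+ 4).
Proof.
have K0 : 0 <= K by have := K_ge1; lra.
apply: divr_ge0; first by apply: mulr_ge0 => //; exact: sqr_ge0.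
by apply: mulr_ge0; [exact: sqr_ge0|exact: exprn_ge0].
Qed.

(** Up to 2 K the additional weight is at most 5, and one factor [Xi] <= 24 makes the square linear,
    hence summable over frequencies: 4 * 5 * 24 = 480. Beyond, the decay xi^-4 beats the weight and
    leaves a Cauchy weight of width K. *)
Lemma node_G_weighted xi : ~~ bad xi ->
  nsq (coef G xi) * (1 + (xi / K) ^+ 2) <=
    480 * w ^+ 2 * Xi xi + 25 * M%:R ^+ 2 / (w ^+ 2 * K ^+ 4) * cauchy_wt K xi.
Proof.
move=> nb; have K1 := K_ge1; have K0 : 0 < K by lra.
have X0 := node_Xi_ge0 xi; have X24 := node_Xi_le xi.
have g0 := nsq_ge0 (coef G xi).
have K2 : 0 < K ^+ 2 by rewrite exprn_gt0.
have w2 : 0 < w ^+ 2 by rewrite exprn_gt0.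
have cK0 := node_cK0.
have [xK|xK] := leP `|xi| (2 * K).
  apply: (@le_trans _ _ (480 * w ^+ 2 * Xi xi)); last first.
    by rewrite lerDl; apply: mulr_ge0 => //; exact/ltW/cauchy_wt_gt0.
  have h1 : nsq (coef G xi) <= (2 * w * Xi xi) ^+ 2.
    by apply: nsq_le (node_G_coef nb); rewrite !mulr_ge0// ltW.
  have h2 : 1 + (xi / K) ^+ 2 <= 5.
    rewrite exprMn exprVn -lerBrDl ler_pdivrMr//.
    have : xi ^+ 2 <= (2 * K) ^+ 2 by apply: sqr_mono_abs; rewrite (ger0_norm (_ : 0 <= 2 * K)); lra.
    rewrite exprMn; lra.
  apply: (@le_trans _ _ ((2 * w * Xi xi) ^+ 2 * 5)).
    by apply: ler_pM => //; rewrite addr_ge0 ?sqr_ge0.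
  have -> : (2 * w * Xi xi) ^+ 2 * 5 = 20 * w ^+ 2 * (Xi xi * Xi xi) by ring.
  have -> : 480 * w ^+ 2 * Xi xi = 20 * w ^+ 2 * (24 * Xi xi) by ring.
  by apply: ler_wpM2l; [rewrite mulr_ge0// ltW|rewrite ler_wpM2r].
apply: (@le_trans _ _ (25 * M%:R ^+ 2 / (w ^+ 2 * K ^+ 4) * cauchy_wt K xi)); last first.
  by rewrite lerDr; apply: mulr_ge0; [apply: mulr_ge0; [lra|exact: ltW]|].
have x0 : 0 < `|xi| by lra.
have x2 : 0 < xi ^+ 2 by rewrite -(real_normK (num_real xi)) exprn_gt0.
have xn : xi != 0 by rewrite -normr_gt0.
have h1 : nsq (coef G xi) <= (4 * M%:R / (w * xi ^+ 2)) ^+ 2.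
  apply: nsq_le (node_G_coef_far xK); apply: divr_ge0; first exact: mulr_ge0.
  by apply: mulr_ge0; exact: ltW.
have xK2 : 4 * K ^+ 2 <= xi ^+ 2.
  have : (2 * K) ^+ 2 <= `|xi| ^+ 2 by apply: sqr_mono; lra.
  by rewrite real_normK ?num_real// exprMn; lra.
apply: (@le_trans _ _ ((4 * M%:R / (w * xi ^+ 2)) ^+ 2 * (1 + (xi / K) ^+ 2))).
  by apply: ler_wpM2r => //; rewrite addr_ge0 ?sqr_ge0.
rewrite /cauchy_wt.
set u := xi ^+ 2 in x2 xK2 *; set v := K ^+ 2 in K2 xK2 *.
have -> : (xi / K) ^+ 2 = u / v by rewrite exprMn exprVn.
have -> : K ^+ 4 = v ^+ 2 by rewrite /v -exprM.
have -> : (4 * M%:R / (w * u)) ^+ 2 * (1 + u / v) = (M%:R ^+ 2 / w ^+ 2) * (16 * (1 + u / v) / u ^+ 2).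
  by field; rewrite !gt_eqF.
have -> : 25 * M%:R ^+ 2 / (w ^+ 2 * v ^+ 2) * (1 + u / v)^-1 =
   (M%:R ^+ 2 / w ^+ 2) * (25 / (v ^+ 2 * (1 + u / v))).
  have : 0 < 1 + u / v by rewrite ltr_pwDl// divr_ge0// ltW.
  have -> : 1 + u / v = (v + u) / v by field; rewrite gt_eqF.
  move=> _; field; rewrite !gt_eqF//; lra.
apply: ler_wpM2l; first by rewrite divr_ge0 ?sqr_ge0// ltW.
have -> : 1 + u / v = (v + u) / v by field; rewrite gt_eqF.
by apply: far_arith.
Qed.

(** The weight 1 + (xi / K)^2 is carried along because its inverse sums to O(K): this is what later
    turns an energy bound into an l^p bound over infinitely many frequencies. *)
Lemma node_energy : exists bad' : R -> bool,
  (forall D a, uniq D -> (count (fun k : int => bad' (k%:~R - a)) D)%:R <= 48 * N / w) /\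
  (forall D a, uniq D ->
    \sum_(k <- D | ~~ bad' (k%:~R - a))
       nsq (coef (fun t => cis (mu * psi t) - 1) (k%:~R - a)) * (1 + ((k%:~R - a) / K) ^+ 2)
    <= 500 * 100 * N * w).
Proof.
exists bad; split=> D a uD; first exact: node_bad_count.
have K1 := K_ge1; have K0 : 0 < K by lra.
have cS : ccont (fun t => \sum_(i < M) H i t) by apply: ccont_sum; exact: node_H_cont.
have cG : ccont G by apply: ccont_sum => i; exact: node_T_cont.
have E k : coef (fun t => cis (mu * psi t) - 1) (k%:~R - a) =
   coef (fun t => \sum_(i < M) H i t) (k%:~R - a) + coef G (k%:~R - a).
  rewrite -coefD//; apply: eq_coef => t _; rewrite node_split; congr (_ + _); exact: node_abel.
pose W k : R := 1 + ((k%:~R - a) / K) ^+ 2.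
have W0 k : 0 <= W k by rewrite addr_ge0 ?sqr_ge0.
have HH : \sum_(k <- D) nsq (coef (fun t => \sum_(i < M) H i t) (k%:~R - a)) * W k <=
   M%:R * w * (16 + 4 * (144 * K ^+ 2) / K ^+ 2).
  apply: (@pieces_weighted_energy _ M y w H 16 (144 * K ^+ 2)) => //.
  - by move=> i; exact: y0.
  - by move=> i; exact: ytau.
  - by move=> i j ij; exact: ysep.
  - exact: node_H0.
  - by rewrite mulr_ge0// sqr_ge0.
  - exact: node_H_le.
  - move=> i s t; have -> : 144 * K ^+ 2 * (s - t) ^+ 2 = (12 * K * `|s - t|) ^+ 2.
      have -> : (12 * K * `|s - t|) ^+ 2 = 144 * K ^+ 2 * `|s - t| ^+ 2 by ring.
      by rewrite real_normK ?num_real.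
    by apply: nsq_le (node_H_clip i s t); apply: mulr_ge0 => //; lra.
  - exact: node_H_cont.
have GG : \sum_(k <- D | ~~ bad (k%:~R - a)) nsq (coef G (k%:~R - a)) * W k <=
   480 * w ^+ 2 * (M%:R * (8 / w)) + 25 * M%:R ^+ 2 / (w ^+ 2 * K ^+ 4) * (8 * K).
  apply: (@le_trans _ _ (\sum_(k <- D) (480 * w ^+ 2 * Xi (k%:~R - a) +
      25 * M%:R ^+ 2 / (w ^+ 2 * K ^+ 4) * cauchy_wt K (k%:~R - a)))).
    rewrite big_mkcond; apply: ler_sum => k _; case: ifP => nb; first exact: node_G_weighted.
    apply: addr_ge0; apply: mulr_ge0.
    - by apply: mulr_ge0; [lra|exact: sqr_ge0].
    - exact: node_Xi_ge0.
    - exact: node_cK0.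
    - exact/ltW/cauchy_wt_gt0.
  rewrite big_split /= -!mulr_sumr; apply: lerD; apply: ler_wpM2l.
  - by apply: mulr_ge0; [lra|exact: sqr_ge0].
  - exact: node_Xi_sum.
  - exact: node_cK0.
  - exact: sum_cauchy_wt.
apply: (@le_trans _ _ (2 * (M%:R * w * (16 + 4 * (144 * K ^+ 2) / K ^+ 2)) +
   2 * (480 * w ^+ 2 * (M%:R * (8 / w)) + 25 * M%:R ^+ 2 / (w ^+ 2 * K ^+ 4) * (8 * K)))).
  apply: (@le_trans _ _ (2 * (\sum_(k <- D) nsq (coef (fun t => \sum_(i < M) H i t) (k%:~R - a)) * W k)
    + 2 * \sum_(k <- D | ~~ bad (k%:~R - a)) nsq (coef G (k%:~R - a)) * W k)); last lra.
  rewrite -mulrDr big_mkcond /= [X in _ + X]big_mkcond /= -big_split /= mulr_sumr.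
  apply: ler_sum => k _; case: ifP => nb.
    rewrite E -mulrDl mulrA; apply: ler_wpM2r; [exact: W0|exact: nsqD_le].
  by rewrite addr0; apply: mulr_ge0 => //; apply: mulr_ge0; [exact: nsq_ge0|exact: W0].
(* With this, M^2 / (w K)^3 is O(N), so the far frequencies cost no more than the others. *)
have wK : N <= w * K.
  have -> : w * K = w * (`|mu| * hh) * N by rewrite /K; ring.
  by apply: ler_peMl mu_large; exact: le_trans ler01 N_ge1.
have -> : 25 * M%:R ^+ 2 / (w ^+ 2 * K ^+ 4) * (8 * K) = 200 * w * (M%:R ^+ 2 / (w * K) ^+ 3).
  by field; rewrite !gt_eqF.
have h3 : M%:R ^+ 2 / (w * K) ^+ 3 <= 9 * N.
  have N1 : 0 < N := lt_le_trans ltr01 N_ge1.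
  have N3 : 0 < N ^+ 3 by rewrite exprn_gt0.
  have wK3 : N ^+ 3 <= (w * K) ^+ 3 by rewrite lerXn2r ?nnegrE// ?(ltW N1)//; apply: le_trans wK; exact: ltW.
  rewrite ler_pdivrMr; last exact: lt_le_trans wK3.
  have M2 : M%:R ^+ 2 <= (3 * N) ^+ 2 by apply: sqr_mono.
  apply: le_trans M2 _; apply: (@le_trans _ _ (9 * N * N ^+ 3)).
    have -> : 9 * N * N ^+ 3 = (3 * N) ^+ 2 * N ^+ 2 by ring.
    by rewrite ler_peMr ?sqr_ge0// exprn_ege1.
  by apply: ler_wpM2l => //; apply: mulr_ge0 => //; exact: ltW.
have -> : M%:R * w * (16 + 4 * (144 * K ^+ 2) / K ^+ 2) = 592 * (M%:R * w).
  by field; rewrite gt_eqF.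
have -> : 480 * w ^+ 2 * (M%:R * (8 / w)) = 3840 * (M%:R * w) by field; rewrite gt_eqF.
have Mw : M%:R * w <= 3 * N * w by rewrite ler_wpM2r// ltW.
have h4 : 200 * w * (M%:R ^+ 2 / (w * K) ^+ 3) <= 200 * w * (9 * N).
  by rewrite ler_wpM2l// mulr_ge0// ltW.
(* The terms add up to (3552 + 23040 + 3600) N w, rounded up. *)
have -> : 500 * 100 * N * w = 500 * 100 * (N * w) by ring.
have Nw : 0 <= N * w by apply: mulr_ge0; [exact: le_trans ler01 N_ge1|exact: ltW].
lra.
Qed.

End node_decomposition.

(** * Blocks: second differences of a staircase primitive *)

Section blocks.
Variable R : realType.
Variables (w h : nat -> R) (halve : nat -> bool).
Hypothesis w_gt0 : forall m, 0 < w m.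
Hypothesis wS : forall m, w m.+1 = w m / 2.
Hypothesis h_gt0 : forall m, 0 < h m.
Hypothesis hS : forall m, h m.+1 = if halve m then h m / 2 else h m.
Hypothesis w_le1 : forall m, w m <= 1.
Local Notation tau := (2 * @pi R).
Local Notation prim := (prim w h halve).
Implicit Types (m n d : nat) (s t : R) (D : seq int).

(** The weights 1, -2, 1 at equally spaced points annihilate affine functions and [prim m] is affine
    beyond [w m], so a block has compact support. Its slope rises to [h m], falls to [- h m] and
    returns to 0. *)
Definition block m u t : R :=
  prim m (t - u) - 2 * prim m (t - (u + w m)) + prim m (t - (u + 2 * w m)).

Lemma big_ord_addn (I J : nat) (F : nat -> R) :
  \sum_(i < I + J) F i = \sum_(i < I) F i + \sum_(i < J) F (I + i)%N.
Proof. by rewrite big_split_ord. Qed.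

Lemma spread_leg (f : nat -> int) (b : R) (N : nat) : injective f ->
  \sum_(i < N) cauchy_wt 1 (b - (f i)%:~R) <= 8.
Proof.
move=> fi; have u : uniq [seq f i | i <- iota 0 N] by rewrite map_inj_uniq// iota_uniq.
have := sum_cauchy_wt b (lexx (1 : R)) u; rewrite mulr1; apply: le_trans.
rewrite big_map -(big_mkord xpredT (fun i => cauchy_wt 1 (b - (f i)%:~R))) /index_iota subn0; apply: ler_sum => i _.
by apply: cauchy_wt_mono => //; rewrite distrC.
Qed.

Section scale.
Variables (m d : nat) (u : R).
Hypothesis u0 : 0 < u.
Hypothesis u3 : u + 3 * w m < tau.
Let n := (m + d)%N.
Let offs := offsets w halve d m.
Let N := size offs.
Let x i := nth 0 offs i.
Let y i := if (i < N)%N then u + x i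
  else if (i < N + N)%N then u + w m + x (i - N)%N else u + 2 * w m + x (i - (N + N))%N.
Let q i : R := if (i < N)%N then 1 else if (i < N + N)%N then -2 else 1.

Let hN : N%:R * h n = h m. Proof. exact: size_offsets. Qed.
Let N_gt0 : (0 < N)%N.
Proof. by rewrite lt0n; apply/eqP => h0; have := h_gt0 m; rewrite -hN h0 mul0r ltxx. Qed.

Let legs (F : nat -> R -> R) : \sum_(i < N + (N + N)) F i (q i) =
  \sum_(i < N) F i 1 + (\sum_(i < N) F (N + i)%N (-2) + \sum_(i < N) F (N + (N + i))%N 1).
Proof.
rewrite (big_ord_addn _ _ (fun i => F i (q i))) (big_ord_addn _ _ (fun i => F (N + i)%N (q (N + i)%N))).
congr (_ + (_ + _)); apply: eq_bigr => i _; have iN := ltn_ord i; rewrite /q.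
- by rewrite iN.
- by rewrite ltn_add2l iN ltnNge leq_addr.
- by rewrite addnA ltnNge -addnA leq_addr /= ltnNge addnA leq_addr.
Qed.

Let y1 (i : 'I_N) : y i = u + x i. Proof. by rewrite /y ltn_ord. Qed.
Let y2 (i : 'I_N) : y (N + i)%N = u + w m + x i.
Proof. by rewrite /y ltn_add2l ltn_ord ltnNge leq_addr /= addKn. Qed.
Let y3 (i : 'I_N) : y (N + (N + i))%N = u + 2 * w m + x i.
Proof. by rewrite /y addnA ltnNge -addnA leq_addr /= ltnNge addnA leq_addr /= addKn. Qed.

Let sumx (F : R -> R) : \sum_(z <- offs) F z = \sum_(i < N) F (x i).
Proof. by rewrite (big_nth 0) big_mkord. Qed.

Lemma block_nodes t : block m u t = \sum_(i < N + (N + N)) q i * prim n (t - y i).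
Proof.
rewrite (legs (fun i r => r * prim n (t - y i))) /block !(@prim_offsets R w h halve w_gt0 wS h_gt0 hS d m) -/offs !sumx.
rewrite mulr_sumr -addrA; congr (_ + _).
  by apply: eq_bigr => i _; rewrite y1 mul1r; congr (prim _ _); ring.
rewrite -sumrN; congr (_ + _); apply: eq_bigr => i _.
  by rewrite y2 mulNr; congr (- (_ * prim _ _)); ring.
by rewrite y3 mul1r; congr (prim _ _); ring.
Qed.

Let sl i : R := \sum_(l < i) q l.
(** The slopes climb from 0 to N by ones, descend to -N by twos and climb back to 0. On each of
    these three legs they are distinct integers, which gives 8 per leg in [block_spread]. *)
Lemma block_sl i : (i <= N + (N + N))%N ->
  sl i = if (i <= N)%N then i%:R else if (i <= N + N)%N then 3 * N%:R - 2 * i%:R else i%:R - 3 * N%:R.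
Proof.
elim: i => [|i IH] iM; first by rewrite /sl big_ord0.
rewrite /sl big_ord_recr /= -/(sl i) IH; last exact: ltnW.
have -> : i.+1%:R = i%:R + 1 :> R by rewrite -natr1.
rewrite /q; have [h1|h1] := ltnP i N; first by rewrite ?(ltnW h1) ?h1.
have [h2|h2] := ltnP i (N + N); last first.
  have -> : (i <= N)%N = false by apply/negbTE; rewrite -ltnNge; lia.
  case: ifP => h3; last by ring.
  have -> : i = (N + N)%N by lia.
  by rewrite natrD; ring.
rewrite (ltnW h2).
case: ifP => h3; last by ring.
have -> : i = N by lia.
ring.
Qed.

Let Nr1 : 1 <= N%:R :> R. Proof. by rewrite ler1n. Qed.

Lemma block_sl_le i : (i < N + (N + N))%N -> `|sl i| <= N%:R.
Proof.
move=> iM; rewrite block_sl ?(ltnW iM)// ler_norml.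
have [h1|h1] := leqP i N.
  by have : i%:R <= N%:R :> R by [rewrite ler_nat]; have : 0 <= i%:R :> R by []; lra.
have [h2|h2] := leqP i (N + N).
  have : i%:R <= (N + N)%:R :> R by rewrite ler_nat.
  have : N%:R <= i%:R :> R by rewrite ler_nat ltnW.
  rewrite natrD; lra.
have : i%:R <= (N + (N + N))%:R :> R by rewrite ler_nat ltnW.
have : (N + N)%:R <= i%:R :> R by rewrite ler_nat ltnW.
rewrite !natrD; lra.
Qed.

Lemma block_slM : sl (N + (N + N)) = 0.
Proof.
by rewrite /sl (legs (fun _ r => r)) !sumr_const card_ord; rewrite -mulrnDl; have -> : -2 + 1 = -1 :> R by [ring]; rewrite mulNrn subrr.
Qed.

Lemma block_spread b : \sum_(i < N + (N + N)) cauchy_wt 1 (b - sl i) <= 24.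
Proof.
have -> : 24 = 8 + (8 + 8) :> R by ring.
rewrite (big_ord_addn _ _ (fun i => cauchy_wt 1 (b - sl i)))
  (big_ord_addn _ _ (fun i => cauchy_wt 1 (b - sl (N + i)%N))).
apply: lerD; last apply: lerD.
- have := @spread_leg (fun i => i%:Z) b N ltac:(by move=> i j []); apply: le_trans.
  apply: ler_sum => i _; rewrite block_sl; last by have := ltn_ord i; lia.
  by rewrite (ltnW (ltn_ord i)).
- have := @spread_leg (fun i => N%:Z - 2 * i%:Z) b N ltac:(by move=> i j; lia); apply: le_trans.
  apply: ler_sum => i _; rewrite block_sl; last by have := ltn_ord i; lia.
  rewrite leq_add2l (ltnW (ltn_ord i)).
  have -> : (if (N + i <= N)%N then (N + i)%:R else 3 * N%:R - 2 * (N + i)%:R) = (N%:Z - 2 * i%:Z)%:~R :> R.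
    rewrite intrD intrN intrM natrD /=.
    case: ifP => h3; last by ring.
    have i0 : nat_of_ord i = 0%N by lia.
    by rewrite i0; ring.
  by [].
- have := @spread_leg (fun i => i%:Z - N%:Z) b N ltac:(by move=> i j; lia); apply: le_trans.
  apply: ler_sum => i _; rewrite block_sl; last by have := ltn_ord i; lia.
  rewrite (leqNgt _ N) (_ : (N < _)%N) /=; last by lia.
  have -> : (if (N + (N + i) <= N + N)%N then 3 * N%:R - 2 * (N + (N + i))%:R else (N + (N + i))%:R - 3 * N%:R) = (i%:Z - N%:Z)%:~R :> R.
    rewrite intrD intrN !natrD /=.
    case: ifP => h3; last by ring.
    have i0 : nat_of_ord i = 0%N by lia.
    by rewrite i0; ring.
  by [].
Qed.

Let xb i : (i < N)%N -> 0 <= x i <= w m - w n.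
Proof. by move=> iN; apply: (offsets_bounds w_gt0 wS); exact: mem_nth. Qed.

Let xsep i j : (i < j)%N -> (j < N)%N -> x i + w n <= x j.
Proof.
move=> ij jN; have /(pairwiseP 0) := offsets_sep halve w_gt0 wS d m.
by apply => //; rewrite inE; exact: ltn_trans jN.
Qed.

Let yb i : (i < N + (N + N))%N -> u <= y i /\ y i + w n <= u + 3 * w m.
Proof.
move=> iM; have wm := w_gt0 m; rewrite /y; case: ifP => h1; first by have := xb h1; lra.
case: ifP => h2.
  have /xb : (i - N < N)%N by lia. lra.
have /xb : (i - (N + N) < N)%N by lia. lra.
Qed.

Let ysep i j : (i < j)%N -> (j < N + (N + N))%N -> y i + w n <= y j.
Proof.
move=> ij jM; have wm := w_gt0 m.
have X k : (k < N)%N -> 0 <= x k <= w m - w n := @xb k.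
rewrite /y; case: (ltnP j N) => j1.
  by rewrite (ltn_trans ij j1); have := xsep ij j1; lra.
case: (ltnP j (N + N)) => j2.
  have /X Xj : (j - N < N)%N by lia.
  case: (ltnP i N) => i1; first by have := X _ i1; lra.
  rewrite (ltn_trans ij j2).
  have ij' : (i - N < j - N)%N by lia.
  have := xsep ij' ltac:(lia); lra.
have /X Xj : (j - (N + N) < N)%N by lia.
case: (ltnP i N) => i1; first by have := X _ i1; lra.
case: (ltnP i (N + N)) => i2.
  have /X : (i - N < N)%N by lia. lra.
have ij' : (i - (N + N) < j - (N + N))%N by lia.
have := xsep ij' ltac:(lia); lra.
Qed.

Lemma block_energy mu : 1 <= w n * (`|mu| * h n) -> exists bad : R -> bool,
  (forall D a, uniq D -> (count (fun k : int => bad (k%:~R - a)) D)%:R <= 48 * (h m / h n) / w n) /\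
  (forall D a, uniq D ->
    \sum_(k <- D | ~~ bad (k%:~R - a))
       nsq (coef (fun t => cis (mu * block m u t) - 1) (k%:~R - a)) *
         (1 + ((k%:~R - a) / (`|mu| * h m)) ^+ 2)
    <= 500 * 100 * (h m / h n) * w n).
Proof.
move=> mu1; have hn := h_gt0 n.
have Nh : h m / h n = N%:R by rewrite -hN mulfK// gt_eqF.
have -> : `|mu| * h m = `|mu| * h n * N%:R by rewrite -hN; ring.
rewrite Nh.
have -> : (fun t => cis (mu * block m u t) - 1 : R[i]) =
   (fun t => cis (mu * \sum_(i < N + (N + N)) q i * prim n (t - y i)) - 1).
  by apply/funext => t; rewrite block_nodes.
apply: (@node_energy R (N + (N + N))%N y q (w n) (h n) (prim n (w n) - h n * w n) N%:R mu (prim n)) => //.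
- by rewrite addn_gt0 N_gt0.
- by rewrite !natrD; lra.
- by move=> i /yb[h1 _]; exact: lt_le_trans h1.
- by move=> i /yb[_ h2]; apply: le_trans h2 _; exact: ltW.
- exact: prim_le0.
- by move=> t /(prim_ge w_gt0 wS h_gt0 hS) ->; ring.
- exact: prim_lip.
- by move=> i; rewrite /q; case: ifP => _; [|case: ifP => _]; rewrite ?normrN ?normr1 ?normr_nat; lra.
- exact: block_sl_le.
- exact: block_slM.
(* The intercepts cancel in triples: the nodes with indices i, N + i and 2 N + i are equally spaced
   and have weights 1, -2, 1. *)
- rewrite (legs (fun i r => r * (prim n (w n) - h n * w n - h n * y i))).
  rewrite -!big_split /= big1// => i _; rewrite y1 y2 y3; ring.
- exact: block_spread.
Qed.

End scale.
End blocks.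

(** * Sums of p-th powers of the coefficients of one block *)

Section block_lp.
Variable R : realType.
Implicit Types (m n d : nat) (s t : R) (D : seq int).
Local Notation tau := (2 * @pi R).

Lemma powR_interp_scaled (c s r p : R) : 1 <= p <= 2 -> 0 <= c -> 0 < s -> 1 <= r ->
  c `^ p <= s `^ p * (c ^+ 2 * r / s ^+ 2 + r^-1).
Proof.
move=> p12 c0 s0 r1; apply: le_trans (powR_interp p12 c0 s0 r1) _.
rewrite mulrDr; apply: lerD => //.
rewrite powRB; last by rewrite (gt_eqF s0) implybT.
have -> : s `^ 2 = s ^+ 2 by rewrite -powR_mulrn// ltW.
by rewrite [leLHS](_ : _ = s `^ p * (c ^+ 2 * r / s ^+ 2))//; ring.
Qed.

(** [powR_interp_scaled] with r = 1 + ((k - a) / K)^2, whose inverse sums to at most 8 K; no bound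
    on the number of frequencies is needed. *)
Lemma lp_tail D (P : pred int) (c : int -> R) a K s E p : uniq D -> (forall k, 0 <= c k) ->
  1 <= K -> 0 < s -> 1 <= p <= 2 ->
  \sum_(k <- D | P k) c k ^+ 2 * (1 + ((k%:~R - a) / K) ^+ 2) <= E ->
  \sum_(k <- D | P k) c k `^ p <= s `^ p * (E / s ^+ 2 + 8 * K).
Proof.
move=> uD c0 K1 s0 p12 HE.
apply: (@le_trans _ _ (s `^ p * ((\sum_(k <- D | P k) c k ^+ 2 * (1 + ((k%:~R - a) / K) ^+ 2)) / s ^+ 2
  + \sum_(k <- D) cauchy_wt K (k%:~R - a)))).
  apply: (@le_trans _ _ (\sum_(k <- D | P k) s `^ p * (c k ^+ 2 * (1 + ((k%:~R - a) / K) ^+ 2) / s ^+ 2 + cauchy_wt K (k%:~R - a)))).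
    by apply: ler_sum => k _; apply: powR_interp_scaled => //; rewrite lerDl sqr_ge0.
  rewrite -mulr_sumr; apply: ler_wpM2l; first exact: powR_ge0.
  rewrite big_split /= -mulr_suml; apply: lerD => //.
  rewrite big_mkcond; apply: ler_sum => k _; case: ifP => // _.
  exact/ltW/cauchy_wt_gt0.
apply: ler_wpM2l; first exact: powR_ge0.
apply: lerD; last exact: sum_cauchy_wt.
by apply: ler_wpM2r => //; rewrite invr_ge0 sqr_ge0.
Qed.

(** The same with r = 1, for frequencies whose number is controlled. *)
Lemma lp_mid D (P : pred int) (c : int -> R) s p : (forall k, 0 <= c k) ->
  0 < s -> 1 <= p <= 2 ->
  \sum_(k <- D | P k) c k `^ p <= s `^ p * ((\sum_(k <- D | P k) c k ^+ 2) / s ^+ 2 + (count P D)%:R).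
Proof.
move=> c0 s0 p12; rewrite mulrDr -sum1_count natr_sum mulr_suml !mulr_sumr -big_split /=.
apply: ler_sum => k _; have := powR_interp_scaled p12 (c0 k) s0 (lexx 1).
by rewrite mulr1 invr1 mulrDr.
Qed.

Variables (w h : nat -> R) (halve : nat -> bool).
Hypothesis w_gt0 : forall m, 0 < w m.
Hypothesis wS : forall m, w m.+1 = w m / 2.
Hypothesis h_gt0 : forall m, 0 < h m.
Hypothesis hS : forall m, h m.+1 = if halve m then h m / 2 else h m.
Hypothesis w_le1 : forall m, w m <= 1.
Local Notation prim := (prim w h halve).
Local Notation block := (block w h halve).

Lemma block_eq0 m u t : t <= u \/ u + 3 * w m <= t -> block m u t = 0.
Proof.
have wm := w_gt0 m; rewrite /block => -[tu|tu]; first by rewrite !prim_le0//; [ring|lra..].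
rewrite (prim_ge w_gt0 wS h_gt0 hS (_ : w m <= t - u)); last lra.
rewrite (prim_ge w_gt0 wS h_gt0 hS (_ : w m <= t - (u + w m))); last lra.
rewrite (prim_ge w_gt0 wS h_gt0 hS (_ : w m <= t - (u + 2 * w m))); last lra.
ring.
Qed.

Lemma block_le m u t : `|block m u t| <= 2 * (h m * w m).
Proof.
have wm := w_gt0 m; have pl := prim_lip w_gt0 wS h_gt0 hS m.
have h1 := pl (t - u) (t - (u + w m)); have h2 := pl (t - (u + w m)) (t - (u + 2 * w m)).
have E1 : t - u - (t - (u + w m)) = w m by ring.
have E2 : t - (u + w m) - (t - (u + 2 * w m)) = w m by ring.
rewrite E1 (ger0_norm (ltW wm)) in h1; rewrite E2 (ger0_norm (ltW wm)) in h2.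
have -> : block m u t = (prim m (t - u) - prim m (t - (u + w m))) -
  (prim m (t - (u + w m)) - prim m (t - (u + 2 * w m))) by rewrite /block; ring.
by apply: le_trans (ler_normB _ _) _; lra.
Qed.

Lemma block_lip m u : lip (block m u) (4 * h m).
Proof.
move=> s t; have pl := prim_lip w_gt0 wS h_gt0 hS m.
have sh v : `|prim m (s - v) - prim m (t - v)| <= h m * `|s - t|.
  by have := pl (s - v) (t - v); have -> : s - v - (t - v) = s - t by ring.
have -> : block m u s - block m u t = (prim m (s - u) - prim m (t - u)) -
  2 * (prim m (s - (u + w m)) - prim m (t - (u + w m))) +
  (prim m (s - (u + 2 * w m)) - prim m (t - (u + 2 * w m))) by rewrite /block; ring.
apply: le_trans (ler_normD _ _) _; apply: le_trans (lerD (ler_normB _ _) (lexx _)) _.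
rewrite normrM normr_nat.
by have := sh u; have := sh (u + w m); have := sh (u + 2 * w m); lra.
Qed.

Lemma block_cont m u : continuous (block m u).
Proof. exact: lip_cont (@block_lip m u). Qed.

Definition bump mu m u t : R[i] := cis (mu * block m u t) - 1.

Lemma bump_cont mu m u : ccont (bump mu m u).
Proof.
apply: ccontB; last exact: ccont_cst.
by apply: ccont_cis; apply: contM; [exact: contC|exact: block_cont].
Qed.

Section one_block.
Variables (m : nat) (u mu p : R).
Hypothesis u0 : 0 < u.
Hypothesis u3 : u + 3 * w m < tau.
Hypothesis mu0 : mu != 0.
Hypothesis p12 : 1 <= p <= 2.
Let x := `|mu| * h m * w m.

Let x0 : 0 < x.
Proof. by rewrite /x !mulr_gt0// normr_gt0. Qed.

(** The whole block taken as a single piece of length 3 w, without resolving its slopes. *)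
Lemma bump_energy0 D a K A : uniq D -> 0 < K -> 0 <= A -> (forall t, nsq (bump mu m u t) <= A) ->
  \sum_(k <- D) nsq (coef (bump mu m u) (k%:~R - a)) * (1 + ((k%:~R - a) / K) ^+ 2) <=
    3 * w m * (A + 64 * (`|mu| * h m) ^+ 2 / K ^+ 2).
Proof.
move=> uD K0 A0 HA.
have -> : bump mu m u = (fun t => \sum_(i < 1) bump mu m u t).
  by apply/funext => t; rewrite big_ord1.
have -> : 3 * w m * (A + 64 * (`|mu| * h m) ^+ 2 / K ^+ 2) =
  1%:R * (3 * w m) * (A + 4 * (16 * (`|mu| * h m) ^+ 2) / K ^+ 2) by ring.
apply: (@pieces_weighted_energy _ 1 (fun=> u) (3 * w m) (fun=> bump mu m u)) => //.
- exact: mulr_gt0.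
- by move=> _; exact: ltW.
- by move=> i j; rewrite !ord1.
- by move=> _ t ht; rewrite /bump block_eq0// mulr0 cis0 subrr.
- by apply: mulr_ge0 => //; exact: sqr_ge0.
- move=> _ s t; have -> : 16 * (`|mu| * h m) ^+ 2 * (s - t) ^+ 2 = (`|mu| * (4 * h m * `|s - t|)) ^+ 2.
    have -> : (`|mu| * (4 * h m * `|s - t|)) ^+ 2 = 16 * (`|mu| * h m) ^+ 2 * `|s - t| ^+ 2 by ring.
    by rewrite real_normK ?num_real.
  apply: nsq_le; first by rewrite !mulr_ge0// ltW.
  rewrite /bump opprB addrA subrK; apply: le_trans (normc_cisB _ _) _.
  by rewrite -mulrBr normrM; apply: ler_wpM2l => //; exact: block_lip.
- by move=> _; exact: bump_cont.
Qed.

(** One formula that dominates both trivial bounds 4 and 4 x^2, in the smaller of the two. *)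
Lemma bump_le t : nsq (bump mu m u t) <= 8 * x / (1 + x).
Proof.
have x0' := x0.
have x1 : 0 < 1 + x by lra.
have h1 : nsq (bump mu m u t) <= 2 ^+ 2.
  apply: nsq_le => //; apply: le_trans (le_normcB _ _) _.
  by rewrite normc_cis ComplexField.Normc.normc1; lra.
have h2 : nsq (bump mu m u t) <= (2 * x) ^+ 2.
  apply: nsq_le; first by rewrite mulr_ge0// ltW.
  rewrite /bump -[1]cis0; apply: le_trans (normc_cisB _ _) _; rewrite subr0 normrM.
  have := ler_wpM2l (normr_ge0 mu) (block_le m u t); rewrite /x.
  by have -> : `|mu| * (2 * (h m * w m)) = 2 * (`|mu| * h m * w m) by ring.
rewrite ler_pdivlMr//.
have [xl|xl] := leP x 1.
  have : nsq (bump mu m u t) * (1 + x) <= (2 * x) ^+ 2 * 2.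
    by apply: ler_pM; rewrite ?nsq_ge0//; lra.
  nra.
have : nsq (bump mu m u t) * (1 + x) <= 2 ^+ 2 * (2 * x).
  by apply: ler_pM; rewrite ?nsq_ge0//; lra.
lra.
Qed.

Let c a k := normc (coef (bump mu m u) (k%:~R - a)).
Let c0 a k : 0 <= c a k. Proof. exact: normc_ge0. Qed.
Let c2 a k : c a k ^+ 2 = nsq (coef (bump mu m u) (k%:~R - a)). Proof. by rewrite nsqE. Qed.

(** Valid for every x, but efficient only below the threshold. The bandwidth (1 + x) / w is that of
    the bump, and [s] is chosen so that both terms of [lp_tail] are multiples of it: 216 + 8 =
    224. *)
Lemma bump_lp_small D a : uniq D ->
  \sum_(k <- D) c a k `^ p <= 224 * (w m `^ p / w m * Num.sqrt x `^ p).
Proof.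
move=> uD; have wm := w_gt0 m; have wl := w_le1 m.
have x0' := x0.
have x1 : 0 < 1 + x by lra.
pose K := (1 + x) / w m.
have K1 : 1 <= K by rewrite /K ler_pdivlMr// mul1r; lra.
have K0 : 0 < K by lra.
have sx : 0 < Num.sqrt x by rewrite sqrtr_gt0.
have s2 : Num.sqrt x ^+ 2 = x by rewrite sqr_sqrtr// ltW.
pose s := w m * Num.sqrt x / (1 + x).
have s0 : 0 < s by rewrite /s divr_gt0// mulr_gt0.
have A0 : 0 <= 8 * x / (1 + x) by apply: divr_ge0; [apply: mulr_ge0 => //|]; exact: ltW.
have H := bump_energy0 a uD K0 A0 bump_le.
have EE : 3 * w m * (8 * x / (1 + x) + 64 * (`|mu| * h m) ^+ 2 / K ^+ 2) <= 216 * w m * (x / (1 + x)).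
  have -> : 64 * (`|mu| * h m) ^+ 2 / K ^+ 2 = 64 * (x / (1 + x)) * (x / (1 + x)).
    by rewrite /K /x; field; rewrite (gt_eqF wm) /= gt_eqF// /x.
  have xx : 0 <= x / (1 + x) <= 1.
    by rewrite divr_ge0 ?(ltW x0) ?(ltW x1)//= ler_pdivrMr// mul1r; lra.
  have -> : 8 * x / (1 + x) = 8 * (x / (1 + x)) by ring.
  move: xx; set v := x / (1 + x) => vv.
  have : w m * (v * v) <= w m * v by apply: ler_wpM2l; [exact: ltW|nra].
  have : 0 <= w m * v by rewrite mulr_ge0 ?(ltW wm)//; lra.
  nra.
apply: (@le_trans _ _ (s `^ p * (216 * w m * (x / (1 + x)) / s ^+ 2 + 8 * K))).
  apply: (lp_tail (a := a) uD (c0 a) K1 s0 p12).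
  by under eq_bigr do rewrite c2; exact: le_trans H EE.
have -> : 216 * w m * (x / (1 + x)) / s ^+ 2 + 8 * K = 224 * ((1 + x) / w m).
  rewrite /K /s; have -> : (w m * Num.sqrt x / (1 + x)) ^+ 2 = w m ^+ 2 * x / (1 + x) ^+ 2.
    by rewrite !exprMn exprVn s2.
  by field; rewrite !gt_eqF.
have -> : s `^ p = w m `^ p * Num.sqrt x `^ p * ((1 + x)^-1) `^ p.
  by rewrite /s powRM ?invr_ge0 ?mulr_ge0 ?(ltW x1) ?(ltW wm) ?(ltW sx)// powRM ?(ltW wm) ?(ltW sx).
have le1 : ((1 + x)^-1) `^ p <= (1 + x)^-1.
  by apply: ge1r_powR; [rewrite invr_gt0 x1 invf_le1//; lra|case/andP: p12].
apply: (@le_trans _ _ (w m `^ p * Num.sqrt x `^ p * (1 + x)^-1 * (224 * ((1 + x) / w m)))).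
  apply: ler_wpM2r; first by rewrite mulr_ge0// divr_ge0 ?ltW.
  by apply: ler_wpM2l => //; rewrite mulr_ge0// powR_ge0.
by rewrite [leLHS](_ : _ = 224 * (w m `^ p / w m * Num.sqrt x `^ p))//; field; rewrite !gt_eqF.
Qed.

Lemma bump_energy_total D a : uniq D -> \sum_(k <- D) c a k ^+ 2 <= 15 * w m.
Proof.
move=> uD; have hm := h_gt0 m.
have b4 t : nsq (bump mu m u t) <= 4.
  have -> : 4 = 2 ^+ 2 :> R by ring.
  apply: nsq_le => //; apply: le_trans (le_normcB _ _) _.
  by rewrite normc_cis ComplexField.Normc.normc1; lra.
(* This K makes the derivative term equal to 1, and 3 * (4 + 1) = 15. *)
have K0 : 0 < 8 * (`|mu| * h m) by rewrite !mulr_gt0// normr_gt0.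
have := bump_energy0 a uD K0 (ler0n _ 4) b4.
have -> : 3 * w m * (4 + 64 * (`|mu| * h m) ^+ 2 / (8 * (`|mu| * h m)) ^+ 2) = 15 * w m.
  by field; rewrite gt_eqF//= normr_eq0.
apply: le_trans; apply: ler_sum => k _; rewrite c2 -[leLHS]mulr1.
by apply: ler_wpM2l; [exact: nsq_ge0|rewrite lerDl sqr_ge0].
Qed.

(** At scale m + j there are about (h m / h (m + j)) / w (m + j) frequencies near the slopes, with
    coefficients typically of size w (m + j). *)
Let scale_term j : R := h m / h (m + j) * (w (m + j) `^ p / w (m + j)).
Let Cs : R := 1000 * 200.

Let mono j : `|mu| * h (m + j.+1) * w (m + j.+1) <= `|mu| * h (m + j) * w (m + j).
Proof.
rewrite addnS; apply: ler_pM; rewrite ?mulr_ge0 ?(ltW (h_gt0 _)) ?(ltW (w_gt0 _))//.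
  by apply: ler_wpM2l => //; have := hS (m + j); have := h_gt0 (m + j); case: (halve _); lra.
by have := wS (m + j); have := w_gt0 (m + j); lra.
Qed.

(* At each scale the frequencies near the slopes are bounded by counting, and the
   energy of the others is passed on to the next scale. *)
Lemma bump_lp_scales D a d : uniq D -> 1 <= `|mu| * h (m + d) * w (m + d) ->
  exists good : pred int,
  \sum_(k <- D) c a k `^ p <= Cs * \sum_(j < d.+1) scale_term j + \sum_(k <- D | good k) c a k `^ p /\
  \sum_(k <- D | good k) c a k ^+ 2 * (1 + ((k%:~R - a) / (`|mu| * h m)) ^+ 2) <=
    500 * 100 * (h m / h (m + d)) * w (m + d).
Proof.
move=> uD.
have split (g : pred int) (bad : R -> bool) : 
   \sum_(k <- D | g k) c a k `^ p = \sum_(k <- D | g k && bad (k%:~R - a)) c a k `^ p +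
     \sum_(k <- D | g k && ~~ bad (k%:~R - a)) c a k `^ p.
  exact: bigID.
have wt1 K k : 1 <= 1 + ((k%:~R - a) / K) ^+ 2 by rewrite lerDl sqr_ge0.
have step (g : pred int) j E : \sum_(k <- D | g k) c a k ^+ 2 <= E ->
     E <= 1000 * 100 * (h m / h (m + j)) * w (m + j) ->
     1 <= w (m + j) * (`|mu| * h (m + j)) ->
   exists good : pred int, \sum_(k <- D | g k) c a k `^ p <= Cs * scale_term j + \sum_(k <- D | good k) c a k `^ p /\
    \sum_(k <- D | good k) c a k ^+ 2 * (1 + ((k%:~R - a) / (`|mu| * h m)) ^+ 2) <=
      500 * 100 * (h m / h (m + j)) * w (m + j).
  move=> gE EE big; have [bad [cnt en]] := block_energy w_gt0 wS h_gt0 hS w_le1 u0 u3 big.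
  have wj := w_gt0 (m + j); have hj := h_gt0 (m + j); have hm := h_gt0 m.
  exists (fun k => g k && ~~ bad (k%:~R - a)); split.
    rewrite (split g bad); apply: lerD => //.
    apply: le_trans (lp_mid _ _ (c0 a) wj p12) _.
    rewrite /scale_term.
    have -> : Cs * (h m / h (m + j) * (w (m + j) `^ p / w (m + j))) =
      w (m + j) `^ p * (Cs * (h m / h (m + j)) / w (m + j)) by ring.
    apply: ler_wpM2l; first exact: powR_ge0.
    have e1 : (\sum_(k <- D | g k && bad (k%:~R - a)) c a k ^+ 2) / w (m + j) ^+ 2 <=
        1000 * 100 * (h m / h (m + j)) / w (m + j).
      rewrite ler_pdivrMr ?exprn_gt0//.
      have -> : 1000 * 100 * (h m / h (m + j)) / w (m + j) * w (m + j) ^+ 2 =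
        1000 * 100 * (h m / h (m + j)) * w (m + j) by field; rewrite !gt_eqF.
      apply: le_trans EE; apply: le_trans gE; rewrite big_mkcondr /=; apply: ler_sum => k _.
      by case: ifP => // _; exact: sqr_ge0.
    have e2 : (count (fun k => g k && bad (k%:~R - a)) D)%:R <= 48 * (h m / h (m + j)) / w (m + j).
      apply: le_trans (cnt D a uD); rewrite ler_nat; apply: sub_count => k /andP[]//.
    apply: le_trans (lerD e1 e2) _; rewrite -mulrDl -mulrDl /Cs.
    apply: ler_wpM2r; first by rewrite invr_ge0 ltW.
    by apply: ler_wpM2r; [rewrite divr_ge0// ltW|lra].
  apply: le_trans (en D a uD); rewrite big_mkcondl /=; apply: ler_sum => k _.
  rewrite c2; case: ifP => // _.
  by apply: mulr_ge0; [exact: nsq_ge0|exact: le_trans (wt1 _ _)].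
elim: d => [|d IH] mu1.
  have wm := w_gt0 m; have hm := h_gt0 m.
  have [|||good [g1 g2]] := step xpredT 0%N (15 * w m).
  - exact: bump_energy_total.
  - by rewrite addn0 divff ?gt_eqF// mulr1; apply: ler_wpM2r; [exact: ltW|lra].
  - by move: mu1; rewrite mulrC.
  exists good; rewrite big_ord_recr big_ord0 /= add0r addn0; split=> //.
  by move: g2; rewrite addn0.
have [good [g1 g2]] := IH (le_trans mu1 (mono d)).
have [|||good' [g3 g4]] := step good d.+1 (500 * 100 * (h m / h (m + d)) * w (m + d)).
- apply: le_trans g2; apply: ler_sum => k _; rewrite -[leLHS]mulr1.
  by apply: ler_wpM2l; [exact: sqr_ge0|exact: wt1].
(* Passing to the next scale halves [w], while the ratio of heights does not decrease; so the
   inherited energy bound loses at most a factor 2, which is why [step] accepts 1000 * 100. *)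
- rewrite addnS; have := hS (m + d); have := wS (m + d).
  have hm := h_gt0 m; have hd := h_gt0 (m + d); have wd := w_gt0 (m + d).
  have ratio : 0 <= h m / h (m + d) * w (m + d) by rewrite mulr_ge0 ?divr_ge0 ?ltW.
  move=> ->; case: (halve (m + d)) => ->; last lra.
  have -> : h m / (h (m + d) / 2) = 2 * (h m / h (m + d)) by field; rewrite gt_eqF.
  lra.
- by rewrite mulrC.
exists good'; split => //.
rewrite big_ord_recr /= mulrDr; lra.
Qed.

(** The product |mu| h w tends to 0 and is divided by 2 or 4 at each scale, so at the last scale
    where it is at least T it is at most 4 T. *)
Lemma last_scale T : 1 <= T -> T <= x -> (fun d => w (m + d)) @ \oo --> (0 : R) ->
  exists d, T <= `|mu| * h (m + d) * w (m + d) /\ `|mu| * h (m + d) * w (m + d) <= 4 * T.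
Proof.
move=> T1 Tx w0.
pose X d := `|mu| * h (m + d) * w (m + d).
have [N HN] : exists N, X N < T.
  have mh : 0 < `|mu| * h m by rewrite mulr_gt0// normr_gt0.
  have e0 : 0 < T / (`|mu| * h m) by rewrite divr_gt0//; lra.
  have /cvgrPdist_lt/(_ _ e0)[N _ HN] := w0; exists N.
  have := HN N (leqnn N); rewrite /= sub0r normrN gtr0_norm// ltr_pdivlMr// mulrC => HN'.
  apply: le_lt_trans HN'; rewrite /X; apply: ler_wpM2r; first exact: ltW.
  by apply: ler_wpM2l => //; exact: (h_le h_gt0 hS).
have ex : exists d, X d < T by exists N.
case: (ex_minnP ex) => -[|d] Xd dmin; first by move: Xd; rewrite /X addn0 ltNge Tx.
have Td : T <= X d by rewrite leNgt; apply/negP => /dmin; rewrite ltnn.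
exists d; split=> //; move: Xd; rewrite /X addnS wS hS.
have hd := h_gt0 (m + d); have wd := w_gt0 (m + d).
have P : 0 < `|mu| * h (m + d) * w (m + d) by rewrite !mulr_gt0// normr_gt0.
case: (halve _); last by rewrite mulrA; lra.
have -> : `|mu| * (h (m + d) / 2) * (w (m + d) / 2) = `|mu| * h (m + d) * w (m + d) / 4 by field.
lra.
Qed.

Lemma bump_lp_large D a T : uniq D -> 1 <= T -> T <= x -> (fun d => w (m + d)) @ \oo --> (0 : R) ->
  exists d, T <= `|mu| * h (m + d) * w (m + d) /\
  \sum_(k <- D) c a k `^ p <= Cs * (\sum_(j < d.+1) scale_term j +
     scale_term d * (T / Num.sqrt T `^ p)).
Proof.
move=> uD T1 Tx w0; have [d [Td T4]] := last_scale T1 Tx w0; exists d; split=> //.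
have [good [g1 g2]] := bump_lp_scales a uD (le_trans T1 Td).
have T0 : 0 < T by lra.
have hm := h_gt0 m; have hd := h_gt0 (m + d); have wd := w_gt0 (m + d); have wl := w_le1 (m + d).
pose K := `|mu| * h m; pose N := h m / h (m + d).
have N0 : 0 < N by rewrite divr_gt0.
have KE : K = N * (`|mu| * h (m + d)) by rewrite /K /N; field; rewrite gt_eqF.
have K1 : 1 <= K.
  apply: le_trans T1 _; apply: le_trans Tx _; rewrite /x -/K -[leRHS]mulr1.
  by apply: ler_wpM2l => //; rewrite /K mulr_ge0// ltW.
have sT : 0 < Num.sqrt T by rewrite sqrtr_gt0.
have sT2 : Num.sqrt T ^+ 2 = T by rewrite sqr_sqrtr// ltW.
(* With this [s] the energy term is a multiple of N T / w. So is the bandwidth term, because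
   stopping below 4 T gives K <= 4 N T / w. *)
pose s := w (m + d) / Num.sqrt T.
have s0 : 0 < s by rewrite divr_gt0.
have := lp_tail (a := a) uD (c0 a) K1 s0 p12 g2.
move=> tl; apply: le_trans g1 _; rewrite mulrDr; apply: lerD => //; apply: le_trans tl _.
have -> : s `^ p = w (m + d) `^ p / Num.sqrt T `^ p.
  rewrite /s powRM ?invr_ge0 ?(ltW sT) ?(ltW wd)//; congr (_ * _).
  by rewrite -[(Num.sqrt T)^-1]powR_inv1 ?(ltW sT)// -powRrM mulN1r powRN.
have -> : s ^+ 2 = w (m + d) ^+ 2 / T by rewrite /s exprMn exprVn sT2.
rewrite -/N /scale_term -/N.
have -> : Cs * (N * (w (m + d) `^ p / w (m + d)) * (T / Num.sqrt T `^ p)) =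
  w (m + d) `^ p / Num.sqrt T `^ p * (Cs * (N * T / w (m + d))) by ring.
apply: ler_wpM2l; first by rewrite divr_ge0 ?powR_ge0.
have -> : 500 * 100 * N * w (m + d) / (w (m + d) ^+ 2 / T) = 500 * 100 * (N * T / w (m + d)).
  by field; rewrite !gt_eqF.
have KT : K <= 4 * (N * T / w (m + d)).
  have -> : 4 * (N * T / w (m + d)) = (N * (4 * T)) / w (m + d) by ring.
  by rewrite ler_pdivlMr// KE -mulrA; apply: ler_wpM2l => //; exact: ltW.
have NT : 0 <= N * T / w (m + d) by apply: divr_ge0; [apply: mulr_ge0|]; exact: ltW.
rewrite /Cs; lra.
Qed.

End one_block.
End block_lp.

(** * Widths and heights adapted to [omega]; first-order expansions *)

Section modulus_scales.
Variable R : realType.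
Implicit Types (m n d : nat) (s t : R).

(** An integrated form of the class with derivative of modulus [omega]: linear in the pair and
    stable under pointwise limits, so series are never differentiated term by term. *)
Definition first_order (omega : R -> R) (r C : R) (f g : R -> R) :=
  forall t s, `|s| <= r -> `|f (t + s) - f t - s * g t| <= C * `|s| * omega `|s|.

Lemma first_orderD omega r C1 C2 f1 g1 f2 g2 :
  first_order omega r C1 f1 g1 -> first_order omega r C2 f2 g2 ->
  first_order omega r (C1 + C2) (fun t => f1 t + f2 t) (fun t => g1 t + g2 t).
Proof.
move=> h1 h2 t s sr; rewrite !mulrDl; apply: le_trans (lerD (h1 t s sr) (h2 t s sr)).
by apply: le_trans (ler_normD _ _); rewrite [leLHS](_ : _ = `|f1 (t + s) - f1 t - s * g1 t + (f2 (t + s) - f2 t - s * g2 t)|)//; congr `|_|; ring.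
Qed.

Lemma first_orderZ omega r C a f g : first_order omega r C f g ->
  first_order omega r (`|a| * C) (fun t => a * f t) (fun t => a * g t).
Proof.
move=> h1 t s sr; have -> : a * f (t + s) - a * f t - s * (a * g t) = a * (f (t + s) - f t - s * g t) by ring.
by rewrite normrM -!mulrA ler_wpM2l//; have := h1 t s sr; rewrite mulrA.
Qed.

Lemma first_order_shift omega r C u f g : first_order omega r C f g ->
  first_order omega r C (fun t => f (t - u)) (fun t => g (t - u)).
Proof. by move=> h1 t s sr; have -> : t + s - u = t - u + s by [ring]; exact: h1. Qed.

Variable omega : R -> R.
Hypothesis omega_ndecr : {in `[0, +oo[ &, {homo omega : x y / x <= y}}.
Hypothesis omega0 : omega 0 = 0.

Lemma omega_le (x y : R) : 0 <= x -> x <= y -> omega x <= omega y.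
Proof.
by move=> x0 xy; apply: omega_ndecr => //; rewrite in_itv /= andbT//; exact: le_trans xy.
Qed.
Lemma omega_ge0 (x : R) : 0 <= x -> 0 <= omega x.
Proof. by move=> x0; rewrite -omega0; exact: omega_le. Qed.

Variable d0 : R.
Hypothesis d0_gt0 : 0 < d0.
Hypothesis doubling : forall d : R, 0 < d <= d0 -> omega (2 * d) < 2 * omega d.

(** If [omega] vanished at a small y, the strict inequality would make omega (2 y) negative. *)
Lemma omega_gt0 (x : R) : 0 < x -> 0 < omega x.
Proof.
move=> x0; pose y := Num.min x d0.
have y0 : 0 < y by rewrite lt_min x0 d0_gt0.
have yd : y <= d0 by rewrite ge_min lexx orbT.
have yx : y <= x by rewrite ge_min lexx.
have h1 := doubling (introT andP (conj y0 yd)).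
have : 0 <= omega (2 * y) by apply: omega_ge0; lra.
have := omega_le (ltW y0) yx; lra.
Qed.

Definition width m : R := d0 / 2 ^+ m.
Fixpoint height m : R := if m is m'.+1 then
  if height m' <= omega (width m) then height m' else height m' / 2 else omega (width 0).
Definition halved m := ~~ (height m <= omega (width m.+1)).

Lemma width_gt0 m : 0 < width m. Proof. by rewrite divr_gt0// exprn_gt0. Qed.
Lemma widthS m : width m.+1 = width m / 2.
Proof. by rewrite /width exprS; field; rewrite gt_eqF// exprn_gt0. Qed.
Lemma width0 : width 0 = d0. Proof. by rewrite /width expr0 divr1. Qed.
Lemma width_le m : width m <= d0.
Proof. by have := w_le width_gt0 widthS 0 m; rewrite add0n width0. Qed.
Lemma heightS m : height m.+1 = if halved m then height m / 2 else height m.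
Proof. by rewrite /halved /=; case: ifP. Qed.

(** The hypothesis gives omega (width m) < 2 omega (width (m + 1)), so one halving is enough to
    return below [omega]. As it is done only when the height exceeds omega (width (m + 1)), the
    result stays above half of it. *)
Lemma height_bounds m : omega (width m) / 2 <= height m <= omega (width m).
Proof.
elim: m => [|m /andP[h1 h2]].
  by have := omega_gt0 (width_gt0 0); rewrite /=; lra.
have wm := width_gt0 m.+1; have w2 := widthS m.
have H1 : omega (width m.+1) <= omega (width m) by apply: omega_le; lra.
have H2 : omega (width m) < 2 * omega (width m.+1).
  have -> : width m = 2 * width m.+1 by lra.
  by apply: doubling; rewrite wm width_le.
rewrite heightS /halved; case: (leP (height m) (omega (width m.+1))) => h3 /=; lra.
Qed.

Lemma height_gt0 m : 0 < height m.
Proof. by have := height_bounds m; have := omega_gt0 (width_gt0 m); lra. Qed.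

Lemma width_cvg0 m : (fun d => width (m + d)) @ \oo --> (0 : R).
Proof.
have H : (fun d => width m * (2^-1) ^+ d) @ \oo --> (width m * 0 : R).
  apply: cvgM; first exact: cvg_cst.
  by apply: cvg_expr; rewrite ger0_norm; lra.
rewrite mulr0 in H; rewrite (_ : (fun d => width (m + d)) = (fun d => width m * (2^-1) ^+ d))//.
apply/funext => d; rewrite /width exprD exprVn; field.
by rewrite !gt_eqF ?exprn_gt0.
Qed.

Lemma small_width (e : R) : 0 < e -> exists m, forall n, (m <= n)%N -> width n <= e.
Proof.
move=> e0; have /cvgrPdist_lt/(_ _ e0)[N _ HN] := width_cvg0 0; exists N => n Nn.
have := HN n Nn; rewrite /= add0n sub0r normrN gtr0_norm ?width_gt0//; exact: ltW.
Qed.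

(** By [prim_slope] the error is at most |s| times an increment of the staircase over a length |s|.
    If w_(n+1) <= |s| <= w_n, this increment is at most 2 h_n <= 4 h_(n+1) <= 4 omega |s|. *)
Lemma prim_first_order m :
  first_order omega d0 4 (prim width height halved m) (stair width height halved m).
Proof.
have sl := prim_slope width_gt0 widthS height_gt0 heightS.
pose st := stair width height halved m.
have inc s t : 0 < s <= d0 -> st (t + s) - st t <= 4 * omega s.
  move=> /andP[s0 sd].
  have [ws|sw] := leP (width m) s.
    have := stair_bounds width_gt0 widthS height_gt0 heightS m (t + s).
    have := stair_bounds width_gt0 widthS height_gt0 heightS m t.
    rewrite -/(st _) -/(st _).
    have := height_bounds m; have := omega_le (ltW (width_gt0 m)) ws.
    have := omega_gt0 s0; rewrite /st; lra.
  have [N HN] : exists N, width (m + N) <= s.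
    have [N HN] := small_width s0; exists N; apply: HN; exact: leq_addl.
  have ex : exists N, width (m + N) <= s by exists N.
  case: (ex_minnP ex) => -[|n] Xn nmin; first by move: Xn; rewrite addn0 leNgt sw.
  have sn : s <= width (m + n).
    by rewrite leNgt; apply/negP => /ltW/nmin; rewrite ltnn.
  have := @stair_window _ _ _ _ width_gt0 widthS height_gt0 heightS n m s t.
  rewrite (ltW s0) sn => /(_ isT); rewrite -/(st _) -/(st _).
  move: Xn; rewrite addnS => Xn.
  have := heightS (m + n); have := height_bounds (m + n).+1; have := height_gt0 (m + n).
  have := omega_le (ltW (width_gt0 (m + n).+1)) Xn.
  by case: (halved _) => *; lra.
move=> t s; have [s0|s0|->] := ltgtP s 0; last first.
- by rewrite addr0 subrr mul0r subrr normr0 mulr0 mul0r.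
- rewrite gtr0_norm// => sd; have /andP[h1 h2] := sl m s t (ltW s0).
  have h3 := inc s t (introT andP (conj s0 sd)); rewrite /st in h3.
  rewrite ger0_norm; last lra.
  apply: (@le_trans _ _ (s * (4 * omega s))); last by rewrite [leLHS](_ : _ = 4 * s * omega s)//; ring.
  apply: le_trans (ler_wpM2l (ltW s0) h3); lra.
- rewrite ltr0_norm// => sd; pose s' := - s; have s'0 : 0 < s' by rewrite oppr_gt0.
  have /andP[h1 h2] := sl m s' (t + s) (ltW s'0).
  have h3 := inc s' (t + s) (introT andP (conj s'0 sd)); rewrite /st in h3.
  have E : t + s + s' = t by rewrite /s'; ring.
  rewrite E in h1 h2 h3.
  have h4 := ler_wpM2l (ltW s'0) h3.
  have Es : s = - s' by rewrite opprK.
  rewrite -/s' ger0_norm; last by rewrite {2}Es; lra.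
  rewrite {2}Es; lra.
Qed.

Lemma block_first_order m u : first_order omega d0 16 (block width height halved m u)
  (fun t => stair width height halved m (t - u) - 2 * stair width height halved m (t - (u + width m))
    + stair width height halved m (t - (u + 2 * width m))).
Proof.
have P := prim_first_order m.
have := first_orderD (first_orderD (first_order_shift u P)
   (first_orderZ (-2) (first_order_shift (u + width m) P))) (first_order_shift (u + 2 * width m) P).
have -> : 4 + `|-2| * 4 + 4 = 16 :> R by rewrite normrN normr_nat; ring.
by move=> H t s sr; have := H t s sr; rewrite /block !mulNr.
Qed.

End modulus_scales.

(** * Inserting blocks so that affinity is destroyed for good *)

Section insertion.
Variable R : realType.
Implicit Types (m n d i j : nat) (s t : R).
Local Notation tau := (2 * @pi R).

(** Up to sign, twice the area of the triangle with these three vertices on the graph. It is linear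
    in [f] and vanishes for affine functions, so its size measures non-affinity in a way stable
    under uniform perturbation. *)
Definition det3 (f : R -> R) (x y z : R) := (z - y) * f x + (x - z) * f y + (y - x) * f z.

Lemma det3_affine (f : R -> R) (a b : R) : a < b ->
  (forall x y z, a < x < b -> a < y < b -> a < z < b -> det3 f x y z = 0) ->
  exists A B, forall t, a < t < b -> f t = A * t + B.
Proof.
move=> ab H; pose x := (2 * a + b) / 3; pose y := (a + 2 * b) / 3.
have xab : a < x < b by rewrite /x; lra.
have yab : a < y < b by rewrite /y; lra.
have yx : y - x != 0 by rewrite /x /y; apply/eqP; lra.
exists ((f y - f x) / (y - x)), (f x - (f y - f x) / (y - x) * x) => t tab.
apply/eqP; rewrite -subr_eq0 -(mulIr_eq0 _ (mulIf yx)).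
rewrite -(H x y t xab yab tab) /det3; apply/eqP; field.
by [].
Qed.

Lemma det3_dist (f g : R -> R) (e x y z : R) : (forall t, `|f t - g t| <= e) ->
  0 < x < tau -> 0 < y < tau -> 0 < z < tau ->
  `|det3 f x y z - det3 g x y z| <= 3 * tau * e.
Proof.
move=> fg xb yb zb.
have -> : det3 f x y z - det3 g x y z =
  (z - y) * (f x - g x) + (x - z) * (f y - g y) + (y - x) * (f z - g z) by rewrite /det3; ring.
have H (c v : R) : `|c| <= tau -> `|v| <= e -> `|c * v| <= tau * e.
  by move=> h1 h2; rewrite normrM; apply: ler_pM.
have -> : 3 * tau * e = tau * e + tau * e + tau * e by ring.
apply: le_trans (ler_normD _ _) _; apply: lerD; last by apply: H => //; rewrite ler_norml; lra.
by apply: le_trans (ler_normD _ _) _; apply: lerD; apply: H => //; rewrite ler_norml; lra.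
Qed.

Variables (w h : nat -> R) (halve : nat -> bool).
Hypothesis w_gt0 : forall m, 0 < w m.
Hypothesis wS : forall m, w m.+1 = w m / 2.
Hypothesis h_gt0 : forall m, 0 < h m.
Hypothesis hS : forall m, h m.+1 = if halve m then h m / 2 else h m.
Hypothesis small : forall e, 0 < e -> exists m, w m <= e /\ h m <= e.
Local Notation prim := (prim w h halve).
Local Notation block := (block w h halve).

Lemma min3_bounds (a b c : R) : 0 < a -> 0 < b -> 0 < c ->
  exists v, [/\ 0 < v, v <= a, v <= b & v <= c].
Proof.
move=> a0 b0 c0; exists (Num.min (Num.min a b) c).
by split; rewrite ?lt_min ?ge_min ?lexx ?orbT// a0 b0 c0.
Qed.

Lemma small_scale e1 e2 e3 : 0 < e1 -> 0 < e2 -> 0 < e3 -> exists m,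
  [/\ h m <= e1, w m <= e1, h m * w m <= e2 & 3 * w m < e3].
Proof.
move=> p1 p2 p3; pose e := Num.min (Num.min e1 1) (Num.min e2 (e3 / 4)).
have e0 : 0 < e by rewrite !lt_min p1 ltr01 p2 divr_gt0.
have [m [wm hm]] := small e0.
have ee : [/\ e <= e1, e <= 1, e <= e2 & e <= e3 / 4].
  by split; rewrite !ge_min lexx ?orbT.
case: ee => q1 q2 q3 q4; have h0 := h_gt0 m; have w0 := w_gt0 m.
exists m; split; try lra.
apply: (@le_trans _ _ (h m * 1)); last lra.
by apply: ler_wpM2l; lra.
Qed.

(** With P = prim m (w m), the three values are 0, P and h w - P. Collinearity would require 3 P = h
    w, whereas P >= h w / 2 by [prim_w]. *)
Lemma det3_block m u : det3 (block m u) u (u + w m) (u + 2 * w m) <= - (h m * w m ^+ 2 / 2).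
Proof.
have wm := w_gt0 m; have hm := h_gt0 m.
have b0 : block m u u = 0 by apply: block_eq0 => //; left.
have b1 : block m u (u + w m) = prim m (w m).
  rewrite /block; have -> : u + w m - u = w m by ring.
  have P1 : prim m (u + w m - (u + 2 * w m)) = 0 by apply: prim_le0 => //; lra.
  have P0 : prim m 0 = 0 by apply: prim_le0.
  by rewrite subrr P1 P0; ring.
have b2 : block m u (u + 2 * w m) = h m * w m - prim m (w m).
  rewrite /block; have -> : u + 2 * w m - u = 2 * w m by ring.
  have -> : u + 2 * w m - (u + w m) = w m by ring.
  have P0 : prim m 0 = 0 by apply: prim_le0.
  rewrite subrr P0.
  by rewrite (prim_ge w_gt0 wS h_gt0 hS (_ : w m <= 2 * w m)); [ring|lra].
have := prim_w w_gt0 wS h_gt0 hS m; rewrite /det3 b0 b1 b2 => pw.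
have -> : (u + 2 * w m - (u + w m)) * 0 + (u - (u + 2 * w m)) * prim m (w m) +
  (u + w m - u) * (h m * w m - prim m (w m)) = w m * (h m * w m - 3 * prim m (w m)) by ring.
have -> : - (h m * w m ^+ 2 / 2) = w m * (- (h m * w m / 2)) by field.
by apply: ler_wpM2l; lra.
Qed.

(* The flag [eps] tells whether a block is inserted.  Sums within [4 * tol'] of
   the new one remain non-affine on [(a, b)] since [3 * tau * 4 < 100]. *)
Definition insertion_spec j (phi : R -> R) (tol a b : R) (r : nat * R * bool * R) :=
  let: (m, u, eps, tol') := r in
  [/\ h m <= 2^-1 ^+ j, w m <= 2^-1 ^+ j & h m * w m <= tol] /\
  [/\ 0 < tol', tol' <= tol / 4 & tol' <= h m * w m / 4] /\
  (eps -> [/\ 0 < u, u + 3 * w m < tau &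
      exists A B, forall t, u <= t <= u + 3 * w m -> phi t = A * t + B]) /\
  exists x y z, [/\ a < x < b, a < y < b, a < z < b &
     100 * tol' <= `|det3 (fun t => phi t + eps%:R * (2^-1 ^+ j * block m u t)) x y z|].

(** If [phi] is already non-affine on the interval, nothing is inserted and the tolerance is reduced
    to preserve this. Otherwise a block goes in the right half, where [det3] sees only the block
    because the affine part drops out. *)
Lemma insertion_step j phi tol a b : 0 < tol -> 0 < a -> a < b -> b < tau ->
  exists r, insertion_spec j phi tol a b r.
Proof.
move=> tol0 a0 ab bt.
have p0 : 0 < (2^-1 : R) ^+ j by rewrite exprn_gt0// invr_gt0.
have [[A [B lin]]|nlin] := pselect (exists A B, forall t, a < t < b -> phi t = A * t + B); last first.
  have [x [y [z [xb yb zb D]]]] : exists x y z, [/\ a < x < b, a < y < b, a < z < b & det3 phi x y z != 0].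
    apply: contrapT => H; apply: nlin; apply: det3_affine => // x y z xb yb zb.
    by apply: contrapT => /eqP D; apply: H; exists x, y, z.
  (* A scale is chosen even without a block: the next tolerance must be small relative to h m * w m
     in all cases. *)
  have [m [h1 h2 h3 _]] := small_scale p0 tol0 ltr01.
  have hw : 0 < h m * w m by rewrite mulr_gt0.
  have dp : 0 < `|det3 phi x y z| / 100 by apply: divr_gt0; [rewrite normr_gt0|exact: ltr0n].
  have [tol' [t0 t1 t2 t3]] := min3_bounds (divr_gt0 tol0 (ltr0n _ 4)) (divr_gt0 hw (ltr0n _ 4)) dp.
  exists (m, 0, false, tol'); split=> //; split=> //; split=> //; exists x, y, z; split=> //.
  have -> : (fun t => phi t + false%:R * (2^-1 ^+ j * block m 0 t)) = phi.
    by apply/funext => t; rewrite mul0r addr0.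
  by rewrite mulrC -ler_pdivlMr ?ltr0n.
pose u := (a + b) / 2.
have bu : 0 < b - u by rewrite /u; lra.
have [m [h1 h2 h3 h4]] := small_scale p0 tol0 bu.
have hm := h_gt0 m; have wm := w_gt0 m; have hw : 0 < h m * w m by rewrite mulr_gt0.
pose v := 2^-1 ^+ j * (h m * w m ^+ 2 / 2).
have v0 : 0 < v by rewrite mulr_gt0// divr_gt0// mulr_gt0// exprn_gt0.
have [tol' [t0 t1 t2 t3]] := min3_bounds (divr_gt0 tol0 (ltr0n _ 4)) (divr_gt0 hw (ltr0n _ 4)) (divr_gt0 v0 (ltr0n _ 100)).
have ub : a < u < b by rewrite /u; lra.
exists (m, u, true, tol'); split=> //; split=> //; split.
  move=> _; split; [by lra|by lra|exists A, B => t tt; apply: lin; lra].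
exists u, (u + w m), (u + 2 * w m); split; try lra.
set f := fun t => _.
have -> : det3 f u (u + w m) (u + 2 * w m) = 2^-1 ^+ j * det3 (block m u) u (u + w m) (u + 2 * w m).
  rewrite /det3 /f !lin; try lra.
  rewrite !mul1r; ring.
have D := det3_block m u.
have nv : 0 <= h m * w m ^+ 2 / 2 by rewrite divr_ge0// mulr_ge0 ?sqr_ge0// ltW.
rewrite normrM (gtr0_norm p0) ler0_norm; last lra.
apply: (@le_trans _ _ v); last by apply: ler_wpM2l; [exact: ltW|lra].
by rewrite mulrC -ler_pdivlMr ?ltr0n.
Qed.

Variable J : nat -> R * R.
Hypothesis J_valid : forall j, [/\ 0 < (J j).1, (J j).1 < (J j).2 & (J j).2 < tau].

Lemma insertion_sequence : exists (r : nat -> nat * R * bool * R) (tol : nat -> R),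
  let phi i t := \sum_(j < i) ((r j).1.2%:R * (2^-1 ^+ j * block (r j).1.1.1 (r j).1.1.2 t)) in
  [/\ tol 0%N = 1, forall j, 0 < tol j, forall j, (r j).2 = tol j.+1 &
      forall j, insertion_spec j (phi j) (tol j) (J j).1 (J j).2 (r j)].
Proof.
(* The choice is made over all states (index, current sum, tolerance) before the recursion; states
   with nonpositive tolerance receive an arbitrary value and are never reached. *)
have [pick Hpick] : {pick : nat * (R -> R) * R -> nat * R * bool * R & forall q, 0 < q.2 ->
    insertion_spec q.1.1 q.1.2 q.2 (J q.1.1).1 (J q.1.1).2 (pick q)}.
  apply: (@choice _ _ (fun q r => 0 < q.2 -> insertion_spec q.1.1 q.1.2 q.2 (J q.1.1).1 (J q.1.1).2 r)).
  move=> [[j phi] tol] /=; have [h1 h2 h3] := J_valid j.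
  have [tol0|ntol] := pselect (0 < tol).
    by have [r Hr] := insertion_step j phi tol0 h1 h2 h3; exists r.
  by exists (0%N, 0, false, 0) => /ntol.
pose st := fix st i : (R -> R) * R := if i is j.+1 then
   let r := pick (j, (st j).1, (st j).2) in
   (fun t => (st j).1 t + r.1.2%:R * (2^-1 ^+ j * block r.1.1.1 r.1.1.2 t), r.2) else (fun=> 0, 1).
have tol0 i : 0 < (st i).2.
  elim: i => [|i IH] //=; have := Hpick (i, (st i).1, (st i).2) IH.
  by case: (pick _) => [[[m u] eps] tol'] /= [_ [[]]].
exists (fun j => pick (j, (st j).1, (st j).2)), (fun j => (st j).2) => phi; split=> // j.
have -> : phi j = (st j).1.
  elim: j => [|j IH]; apply/funext => t; first by rewrite /phi big_ord0.
  by rewrite /phi big_ord_recr /= -IH.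
exact: (Hpick (j, (st j).1, (st j).2) (tol0 j)).
Qed.

End insertion.

(** * Minkowski's inequality for finite sums *)

Section finite_minkowski.
Variable R : realType.

(** (c + d) / (X + Y) is the mean of c / X and d / Y with weights X / (X + Y) and Y / (X + Y);
    convexity of the power function is applied termwise. *)
Lemma sum_powR_minkowski (I : eqType) (D : seq I) (c d : I -> R) (X Y p : R) : 1 <= p ->
  (forall k, 0 <= c k) -> (forall k, 0 <= d k) -> 0 < X -> 0 < Y ->
  \sum_(k <- D) c k `^ p <= X `^ p -> \sum_(k <- D) d k `^ p <= Y `^ p ->
  \sum_(k <- D) (c k + d k) `^ p <= (X + Y) `^ p.
Proof.
move=> p1 c0 d0 X0 Y0 cX dY; pose v := X / (X + Y).
have XY : 0 < X + Y by lra.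
have v0 : 0 <= v by rewrite divr_ge0// ltW.
have v1 : v <= 1 by rewrite /v ler_pdivrMr// mul1r; lra.
have XYp : 0 <= (X + Y) `^ p by exact: powR_ge0.
have conv a b : 0 <= a -> 0 <= b -> (v * a + (1 - v) * b) `^ p <= v * a `^ p + (1 - v) * b `^ p.
  move=> a0 b0; have := @convex_powR R p p1 (Itv01 v0 v1) a b; rewrite !convRE /=.
  by apply; rewrite ?inE/= ?in_itv/= ?andbT.
have step k : (c k + d k) `^ p <=
    (X + Y) `^ p * (v * (c k `^ p / X `^ p) + (1 - v) * (d k `^ p / Y `^ p)).
  have -> : c k + d k = (X + Y) * (v * (c k / X) + (1 - v) * (d k / Y)).
    by rewrite /v; field; rewrite !gt_eqF//; lra.
  have cX0 : 0 <= c k / X by rewrite divr_ge0// ltW.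
  have dY0 : 0 <= d k / Y by rewrite divr_ge0// ltW.
  rewrite powRM; first last.
  - by apply: addr_ge0; apply: mulr_ge0 => //; lra.
  - lra.
  apply: ler_wpM2l => //; apply: le_trans (conv _ _ cX0 dY0) _.
  have iv a b : 0 <= a -> 0 < b -> (a / b) `^ p = a `^ p / b `^ p.
    move=> a0 b0; have b1 := ltW b0; rewrite powRM ?invr_ge0//; congr (_ * _).
    by rewrite -[in LHS]powR_inv1// -powRrM mulN1r powRN.
  by rewrite !iv.
apply: (le_trans (ler_sum _ (fun k _ => step k))).
rewrite -mulr_sumr -[leRHS]mulr1; apply: ler_wpM2l => //.
rewrite big_split /= -!mulr_sumr -!mulr_suml.
have H1 : (\sum_(i <- D) c i `^ p) / X `^ p <= 1 by rewrite ler_pdivrMr ?powR_gt0// mul1r.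
have H2 : (\sum_(i <- D) d i `^ p) / Y `^ p <= 1 by rewrite ler_pdivrMr ?powR_gt0// mul1r.
have := ler_wpM2l v0 H1; have v1' : 0 <= 1 - v by lra.
have := ler_wpM2l v1' H2; lra.
Qed.

End finite_minkowski.

Lemma coef_le_sup (R : realType) (f : R -> R[i]) (a : R) : ccont f -> 0 <= a -> (forall t, normc (f t) <= a) ->
  forall k : int, normc (coef f k%:~R) <= a.
Proof.
move=> cf a0 fa k; apply: normc_le => //.
have := @bessel R [:: k] 0 f cf isT; rewrite big_seq1 subr0 => /le_trans; apply.
have -> : a ^+ 2 = (2 * @pi R)^-1 * sint 0 (2 * @pi R) (fun=> a ^+ 2).
  by rewrite sint_cst ?(ltW (tau_gt0 _))// subr0 mulrC -mulrA mulfV ?mulr1// gt_eqF// tau_gt0.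
apply: ler_wpM2l; first by rewrite invr_ge0 ltW// tau_gt0.
apply: le_sint; [exact: cont_nsq|exact: contC|] => t _.
exact: nsq_le.
Qed.

(** * The series of blocks and its Fourier coefficients *)

Section block_series.
Variable R : realType.
Implicit Types (m n d i j : nat) (s t : R) (D : seq int).
Local Notation tau := (2 * @pi R).
Variables (w h : nat -> R) (halve : nat -> bool).
Hypothesis w_gt0 : forall m, 0 < w m.
Hypothesis wS : forall m, w m.+1 = w m / 2.
Hypothesis h_gt0 : forall m, 0 < h m.
Hypothesis hS : forall m, h m.+1 = if halve m then h m / 2 else h m.
Local Notation block := (block w h halve).
Variables (ms : nat -> nat) (us tol : nat -> R) (eps : nat -> bool).

(** The first-order constant 16 of a block does not shrink with the block; the factor 2^-j makes
    these constants summable, to 32. *)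
Definition layer j t := (eps j)%:R * (2^-1 ^+ j * block (ms j) (us j) t).
Definition layers i t := \sum_(j < i) layer j t.
Definition series_sum t := limn (fun i => layers i t).

Hypothesis tol_gt0 : forall j, 0 < tol j.
Hypothesis tolS : forall j, tol j.+1 <= tol j / 4.
Hypothesis hw_tol : forall j, h (ms j) * w (ms j) <= tol j.
Hypothesis h_small : forall j, h (ms j) <= 2^-1 ^+ j.
Hypothesis inside : forall j, eps j -> [/\ 0 < us j, us j + 3 * w (ms j) < tau &
  exists A B, forall t, us j <= t <= us j + 3 * w (ms j) -> layers j t = A * t + B].

Lemma exp_half_bounds j : 0 < (2^-1 : R) ^+ j <= 1.
Proof. by rewrite exprn_gt0 ?exprn_ile1//; lra. Qed.

Lemma layer_le j t : `|layer j t| <= 2 * tol j.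
Proof.
rewrite /layer normrM normrM; have := block_le w_gt0 wS h_gt0 hS (ms j) (us j) t.
have /andP[p0 p1] := exp_half_bounds j; have := hw_tol j; rewrite (gtr0_norm p0) => h1 h2.
have h3 : 2^-1 ^+ j * `|block (ms j) (us j) t| <= `|block (ms j) (us j) t|.
  by rewrite ler_piMl.
case: (eps j); rewrite ?normr1 ?normr0 ?mul1r ?mul0r; last by have := tol_gt0 j; lra.
lra.
Qed.

Lemma series_cvg t : (fun i => layers i t) @ \oo --> series_sum t /\
  forall i, `|layers i t - series_sum t| <= 4 * tol i.
Proof.
apply: (@telescoping_cvg _ _ (fun i => 4 * tol i)) => i.
  by have := tol_gt0 i; lra.
rewrite /layers big_ord_recr /= addrAC subrr add0r.
by have := layer_le i t; have := tolS i; have := tol_gt0 i; lra.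
Qed.

Lemma layers_outside i t : t <= 0 \/ tau <= t -> layers i t = 0.
Proof.
move=> H; rewrite /layers big1// => -[j ji] _ /=; rewrite /layer.
case E: (eps j); last by rewrite mul0r.
have [u0 u3 _] := inside E; rewrite block_eq0 ?mulr0//.
by case: H => H; [left|right]; lra.
Qed.

Lemma series_outside t : t <= 0 \/ tau <= t -> series_sum t = 0.
Proof.
move=> H; rewrite /series_sum; under eq_fun do rewrite layers_outside//.
exact: lim_cst.
Qed.

Lemma tol_cvg0 : tol @ \oo --> (0 : R).
Proof.
have H : (fun d => tol 0%N * (2^-1) ^+ d) @ \oo --> (tol 0%N * 0 : R).
  apply: cvgM; first exact: cvg_cst.
  by apply: cvg_expr; rewrite ger0_norm; lra.
rewrite mulr0 in H; apply: (squeeze_cvgr _ (cvg_cst (0 : R)) H).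
apply: nearW => n; rewrite (ltW (tol_gt0 n)) /=.
elim: n => [|n IH]; first by rewrite expr0 mulr1.
by rewrite exprS; have := tolS n; have := tol_gt0 n; lra.
Qed.

Lemma series_det3 j x y z : 0 < x < tau -> 0 < y < tau -> 0 < z < tau ->
  100 * tol j <= `|det3 (layers j) x y z| -> det3 series_sum x y z != 0.
Proof.
move=> xt yt zt D; apply/eqP => E.
have := det3_dist (fun t => (series_cvg t).2 j) xt yt zt; rewrite E subr0 => H.
have p2 : @pi R <= 4 by have := pihalf_02_cos_pihalf R; case=> /andP[_]; lra.
have tj := tol_gt0 j.
have : 3 * tau * (4 * tol j) <= 96 * tol j.
  rewrite [leLHS](_ : _ = (24 * pi) * tol j); last by ring.
  by apply: ler_wpM2r; [exact: ltW|lra].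
lra.
Qed.

Section first_order.
Variables (omega : R -> R) (r : R) (gb : nat -> R -> R -> R).
Hypothesis omega_nneg : forall s, 0 <= s -> 0 <= omega s.
Hypothesis gb_fo : forall m u, first_order omega r 16 (block m u) (gb m u).
Hypothesis gb_le : forall m u t, `|gb m u t| <= 4 * h m.

Let glayer j t := (eps j)%:R * (2^-1 ^+ j * gb (ms j) (us j) t).
Let glayers i t := \sum_(j < i) glayer j t.

Lemma layer_first_order j : first_order omega r (16 * 2^-1 ^+ j) (layer j) (glayer j).
Proof.
have /andP[p0 p1] := exp_half_bounds j.
move=> t s sr; have := first_orderZ ((eps j)%:R * 2^-1 ^+ j) (gb_fo (ms j) (us j)) t sr.
rewrite /layer /glayer !mulrA => /le_trans; apply.
have o0 := omega_nneg (normr_ge0 s).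
do 2!apply: ler_wpM2r => //.
rewrite normrM (gtr0_norm p0); case: (eps j); rewrite ?normr1 ?normr0; lra.
Qed.

Lemma layers_first_order i : first_order omega r (32 - 32 * 2^-1 ^+ i) (layers i) (glayers i).
Proof.
elim: i => [|i IH] t s sr.
  rewrite /layers /glayers !big_ord0 expr0 mulr1 !subrr !mul0r mulr0 subrr normr0.
  exact: lexx.
rewrite /layers /glayers !big_ord_recr /=.
have := first_orderD IH (layer_first_order i) t sr.
rewrite /layers /glayers => /le_trans; apply.
have o0 := omega_nneg (normr_ge0 s).
do 2!apply: ler_wpM2r => //.
by rewrite exprS; lra.
Qed.

Lemma series_first_order : exists g, first_order omega r 32 series_sum g.
Proof.
exists (fun t => limn (fun i => glayers i t)) => t s sr.
have cg t' : (fun i => glayers i t') @ \oo --> limn (fun i => glayers i t').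
  (* The candidate derivatives converge since [gb] is at most 4 h <= 4 in size and is multiplied by
     2^-i. *)
  apply: (@telescoping_cvg _ _ (fun i => 8 * 2^-1 ^+ i) _ _).1 => i.
    by have := exp_half_bounds i; lra.
  rewrite /glayers big_ord_recr /= addrAC subrr add0r exprS.
  have /andP[p0 p1] := exp_half_bounds i.
  have h1 := gb_le (ms i) (us i) t'; have h2 := h_small i.
  have h3 : `|gb (ms i) (us i) t'| <= 4 by lra.
  rewrite /glayer; case: (eps i); rewrite ?mul0r ?mul1r ?normr0; last lra.
  have -> : 8 * 2^-1 ^+ i - 8 * (2^-1 * 2^-1 ^+ i) = 2^-1 ^+ i * 4 :> R by field.
  by rewrite normrM (gtr0_norm p0); apply: ler_wpM2l => //; exact: ltW.
have C : (fun i => `|layers i (t + s) - layers i t - s * glayers i t|) @ \oo -->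
    `|series_sum (t + s) - series_sum t - s * limn (fun i => glayers i t)|.
  apply: cvg_norm; apply: cvgB; last by apply: cvgM; [exact: cvg_cst|exact: cg].
  by apply: cvgB; exact: (series_cvg _).1.
apply: (lim_le_cst (N := 0%N) C) => i _; apply: le_trans (layers_first_order i t sr) _.
have o0 := omega_nneg (normr_ge0 s).
do 2!apply: ler_wpM2r => //.
by have := exp_half_bounds i; lra.
Qed.

End first_order.

Lemma layers_cont i : continuous (layers i).
Proof.
apply: cont_sum => j; apply: contM; first exact: contC.
apply: contM; first exact: contC.
exact: (block_cont w_gt0 wS h_gt0 hS).
Qed.

Section fourier.
Variables (lambda p : R) (cost : nat -> R) (S : R).
Hypothesis lambda0 : lambda != 0.
Hypothesis p1 : 1 <= p.
Hypothesis cost_gt0 : forall j, 0 < cost j.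
Hypothesis cost_bump : forall j D a, eps j -> uniq D ->
  \sum_(k <- D) normc (coef (bump w h halve (lambda * 2^-1 ^+ j) (ms j) (us j)) (k%:~R - a)) `^ p <=
  cost j `^ p.
Hypothesis cost_sum : forall i, 1 + \sum_(j < i) cost j <= S.
Hypothesis series_cont : continuous series_sum.

Local Notation F i := (fun t => cis (lambda * layers i t)).

Lemma F_cont i : ccont (F i).
Proof. by apply: ccont_cis; apply: contM; [exact: contC|exact: layers_cont]. Qed.

(** On the support of the new block the previous sum is A t + B, so the increment is the bump times
    one exponential of frequency [lambda * A]. This is where bounds uniform in [a] are needed. *)
Lemma layer_increment j : exists c : int -> R, [/\ forall k, 0 <= c k,
  forall k, normc (coef (F j.+1) k%:~R) <= normc (coef (F j) k%:~R) + c k &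
  forall D, uniq D -> \sum_(k <- D) c k `^ p <= cost j `^ p].
Proof.
case E: (eps j); last first.
  exists (fun=> 0); split=> // [k|D _]; last first.
    by rewrite big1 ?powR_ge0// => k _; rewrite powR0//; apply/eqP; have := p1; lra.
  rewrite addr0 (_ : F j.+1 = F j)//; apply/funext => t.
  by rewrite /layers big_ord_recr /= /layer E mul0r addr0.
have [u0 u3 [A [B lin]]] := inside E.
pose b := bump w h halve (lambda * 2^-1 ^+ j) (ms j) (us j).
have bc : ccont b by exact: (bump_cont w_gt0 wS h_gt0 hS).
exists (fun k => normc (coef b (k%:~R - lambda * A))); split=> [k|k|D uD].
- exact: normc_ge0.
- have H : F j.+1 = (fun t => F j t + cis (lambda * A * t + lambda * B) * b t).
    apply/funext => t; rewrite /layers big_ord_recr /= -/(layers j t) /layer E mul1r mulrDr cisD /b /bump.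
    rewrite mulrA.
    have [tt|nt] := boolP (us j <= t <= us j + 3 * w (ms j)).
      by rewrite lin// (_ : lambda * (A * t + B) = lambda * A * t + lambda * B); ring.
    rewrite block_eq0 ?mulr0 ?cis0 ?subrr ?mulr0 ?addr0 ?mulr1//.
    by move: nt; rewrite negb_and -!ltNge => /orP[]; [left|right]; exact: ltW.
  rewrite H coefD; [|exact: F_cont|]; last first.
    by apply: ccontM => //; apply: ccont_cis; exact: cont_affine.
  rewrite coef_modulate// -[X in _ <= _ + X]mul1r -(normc_cis (lambda * B)) -ComplexField.Normc.normcM.
  by rewrite -[X in normc (_ + X)]opprK; apply: le_trans (le_normcB _ _) _; rewrite normcN.
- exact: cost_bump.
Qed.

Lemma layers_lp i D : uniq D ->
  \sum_(k <- D) normc (coef (F i) k%:~R) `^ p <= (1 + \sum_(j < i) cost j) `^ p.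
Proof.
move=> uD; have pn0 : p != 0 by apply/eqP; have := p1; lra.
elim: i => [|i IH].
  (* The initial 1 is the norm of the constant function 1, whose only nonzero coefficient is at
     0. *)
  rewrite big_ord0 addr0 powR1.
  have E k : normc (coef (F 0) k%:~R) `^ p = (0 == k)%:R.
    have := @coef_cis_int R 0 0 k; rewrite !subr0 => E.
    rewrite (_ : F 0 = (fun t : R => cis (0%:~R * t))); last first.
      by apply/funext => t; rewrite /layers big_ord0 mulr0 mul0r.
    rewrite E; case: (0 == k); first by rewrite ComplexField.Normc.normc1 powR1.
    by rewrite ComplexField.Normc.normc0 powR0.
  under eq_bigr do rewrite E.
  rewrite -natr_sum -[X in _ <= X]/(1%:R) ler_nat.
  rewrite (_ : (\sum_(k <- D) (0%R == k))%N = count_mem (0%R : int) D); last first.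
    by elim: D {uD} => [|k D IH]; rewrite ?big_nil// big_cons /= IH eq_sym.
  by rewrite count_uniq_mem//; case: (_ \in _).
have [c [c0 ci cD]] := layer_increment i.
rewrite big_ord_recr /= addrA.
have S0 : 0 < 1 + \sum_(j < i) cost j.
  by rewrite ltr_pwDl// sumr_ge0// => j _; exact: ltW.
apply: le_trans (sum_powR_minkowski p1 _ c0 S0 (cost_gt0 i) IH (cD D uD)); last first.
  by move=> k; exact: normc_ge0.
apply: ler_sum => k _; apply: ge0_ler_powR; rewrite ?nnegrE ?normc_ge0//.
- by have := p1; lra.
- by rewrite addr_ge0 ?normc_ge0.
- exact: ci.
Qed.

(** For a fixed list, replacing the series by a partial sum changes each coefficient by at most
    |lambda| 4 tol i, hence the norm by at most N times that, which tends to 0. The successor in N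
    keeps it positive for the empty list. *)
Lemma series_lp D : uniq D ->
  \sum_(k <- D) normc (coef (fun t => cis (lambda * series_sum t)) k%:~R) `^ p <= S `^ p.
Proof.
move=> uD; set f := fun t => cis _.
have p0 : 0 < p by have := p1; lra.
have cf : ccont f by apply: ccont_cis; apply: contM; [exact: contC|exact: series_cont].
have S0 : 0 < S by have := cost_sum 0; rewrite big_ord0; lra.
pose N : R := (size D).+1%:R; have N0 : 0 < N by rewrite ltr0n.
have N1 : 1 <= N by rewrite ler1n.
have B i : \sum_(k <- D) normc (coef f k%:~R) `^ p <= (S + N * (`|lambda| * (4 * tol i))) `^ p.
  pose dl := `|lambda| * (4 * tol i).
  have dl0 : 0 < dl by rewrite mulr_gt0 ?normr_gt0// mulr_gt0.
  have LD := layers_lp i uD.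
  have DD : \sum_(k <- D) dl `^ p <= (N * dl) `^ p.
    rewrite big_const_seq count_predT iter_addr_0 -mulr_natl powRM ?(ltW N0) ?(ltW dl0)//.
    apply: ler_wpM2r; first exact: powR_ge0.
    apply: (@le_trans _ _ N); first by rewrite ler_nat.
    by have := ler_powR N1 p1; rewrite powRr1// ltW.
  have S1 : 0 < 1 + \sum_(j < i) cost j.
    by rewrite ltr_pwDl// sumr_ge0// => j _; exact: ltW.
  have M := sum_powR_minkowski p1 (fun k => normc_ge0 (coef (F i) k%:~R)) (fun _ : int => ltW dl0)
     S1 (mulr_gt0 N0 dl0) LD DD.
  apply: le_trans (_ : _ <= (1 + \sum_(j < i) cost j + N * dl) `^ p) _; last first.
    apply: ge0_ler_powR; rewrite ?nnegrE ?(ltW p0)//.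
    - by apply: addr_ge0; apply: ltW => //; exact: mulr_gt0.
    - by apply: addr_ge0; apply: ltW => //; exact: mulr_gt0.
    - by rewrite lerD2r; exact: cost_sum.
  apply: le_trans M; apply: ler_sum => k _; apply: ge0_ler_powR; rewrite ?nnegrE ?normc_ge0//.
  - exact: ltW.
  - by apply: addr_ge0; [exact: normc_ge0|exact: ltW].
  have -> : coef f k%:~R = coef (F i) k%:~R - coef (fun t => F i t - f t) k%:~R.
    by rewrite coefB; [ring|exact: F_cont|exact: cf].
  apply: le_trans (le_normcB _ _) _; rewrite lerD2l.
  apply: coef_le_sup => //.
  - by apply: ccontB; [exact: F_cont|exact: cf].
  - exact: ltW.
  - move=> t; apply: le_trans (normc_cisB _ _) _.
    by rewrite -mulrBr normrM /dl; apply: ler_wpM2l => //; exact: (series_cvg t).2.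
have C : (fun i => (S + N * (`|lambda| * (4 * tol i))) `^ p) @ \oo --> (S + N * (`|lambda| * (4 * 0))) `^ p.
  have Q : (fun i => S + N * (`|lambda| * (4 * tol i))) @ \oo --> (S + N * (`|lambda| * (4 * 0))).
    apply: cvgD; first exact: cvg_cst.
    apply: cvgM; first exact: cvg_cst.
    apply: cvgM; first exact: cvg_cst.
    by apply: cvgM; [exact: cvg_cst|exact: tol_cvg0].
  rewrite !mulr0 addr0 in Q *.
  apply: (cvg_comp _ (fun x => x `^ p) Q).
  have /derivable1_diffP/differentiable_continuous := @ex_derive _ _ _ _ _ _ _ (@is_derive1_powR R p _ S0); exact.
rewrite !mulr0 addr0 in C.
exact: (lim_ge_cst (N := 0%N) C (fun i _ => B i)).
Qed.

End fourier.
End block_series.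

(** * The inverse of [chi] *)

Section chi_inverse.
Variable R : realType.
Implicit Types (x y : R).
Variable omega : R -> R.
Hypothesis omega_cont : {within `[0, +oo[, continuous omega}.
Hypothesis omega_ndecr : {in `[0, +oo[ &, {homo omega : x y / x <= y}}.
Hypothesis omega_pos : forall x, 0 < x -> 0 < omega x.

Lemma chi_lt x y : 0 <= x -> x < y -> chi omega x < chi omega y.
Proof.
move=> x0 xy; have y0 : 0 < y by lra.
have h1 := omega_le omega_ndecr x0 (ltW xy); have h2 := omega_pos y0.
rewrite /chi; apply: le_lt_trans (_ : _ <= x * omega y) _; first exact: ler_wpM2l.
by rewrite ltr_pM2r.
Qed.

Lemma chi_le x y : 0 <= x -> x <= y -> chi omega x <= chi omega y.
Proof. by move=> x0; rewrite le_eqVlt => /predU1P[->//|xy]; exact/ltW/chi_lt. Qed.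

Lemma chi_le_inv x y : 0 <= y -> chi omega x <= chi omega y -> x <= y.
Proof. by move=> y0 H; rewrite leNgt; apply/negP => /(chi_lt y0); rewrite ltNge H. Qed.

Lemma chi0 : chi omega 0 = 0. Proof. by rewrite /chi mul0r. Qed.

Lemma chi_inj : {in `[0, +oo[%classic &, injective (chi omega)}.
Proof.
move=> x y; rewrite !inE /= !in_itv /= !andbT => x0 y0 E.
by apply/eqP; rewrite eq_le; apply/andP; split; apply: chi_le_inv => //; rewrite E.
Qed.

Lemma chi_surj y : 0 <= y -> exists2 x, 0 <= x & chi omega x = y.
Proof.
(* This [b] is at least 1 and b omega 1 >= y, so [chi] exceeds y at [b] and the intermediate value
   theorem applies. *)
move=> y0; have o1 := omega_pos ltr01; pose b := 1 + y / omega 1.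
have q0 : 0 <= y / omega 1 by rewrite divr_ge0// ltW.
have b0 : 0 <= b by rewrite /b; lra.
have cb : y <= chi omega b.
  apply: (@le_trans _ _ (b * omega 1)).
    by rewrite /b mulrDl divfK ?gt_eqF//; lra.
  by apply: ler_wpM2l => //; apply: omega_le => //; rewrite /b; lra.
have sub : `[0, b]%classic `<=` (`[0, +oo[%classic : set R).
  by move=> t /=; rewrite !in_itv /= andbT => /andP[].
have cc : {within `[0, b], continuous (chi omega)}.
  have oc := continuous_subspaceW sub omega_cont.
  by move=> t; apply: cvgM; [exact: (continuous_subspaceT (fun z : R => @cvg_id _ _))|exact: oc].
have [] := @IVT R (chi omega) 0 b y b0 cc.
  by rewrite chi0 ge_min y0 le_max cb orbT.
by move=> c; rewrite in_itv /= => /andP[c0 _] <-; exists c.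
Qed.

Lemma chi_invP y : 0 <= y -> 0 <= chi_inv omega y /\ chi omega (chi_inv omega y) = y.
Proof.
by move=> /chi_surj[x x0 <-]; rewrite /chi_inv (pinvKV (fun=> 0) chi_inj)// inE /= in_itv /= andbT.
Qed.

Lemma chi_inv_le x y : 0 <= x -> x <= y -> chi_inv omega x <= chi_inv omega y.
Proof.
move=> x0 xy; have [h1 h2] := chi_invP x0; have [h3 h4] := chi_invP (le_trans x0 xy).
by apply: chi_le_inv; rewrite ?h2 ?h4.
Qed.

Lemma chi_inv_gt0 y : 0 < y -> 0 < chi_inv omega y.
Proof.
move=> y0; have [h1 h2] := chi_invP (ltW y0); rewrite lt_neqAle h1 andbT.
by apply/eqP => E; move: y0; rewrite -h2 -E chi0 ltxx.
Qed.

Lemma le_chi_inv x y : 0 <= x -> chi omega x <= y -> x <= chi_inv omega y.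
Proof.
move=> x0 xy; have y0 : 0 <= y by apply: le_trans xy; rewrite -chi0; exact: chi_le.
by have [h1 h2] := chi_invP y0; apply: chi_le_inv; rewrite ?h2.
Qed.

Lemma chi_inv_cont y : 0 < y -> {for y, continuous (chi_inv omega)}.
Proof.
move=> y0; have [_ Cx] := chi_invP (ltW y0); have x0 := chi_inv_gt0 y0.
set x := chi_inv omega y in Cx x0.
apply/cvgrPdist_lt => e e0; pose d := Num.min e x / 2.
have m0 : 0 < Num.min e x by rewrite lt_min e0 x0.
have me : Num.min e x <= e by rewrite ge_min lexx.
have mx : Num.min e x <= x by rewrite ge_min lexx orbT.
have d0 : 0 < d by rewrite /d; lra.
have xd : 0 <= x - d by rewrite /d; lra.
have L : chi omega (x - d) < y by rewrite -Cx; apply: chi_lt => //; lra.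
have U : y < chi omega (x + d) by rewrite -Cx; apply: chi_lt; lra.
near=> z.
have zl : chi omega (x - d) < z by near: z; exact: lt_nbhsr.
have zu : z < chi omega (x + d) by near: z; exact: lt_nbhsl.
have z0 : 0 <= z by apply: le_trans (ltW zl); rewrite -chi0; exact: chi_le.
have [h1 h2] := chi_invP z0.
have : x - d <= chi_inv omega z by apply: chi_le_inv => //; rewrite h2 ltW.
have : chi_inv omega z <= x + d by apply: chi_le_inv; rewrite ?h2 ?ltW//; lra.
by move=> u1 u2; rewrite -/x ltr_norml /d in u1 u2 *; lra.
Unshelve. all: by end_near. Qed.

(* Extended by a constant to the left of [1], so as to be continuous on the line. *)
Definition chi_density p (s : R) := chi_inv omega (1 / Num.max s 1) `^ p.

Lemma max1_gt0 (s : R) : 0 < 1 / Num.max s 1.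
Proof. by rewrite divr_gt0// lt_max ltr01 orbT. Qed.

Lemma chi_density_cont p : continuous (chi_density p).
Proof.
move=> s; rewrite /chi_density.
have v0 := chi_inv_gt0 (max1_gt0 s).
have c1 : (fun t : R => 1 / Num.max t 1) @ s --> 1 / Num.max s 1.
  apply: cvgM; first exact: cvg_cst.
  apply: cvgV; first by rewrite gt_eqF// lt_max ltr01 orbT.
  by apply: continuous_max; [exact: cvg_id|exact: cvg_cst].
have c2 : (fun t : R => chi_inv omega (1 / Num.max t 1)) @ s --> chi_inv omega (1 / Num.max s 1).
  by apply: (cvg_comp _ (chi_inv omega) c1); exact: chi_inv_cont (max1_gt0 s).
apply: (cvg_comp _ (fun x => x `^ p) c2).
have /derivable1_diffP/differentiable_continuous := @ex_derive _ _ _ _ _ _ _ (@is_derive1_powR R p _ v0); exact.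
Qed.

Lemma chi_density_ge0 p s : 0 <= chi_density p s. Proof. exact: powR_ge0. Qed.

Lemma chi_density_integral p b : 
  \int[lebesgue_measure]_(t in `[1, b]) (chi_inv omega (1 / t) `^ p) = sint 1 b (chi_density p).
Proof.
apply: (@eq_sint R 1 b) => t; rewrite in_itv /= => /andP[t1 _].
by rewrite /chi_density max_l.
Qed.

End chi_inverse.

(** * Logarithms and lacunary sums *)

Section log_bounds.
Variable R : realType.

Lemma ln2_ge_half : 2^-1 <= ln (2 : R).
Proof.
have -> : 2 = (2^-1)^-1 :> R by rewrite invrK.
rewrite lnV ?posrE ?invr_gt0//.
have := @le_ln1Dx R (- 2^-1); have -> : 1 + - 2^-1 = 2^-1 :> R by field.
have h : -1 < - 2^-1 :> R by lra.
move=> /(_ h); rewrite invrK; lra.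
Qed.

Lemma ln_ge_half (x : R) : 2 <= x -> 2^-1 <= ln x.
Proof. by move=> x2; apply: le_trans ln2_ge_half _; rewrite ler_ln ?posrE//; lra. Qed.

(** From ln x = 2 ln (sqrt x). It keeps the argument (ln |lambda|)^2 / |lambda| of [chi_inv] below
    4. *)
Lemma sqr_ln_le (x : R) : 1 <= x -> ln x ^+ 2 <= 4 * x.
Proof.
move=> x1; have x0 : 0 < x by lra.
have s0 : 0 < Num.sqrt x by rewrite sqrtr_gt0.
have E : ln x = 2 * ln (Num.sqrt x).
  by rewrite -{1}(sqr_sqrtr (ltW x0)) lnXn// mulr_natl.
have := ln_sublinear s0; have := ln_ge0 x1; rewrite E => h1 h2.
have : (2 * ln (Num.sqrt x)) ^+ 2 <= (2 * Num.sqrt x) ^+ 2 by apply: sqr_mono; lra.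
by move=> /le_trans; apply; rewrite exprMn sqr_sqrtr ?(ltW x0)//; lra.
Qed.

Lemma nat_le_ln (n : nat) (x : R) : 2 ^+ n <= x -> n%:R <= 2 * ln x.
Proof.
move=> nx; have p0 : 0 < (2 : R) ^+ n by rewrite exprn_gt0.
have : ln (2 ^+ n) <= ln x by rewrite ler_ln ?posrE//; lra.
rewrite lnXn// => h; rewrite -[ln 2 *+ n]mulr_natl in h; have := ln2_ge_half => h2.
have n0 : 0 <= n%:R :> R by exact: ler0n.
have := ler_wpM2l n0 h2; lra.
Qed.

(** The terms below s form a sequence that at least halves, starting below s; the number of larger
    terms before it, which depends on [lambda], does not matter. *)
Lemma lacunary_sum (g : nat -> R) (s : R) : 0 <= s -> (forall j, 0 <= g j) -> (forall j, g j.+1 <= g j / 2) ->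
  forall i, \sum_(j < i | g j < s) g j <= 2 * s.
Proof.
move=> s0 g0 gS i.
suff : \sum_(j < i | g j < s) g j <= 2 * (if g 0%N < s then g 0%N else s).
  by move/le_trans; apply; case: ltP => h; lra.
elim: i g g0 gS => [|i IH] g g0 gS.
  by rewrite big_ord0; case: ifP => _; have := g0 0%N; lra.
rewrite big_mkcond big_ord_recl /= -big_mkcond /=.
have := IH (fun j => g j.+1) (fun j => g0 j.+1) (fun j => gS j.+1) => /=.
have := gS 0%N; have := g0 0%N; have := g0 1%N.
case: ltP => h1; case: ltP => h2; lra.
Qed.

Lemma half_geometric_sum i : \sum_(j < i) (2^-1 : R) ^+ j <= 2.
Proof.
suff -> : \sum_(j < i) (2^-1 : R) ^+ j = 2 - 2 * 2^-1 ^+ i.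
  by have : 0 <= (2^-1 : R) ^+ i by [rewrite exprn_ge0// invr_ge0]; lra.
elim: i => [|i IH]; first by rewrite big_ord0 expr0; lra.
by rewrite big_ord_recr /= IH exprS; field.
Qed.

Lemma geometric_sum_le (q : R) i : 0 <= q < 1 -> \sum_(j < i) q ^+ j <= (1 - q)^-1.
Proof.
move=> q01; have q1 : 0 < 1 - q by lra.
suff E : (1 - q) * \sum_(j < i) q ^+ j = 1 - q ^+ i.
  rewrite -[leRHS]mul1r ler_pdivlMr// mulrC E.
  by have : 0 <= q ^+ i by [rewrite exprn_ge0//; lra]; lra.
elim: i => [|i IH]; first by rewrite big_ord0 expr0; lra.
by rewrite big_ord_recr /= mulrDr IH exprS; ring.
Qed.
End log_bounds.

(** * Cost of one block in terms of [chi_inv] *)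

Section block_costs.
Variable R : realType.
Implicit Types (m n d i j : nat) (s t : R) (D : seq int).
Local Notation tau := (2 * @pi R).
Variable omega : R -> R.
Hypothesis omega_cont : {within `[0, +oo[, continuous omega}.
Hypothesis omega_ndecr : {in `[0, +oo[ &, {homo omega : x y / x <= y}}.
Hypothesis omega_pos : forall x, 0 < x -> 0 < omega x.
Variables (w h : nat -> R) (halve : nat -> bool).
Hypothesis w_gt0 : forall m, 0 < w m.
Hypothesis wS : forall m, w m.+1 = w m / 2.
Hypothesis h_gt0 : forall m, 0 < h m.
Hypothesis hS : forall m, h m.+1 = if halve m then h m / 2 else h m.
Hypothesis w_le1 : forall m, w m <= 1.
Hypothesis width_pow : forall m, w m * 2 ^+ m <= 1.
Hypothesis width_cvg : forall m, (fun d => w (m + d)) @ \oo --> (0 : R).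
Hypothesis h_omega : forall m, omega (w m) / 2 <= h m <= omega (w m).
Hypothesis omega_w : forall m, omega (w m) <= 2^-1.

Lemma chi_width_half m : chi omega (w m) <= 2^-1.
Proof.
have o1 := omega_w m; have o0 := omega_pos (w_gt0 m).
rewrite /chi; apply: le_trans (_ : _ <= 1 * omega (w m)) _; last lra.
by apply: ler_wpM2r; [exact: ltW|exact: w_le1].
Qed.

Lemma chi_width_gt0 m : 0 < chi omega (w m).
Proof. by rewrite /chi mulr_gt0// omega_pos. Qed.

Lemma chi_widthS m : 2 * chi omega (w m.+1) <= chi omega (w m).
Proof.
rewrite /chi wS; have := w_gt0 m => wm.
have w2 : 0 <= w m / 2 by lra.
have w3 : w m / 2 <= w m by lra.
have := ler_wpM2l (ltW wm) (omega_le omega_ndecr w2 w3); lra.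
Qed.

Variable lambda : R.
Hypothesis lambda2 : 2 <= `|lambda|.
Local Notation lam := (`|lambda|).
Let L := ln lam.
Let lpos : 0 < lam. Proof. by apply: lt_le_trans lambda2. Qed.
Let lnz : lambda != 0. Proof. by rewrite -normr_gt0. Qed.
Let Lhalf : 2^-1 <= L. Proof. exact: ln_ge_half. Qed.

Lemma scaled_abs j : `|lambda * 2^-1 ^+ j| = lam * 2^-1 ^+ j.
Proof. by have /andP[p0 _] := exp_half_bounds R j; rewrite normrM (gtr0_norm p0). Qed.

Lemma scaled_neq0 j : lambda * 2^-1 ^+ j != 0.
Proof. by rewrite mulf_neq0// gt_eqF//; have /andP[] := exp_half_bounds R j. Qed.

Section one.
Variables (j m : nat) (u : R).
Hypothesis u0 : 0 < u.
Hypothesis u3 : u + 3 * w m < tau.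
Hypothesis hm_small : h m <= 2^-1 ^+ j.
Hypothesis wm_small : w m <= 2^-1 ^+ j.
Local Notation b := (bump w h halve (lambda * 2^-1 ^+ j) m u).
Local Notation x := (lam * 2^-1 ^+ j * h m * w m).

(** Since w n <= 2^-n and h n <= 1 / 2, a product still at least 1 forces 2^n <= |lambda|; so only
    O(log |lambda|) scales are ever used. *)
Lemma reached_scale n T : 1 <= T -> T <= lam * 2^-1 ^+ j * h n * w n ->
  T <= lam * (h n * w n) /\ 2 ^+ n <= lam.
Proof.
move=> T1 H; have /andP[p0 p1] := exp_half_bounds R j.
have hn := h_gt0 n; have wn := w_gt0 n.
have hh : h n <= 2^-1 by have /andP[_ h2] := h_omega n; exact: le_trans (omega_w n).
have lhw : 0 <= lam * (h n * w n) by do 2!(apply: mulr_ge0; try exact: ltW).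
have H2 : T <= lam * (h n * w n).
  apply: le_trans H _; rewrite [leLHS](_ : _ = 2^-1 ^+ j * (lam * (h n * w n))); last by ring.
  by rewrite ler_piMl.
split=> //; have q0 : 0 < (2 : R) ^+ n by rewrite exprn_gt0.
have : 2 ^+ n * 1 <= 2 ^+ n * (lam * (h n * w n)).
  by apply: ler_wpM2l; [exact: ltW|exact: le_trans H2].
rewrite mulr1 => /le_trans; apply.
rewrite [leLHS](_ : _ = lam * (h n * (w n * 2 ^+ n))); last by ring.
rewrite -[leRHS]mulr1; apply: ler_wpM2l; first exact: ltW.
apply: (@le_trans _ _ (h n * 1)); last lra.
by apply: ler_wpM2l; [exact: ltW|exact: width_pow].
Qed.

Let Dl := chi_inv omega (L ^+ 2 / lam).

Lemma log_radius_gt0 : 0 < Dl.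
Proof. by apply: (chi_inv_gt0 omega_cont omega_ndecr omega_pos); rewrite divr_gt0// exprn_gt0//; have := Lhalf; lra. Qed.

(* The threshold for [x] is [T = (2 * L) ^+ 2]: the number of scales is [O(L)], and
   [Num.sqrt T] is of the same order. *)
Lemma bump_log_cost D a : uniq D ->
  \sum_(k <- D) normc (coef b (k%:~R - a)) <=
  (if Num.sqrt x < 2 * L then 224 * Num.sqrt x else 0) +
  (1000 * 200) * 12 * 2^-1 ^+ j * (L / omega Dl).
Proof.
move=> uD; have L' := Lhalf; have p12 : 1 <= (1 : R) <= 2 by lra.
have oD : 0 < omega Dl by apply: omega_pos; exact: log_radius_gt0.
have /andP[p0 p1] := exp_half_bounds R j.
have E1 : \sum_(k <- D) normc (coef b (k%:~R - a)) = \sum_(k <- D) normc (coef b (k%:~R - a)) `^ 1.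
  by apply: eq_bigr => k _; rewrite powRr1 ?normc_ge0.
have hm := h_gt0 m; have wm := w_gt0 m.
have x0 : 0 < x by do 3!(apply: mulr_gt0 => //).
have second0 : 0 <= (1000 * 200) * 12 * 2^-1 ^+ j * (L / omega Dl).
  apply: mulr_ge0; last by apply: divr_ge0; [lra|exact: ltW].
  by apply: mulr_ge0; [lra|exact: ltW].
rewrite E1; case: ltP => xT.
  have := bump_lp_small w_gt0 wS h_gt0 hS w_le1 u0 u3 (scaled_neq0 j) p12 a uD.
  rewrite /= scaled_abs !powRr1 ?sqrtr_ge0 ?(ltW wm)// mulfV ?gt_eqF// mul1r => h1.
  by apply: le_trans h1 _; rewrite lerDl.
have T1 : 1 <= 4 * L ^+ 2.
  rewrite (_ : 4 * L ^+ 2 = (2 * L) ^+ 2); last by ring.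
  by rewrite expr_ge1//; lra.
have sT : Num.sqrt (4 * L ^+ 2) = 2 * L.
  rewrite (_ : 4 * L ^+ 2 = (2 * L) ^+ 2); last by ring.
  by rewrite sqrtr_sqr ger0_norm//; lra.
have Tx : 4 * L ^+ 2 <= `|lambda * 2^-1 ^+ j| * h m * w m.
  rewrite scaled_abs -(sqr_sqrtr (ltW x0)) (_ : 4 * L ^+ 2 = (2 * L) ^+ 2); last by ring.
  by apply: sqr_mono => //; lra.
have [d [Td]] := bump_lp_large w_gt0 wS h_gt0 hS w_le1 u0 u3 (scaled_neq0 j) p12 a uD T1 Tx (width_cvg m).
rewrite /= sT => h1; apply: le_trans h1 _; rewrite add0r.
rewrite scaled_abs in Td; set n := (m + d)%N in Td *.
have [lT ln2] := reached_scale T1 Td.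
have hn := h_gt0 n; have wn := w_gt0 n.
(* At the stopping scale chi (w n) >= h n w n >= 4 L^2 / |lambda|, which exceeds chi Dl. *)
have wDl : Dl <= w n.
  have [e1 e2] : 0 <= Dl /\ chi omega Dl = L ^+ 2 / lam.
    by apply: (chi_invP omega_cont omega_ndecr omega_pos); rewrite divr_ge0 ?sqr_ge0// ltW.
  apply: (chi_le_inv omega_ndecr omega_pos); first exact: ltW.
  rewrite e2 ler_pdivrMr// /chi.
  have := h_omega n => /andP[_ hn2].
  have : lam * (h n * w n) <= w n * omega (w n) * lam.
    rewrite [leRHS](_ : _ = lam * (omega (w n) * w n)); last by ring.
    by apply: ler_wpM2l; [exact: ltW|apply: ler_wpM2r => //; exact: ltW].
  by have := sqr_ge0 L; lra.
have hDl : omega Dl / 2 <= h n.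
  have /andP[h3 _] := h_omega n.
  by have := omega_le omega_ndecr (ltW log_radius_gt0) wDl; rewrite -/Dl; lra.
have ratio k : h m / h (m + k) * (w (m + k) `^ 1 / w (m + k)) = h m / h (m + k).
  by rewrite powRr1 ?(ltW (w_gt0 _))// mulfV ?mulr1// gt_eqF// w_gt0.
rewrite ratio; under eq_bigr do rewrite ratio.
have S1 : \sum_(i < d.+1) h m / h (m + i) <= d.+1%:R * (h m / h n).
  rewrite mulr_natl -[leRHS](_ : \sum_(i < d.+1) h m / h n = _); last first.
    by rewrite sumr_const card_ord.
  apply: ler_sum => i _; apply: ler_wpM2l; first exact: ltW.
  rewrite lef_pV2 ?posrE ?h_gt0//.
  have -> : n = (m + i + (d - i))%N by rewrite /n -addnA subnKC// -ltnS.
  exact: (h_le h_gt0 hS).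
have nL : n%:R <= 2 * L by apply: nat_le_ln.
have dL : d%:R <= 2 * L by apply: le_trans nL; rewrite ler_nat leq_addl.
have ratio0 : 0 <= h m / h n by rewrite divr_ge0// ltW.
have T2 : 4 * L ^+ 2 / (2 * L) `^ 1 = 2 * L.
  by rewrite powRr1; [field; apply/eqP; lra|lra].
rewrite T2.
suff Hs (K : R) : 0 <= K -> K * (\sum_(i < d.+1) h m / h (m + i) + h m / h (m + d) * (2 * L)) <=
    K * 12 * 2^-1 ^+ j * (L / omega Dl) by apply: Hs; lra.
move=> K0; rewrite [leRHS](_ : _ = K * (12 * (2^-1 ^+ j * (L / omega Dl)))); last by ring.
 apply: ler_wpM2l => //.
(* As 1 <= 2 L, the d + 1 scales contribute at most 4 L and the tail 2 L; the comparison of h n with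
   omega Dl doubles this to 12. *)
apply: (@le_trans _ _ (6 * L * (h m / h n))).
  rewrite -natr1 in S1.
  have : (d%:R + 1) * (h m / h n) <= 4 * L * (h m / h n) by apply: ler_wpM2r => //; lra.
  lra.
have : h m / h n <= 2^-1 ^+ j * (2 / omega Dl).
  apply: ler_pM => //; first exact: ltW; first by rewrite invr_ge0 ltW.
  rewrite -[leRHS]invrK lef_pV2 ?posrE ?invr_gt0 ?divr_gt0// invf_div; lra.
have L6 : 0 <= 6 * L by lra.
move=> /(ler_wpM2l L6) /le_trans; apply.
by rewrite [leLHS](_ : _ = 12 * (2^-1 ^+ j * (L / omega Dl)))//; ring.
Qed.

Variable p : R.
Hypothesis p12 : 1 < p < 2.

(** For p > 1 the threshold is T = 1: the factor w^(p-1) stays in the scale sum, which is then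
    compared with the integral, so no logarithm is spent. The bound w m <= 2^-j provides decay in
    [j] for blocks below the threshold. *)
Lemma bump_power_cost D a : uniq D -> exists2 n, (x < 1 \/ 1 <= lam * (h n * w n)) &
  \sum_(k <- D) normc (coef b (k%:~R - a)) `^ p <=
  224 * (2^-1 ^+ j) `^ (p - 1) +
  (1000 * 200) * 4 * 2^-1 ^+ j * (if x < 1 then 0 else \sum_(l < n.+1) w l `^ (p - 1) / omega (w l)).
Proof.
move=> uD; have p12' : 1 <= p <= 2 by have := p12; lra.
have /andP[p0 p1] := exp_half_bounds R j.
have hm := h_gt0 m; have wm := w_gt0 m.
have x0 : 0 < x by do 3!(apply: mulr_gt0 => //).
have wp n : w n `^ p / w n = w n `^ (p - 1).
  by rewrite powRB ?powRr1 ?(ltW (w_gt0 n))// (gt_eqF (w_gt0 n)) implybT.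
case: (ltP x 1) => x1.
  exists 0%N; first by left.
  have := bump_lp_small w_gt0 wS h_gt0 hS w_le1 u0 u3 (scaled_neq0 j) p12' a uD.
  rewrite /= scaled_abs wp mulr0 addr0 => /le_trans; apply.
  apply: ler_wpM2l => //; rewrite -[leRHS]mulr1; apply: ler_pM; try exact: powR_ge0.
    by apply: ge0_ler_powR; rewrite ?nnegrE ?(ltW p0) ?(ltW wm)//; have := p12; lra.
  have e1 : 1 `^ p = 1 :> R by rewrite powR1.
  rewrite -[leRHS]e1; apply: ge0_ler_powR; rewrite ?nnegrE ?sqrtr_ge0//; first by have := p12; lra.
  by rewrite -[leRHS]sqrtr1 ler_wsqrtr// ltW.
have Tx : 1 <= `|lambda * 2^-1 ^+ j| * h m * w m by rewrite scaled_abs.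
have [d [Td]] := bump_lp_large w_gt0 wS h_gt0 hS w_le1 u0 u3 (scaled_neq0 j) p12' a uD (lexx 1) Tx (width_cvg m).
rewrite scaled_abs in Td; set n := (m + d)%N in Td *.
have [lT _] := reached_scale (lexx 1) Td.
rewrite /= sqrtr1 powR1 divr1 mulr1 => h1; exists n; first by right.
apply: le_trans h1 _; apply: (@le_trans _ _ (0 + (1000 * 200) * 4 * 2^-1 ^+ j * \sum_(l < n.+1) w l `^ (p - 1) / omega (w l))); last first.
  by rewrite lerD2r mulr_ge0// powR_ge0.
rewrite add0r.
suff Hs (K : R) : 0 <= K -> K * (\sum_(j0 < d.+1) h m / h (m + j0) * (w (m + j0) `^ p / w (m + j0)) +
   h m / h n * (w n `^ p / w n)) <= K * 4 * 2^-1 ^+ j * \sum_(l < n.+1) w l `^ (p - 1) / omega (w l).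
  by apply: Hs; lra.
move=> K0; rewrite [leRHS](_ : _ = K * (4 * (2^-1 ^+ j * \sum_(l < n.+1) w l `^ (p - 1) / omega (w l)))); last by ring.
apply: ler_wpM2l => //.
set st := fun k => h m / h (m + k) * (w (m + k) `^ p / w (m + k)).
have st0 k : 0 <= st k.
  by rewrite /st mulr_ge0 ?divr_ge0 ?powR_ge0 ?(ltW (h_gt0 _)) ?(ltW (w_gt0 _)).
have stle k : st k <= 2 * (2^-1 ^+ j * (w (m + k) `^ (p - 1) / omega (w (m + k)))).
  have ok := omega_pos (w_gt0 (m + k)); have hk := h_gt0 (m + k); have /andP[hb1 _] := h_omega (m + k).
  rewrite /st wp.
  have : h m / h (m + k) <= 2^-1 ^+ j * (2 / omega (w (m + k))).
    apply: ler_pM => //; first exact: ltW; first by rewrite invr_ge0 ltW.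
    rewrite -[leRHS]invrK lef_pV2 ?posrE ?invr_gt0 ?divr_gt0// invf_div; lra.
  move=> /(ler_wpM2r (powR_ge0 (w (m + k)) (p - 1))) /le_trans; apply.
  by rewrite [leLHS](_ : _ = 2 * (2^-1 ^+ j * (w (m + k) `^ (p - 1) / omega (w (m + k)))))//; ring.
have last_le : st d <= \sum_(i < d.+1) st i.
  by rewrite big_ord_recr /= lerDr sumr_ge0// => i _; exact: st0.
apply: (@le_trans _ _ (2 * \sum_(i < d.+1) st i)).
  by rewrite mulrDl mul1r; exact: lerD.
apply: (@le_trans _ _ (2 * \sum_(i < d.+1) 2 * (2^-1 ^+ j * (w (m + i) `^ (p - 1) / omega (w (m + i)))))).
  by apply: ler_wpM2l => //; apply: ler_sum => i _; exact: stle.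
rewrite -!mulr_sumr mulrA.
have -> : 2 * 2 = 4 :> R by ring.
apply: ler_wpM2l => //; apply: ler_wpM2l; first exact: ltW.
(* The scales before [m] are added so that the final sum does not depend on the position of the
   block in the cascade. *)
rewrite -(big_mkord xpredT (fun l => w l `^ (p - 1) / omega (w l))) (@big_cat_nat _ _ _ m) //=; last first.
  by rewrite /n leqW// leq_addr.
rewrite -[leLHS]add0r; apply: lerD.
  by apply: sumr_ge0 => i _; rewrite divr_ge0 ?powR_ge0// ltW// omega_pos.
rewrite -[X in \sum_(X <= _ < _) _]add0n big_addn big_mkord /n -addnS addKn.
by apply: ler_sum => i _; rewrite addnC.
Qed.

End one.

(* The intervals [[1 / (2 * chi (w l)), 1 / chi (w l)]] do not overlap, and on each
   of them the integrand is at least [w l `^ p]. *)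
Lemma scale_sum_le_integral p n : 0 < p ->
  \sum_(l < n.+1) w l `^ (p - 1) / omega (w l) <= 2 * sint 1 (chi omega (w n))^-1 (chi_density omega p).
Proof.
move=> p0; have cd := chi_density_cont omega_cont omega_ndecr omega_pos (p := p).
have dp a b : 0 <= sint a b (chi_density omega p) by apply: sint_ge0 => t; exact: chi_density_ge0.
have I1 l : 1 <= (2 * chi omega (w l))^-1.
  by have c1 := chi_width_gt0 l; have c2 := chi_width_half l; rewrite -[leLHS]invr1 lef_pV2 ?posrE//; lra.
have I2 l : (2 * chi omega (w l))^-1 <= (chi omega (w l))^-1.
  by have c1 := chi_width_gt0 l; rewrite lef_pV2 ?posrE//; lra.
have one l : w l `^ (p - 1) / omega (w l) <=
    2 * sint (2 * chi omega (w l))^-1 (chi omega (w l))^-1 (chi_density omega p).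
  have c1 := chi_width_gt0 l; have wl := w_gt0 l; have ol := omega_pos wl.
  have H : sint (2 * chi omega (w l))^-1 (chi omega (w l))^-1 (fun=> w l `^ p) <=
      sint (2 * chi omega (w l))^-1 (chi omega (w l))^-1 (chi_density omega p).
    apply: le_sint => [||t]; [exact: contC|exact: cd|].
    rewrite in_itv /= => /andP[t1 t2]; rewrite /chi_density.
    have t1' : 1 <= t by apply: le_trans t1.
    rewrite max_l//; apply: ge0_ler_powR; rewrite ?nnegrE ?(ltW p0) ?(ltW wl)//.
      apply: ltW; apply: (chi_inv_gt0 omega_cont omega_ndecr omega_pos).
      by rewrite divr_gt0//; lra.
    apply: (le_chi_inv omega_cont omega_ndecr omega_pos); first exact: ltW.
    rewrite mul1r -[leLHS]invrK lef_pV2 ?posrE ?invr_gt0//; lra.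
  rewrite sint_cst// in H.
  apply: le_trans (_ : _ <= 2 * (w l `^ p * ((chi omega (w l))^-1 - (2 * chi omega (w l))^-1))) _; last lra.
  rewrite powRB ?powRr1 ?(ltW wl)// ?(gt_eqF wl) ?implybT// /chi.
  rewrite [leLHS](_ : _ = 2 * (w l `^ p * ((w l * omega (w l))^-1 - (2 * (w l * omega (w l)))^-1)))//.
  by field; rewrite !gt_eqF.
elim: n => [|n IH].
  rewrite big_ord_recl big_ord0 addr0; apply: le_trans (one 0%N) _.
  apply: ler_wpM2l => //.
  rewrite (@sint_split R 1 (2 * chi omega (w 0))^-1 (chi omega (w 0))^-1) ?I1 ?I2//.
  by rewrite lerDr.
rewrite big_ord_recr /=; apply: le_trans (lerD IH (one n.+1)) _.
have c1 := chi_width_gt0 n.+1; have c2 := chi_widthS n; have c3 := chi_width_gt0 n.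
have J1 : (chi omega (w n))^-1 <= (2 * chi omega (w n.+1))^-1 by rewrite lef_pV2 ?posrE//; lra.
have J0 : 1 <= (chi omega (w n))^-1 by apply: le_trans (I1 n) (I2 n).
rewrite (@sint_split R 1 (chi omega (w n))^-1 (chi omega (w n.+1))^-1)//; last first.
  by rewrite J0 (le_trans J1 (I2 _)).
rewrite (@sint_split R (chi omega (w n))^-1 (2 * chi omega (w n.+1))^-1 (chi omega (w n.+1))^-1)//; last first.
  by rewrite J1 I2.
have := dp (chi omega (w n))^-1 (2 * chi omega (w n.+1))^-1; lra.
Qed.

Lemma scale_sum_le_integral_lambda p n : 0 < p -> 1 <= lam * (h n * w n) ->
  \sum_(l < n.+1) w l `^ (p - 1) / omega (w l) <= 2 * sint 1 lam (chi_density omega p).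
Proof.
move=> p0 H; apply: le_trans (scale_sum_le_integral n p0) _; apply: ler_wpM2l => //.
have cd := chi_density_cont omega_cont omega_ndecr omega_pos (p := p).
have c1 := chi_width_gt0 n; have c2 := chi_width_half n.
have J1 : (chi omega (w n))^-1 <= lam.
  have /andP[_ hn] := h_omega n; have wn := w_gt0 n.
  rewrite -[leLHS]mul1r ler_pdivrMr//.
  apply: le_trans H _; apply: ler_wpM2l; first exact: ltW.
  by rewrite /chi mulrC; apply: ler_wpM2l => //; exact: ltW.
rewrite (@sint_split R 1 (chi omega (w n))^-1 lam)//; last first.
  by rewrite J1 andbT -[leLHS]invr1 lef_pV2 ?posrE//; lra.
by rewrite lerDl; apply: sint_ge0 => t; exact: chi_density_ge0.
Qed.

End block_costs.

(** * Summing the costs of all blocks *)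

Section series_norms.
Variable R : realType.
Implicit Types (m n d i j : nat) (s t : R) (D : seq int).
Local Notation tau := (2 * @pi R).
Variable omega : R -> R.
Hypothesis omega_cont : {within `[0, +oo[, continuous omega}.
Hypothesis omega_ndecr : {in `[0, +oo[ &, {homo omega : x y / x <= y}}.
Hypothesis omega_pos : forall x, 0 < x -> 0 < omega x.
Variables (w h : nat -> R) (halve : nat -> bool).
Hypothesis w_gt0 : forall m, 0 < w m.
Hypothesis wS : forall m, w m.+1 = w m / 2.
Hypothesis h_gt0 : forall m, 0 < h m.
Hypothesis hS : forall m, h m.+1 = if halve m then h m / 2 else h m.
Hypothesis w_le1 : forall m, w m <= 1.
Hypothesis width_pow : forall m, w m * 2 ^+ m <= 1.
Hypothesis width_cvg : forall m, (fun d => w (m + d)) @ \oo --> (0 : R).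
Hypothesis h_omega : forall m, omega (w m) / 2 <= h m <= omega (w m).
Hypothesis omega_w : forall m, omega (w m) <= 2^-1.
Variables (ms : nat -> nat) (us tol : nat -> R) (eps : nat -> bool).
Hypothesis tol_gt0 : forall j, 0 < tol j.
Hypothesis tolS : forall j, tol j.+1 <= tol j / 4.
Hypothesis tol_hw : forall j, tol j.+1 <= h (ms j) * w (ms j) / 4.
Hypothesis hw_tol : forall j, h (ms j) * w (ms j) <= tol j.
Hypothesis h_small : forall j, h (ms j) <= 2^-1 ^+ j.
Hypothesis w_small : forall j, w (ms j) <= 2^-1 ^+ j.
Hypothesis inside : forall j, eps j -> [/\ 0 < us j, us j + 3 * w (ms j) < tau &
  exists A B, forall t, us j <= t <= us j + 3 * w (ms j) -> layers w h halve ms us eps j t = A * t + B].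
Local Notation phi := (series_sum w h halve ms us eps).
Hypothesis series_cont : continuous phi.

Local Notation lp_sum p lambda D :=
  (\sum_(k <- D) normc (coef (fun t => cis (lambda * phi t)) k%:~R) `^ p).

Section fixed_lambda.
Variable lambda : R.
Hypothesis lambda2 : 2 <= `|lambda|.
Let lam : R := `|lambda|.
Let L : R := ln lam.

Let x j : R := lam * 2^-1 ^+ j * h (ms j) * w (ms j).
Let x_ge0 j : 0 <= x j.
Proof.
have /andP[p0 _] := exp_half_bounds R j; have hm := h_gt0 (ms j); have wm := w_gt0 (ms j).
by apply: mulr_ge0; [apply: mulr_ge0; [apply: mulr_ge0|]|]; rewrite ?normr_ge0//; exact: ltW.
Qed.

(** The tolerances make h w drop by a factor 4 from one block to the next, so the square roots at
    least halve, and the unresolved blocks contribute only O(L) in total. *)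
Lemma sqrt_lacunary j : Num.sqrt (x j.+1) <= Num.sqrt (x j) / 2.
Proof.
have /andP[p0 p1] := exp_half_bounds R j.
have E : Num.sqrt (x j) / 2 = Num.sqrt (x j / 4).
  have i0 : 0 <= 2^-1 :> R by rewrite invr_ge0.
  have -> : x j / 4 = x j * 2^-1 ^+ 2 by field.
  by rewrite (sqrtrM _ (x_ge0 j)) (sqrtr_sqr (2^-1 : R)) (ger0_norm i0).
rewrite E; apply: ler_wsqrtr.
have hw : h (ms j.+1) * w (ms j.+1) <= h (ms j) * w (ms j) / 4 by apply: le_trans (hw_tol _) (tol_hw j).
have c0 : 0 <= lam * 2^-1 ^+ j by rewrite mulr_ge0 ?normr_ge0// ltW.
have q0 : 0 <= h (ms j.+1) * w (ms j.+1) by rewrite mulr_ge0// ltW.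
rewrite /x exprS.
apply: (@le_trans _ _ (lam * 2^-1 ^+ j * (h (ms j.+1) * w (ms j.+1)))).
  rewrite [leLHS](_ : _ = lam * 2^-1 ^+ j * (h (ms j.+1) * w (ms j.+1)) / 2); last by field.
  by have := mulr_ge0 c0 q0; lra.
apply: le_trans (ler_wpM2l c0 hw) _.
by rewrite [leLHS](_ : _ = lam * 2^-1 ^+ j * h (ms j) * w (ms j) / 4)//; ring.
Qed.

Let lnz : lambda != 0. Proof. by rewrite -normr_gt0; apply: lt_le_trans lambda2. Qed.

Lemma series_log_bound_omega D : uniq D ->
  lp_sum 1 lambda D <= 1 + 224 * (4 * L) + 1000 * 200 * 12 * 2 * (L / omega (chi_inv omega (L ^+ 2 / lam))).
Proof.
move=> uD; have Lhalf : 2^-1 <= L by exact: ln_ge_half.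
set q := L / omega _.
have D0 : 0 < chi_inv omega (L ^+ 2 / lam).
  exact: (log_radius_gt0 omega_cont omega_ndecr omega_pos lambda2).
have q0 : 0 < q by apply: divr_gt0; [lra|exact: omega_pos].
pose g j := Num.sqrt (x j).
pose cost j := (if g j < 2 * L then 224 * g j else 0) + 1000 * 200 * 12 * 2^-1 ^+ j * q.
have first0 j : 0 <= (if g j < 2 * L then 224 * g j else 0).
  by have := sqrtr_ge0 (x j); rewrite -/(g j) => g0; case: ifP => _; lra.
have cost0 j : 0 < cost j.
  have /andP[p0 _] := exp_half_bounds R j.
  apply: ltr_wpDl; first exact: first0.
  by apply: mulr_gt0; [apply: mulr_gt0; [lra|exact: p0]|exact: q0].
have costB j D' a : eps j -> uniq D' ->
    \sum_(k <- D') normc (coef (bump w h halve (lambda * 2^-1 ^+ j) (ms j) (us j)) (k%:~R - a)) `^ 1 <=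
    cost j `^ 1.
  move=> ej uD'; have [u0 u3 _] := inside ej.
  under eq_bigr do rewrite powRr1 ?normc_ge0//.
  rewrite powRr1 ?(ltW (cost0 j))//.
  exact: (bump_log_cost omega_cont omega_ndecr omega_pos w_gt0 wS h_gt0 hS w_le1 width_pow
    width_cvg h_omega omega_w lambda2 u0 u3 (h_small j)).
have sumB i : 1 + \sum_(j < i) cost j <= 1 + 224 * (4 * L) + 1000 * 200 * 12 * 2 * q.
  rewrite -addrA lerD2l big_split /=; apply: lerD.
    rewrite -big_mkcond /= -mulr_sumr; apply: ler_wpM2l => //.
    rewrite (_ : 4 * L = 2 * (2 * L)); last by ring.
    apply: lacunary_sum => [|j|j]; [lra|exact: sqrtr_ge0|exact: sqrt_lacunary].
  rewrite -mulr_suml -mulr_sumr; apply: ler_wpM2r; first exact: (ltW q0).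
  by apply: ler_wpM2l; [lra|exact: half_geometric_sum].
have := series_lp w_gt0 wS h_gt0 hS tol_gt0 tolS hw_tol inside lnz (lexx 1) cost0 costB sumB series_cont uD.
have nn := sumB 0%N; rewrite big_ord0 addr0 in nn.
by rewrite (powRr1 (le_trans ler01 nn)).
Qed.

Section power.
Variable p : R.
Hypothesis p12 : 1 < p < 2.
Local Notation I := (sint 1 lam (chi_density omega p)).
(** Minkowski's inequality adds norms, so the factor (2^-j)^(p-1) in the cost of the j-th block
    enters through its p-th root q^j; p > 1 makes this a convergent geometric series. *)
Local Notation q := (2^-1 `^ ((p - 1) / p) : R).

Lemma power_ratio_bounds : 0 <= q < 1.
Proof.
rewrite powR_ge0 /=; have p0 : 0 < (p - 1) / p by have := p12; move=> ?; apply: divr_gt0; lra.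
have e1 : 1 `^ ((p - 1) / p) = 1 :> R by rewrite powR1.
by rewrite -[ltRHS]e1; apply: gt0_ltr_powR; rewrite ?nnegrE//; lra.
Qed.

Lemma power_ratioE j : (q ^+ j) `^ p = (2^-1 ^+ j) `^ (p - 1).
Proof.
have pn0 : p != 0 by have := p12; move=> ?; apply/eqP; lra.
have i0 : 0 <= 2^-1 :> R by rewrite invr_ge0.
rewrite -(powR_mulrn j (powR_ge0 _ _)) -(powR_mulrn j i0) -!powRrM; congr (_ `^ _).
by rewrite mulrCA (divfK pn0).
Qed.

Lemma series_power_bound_integral D : uniq D ->
  lp_sum p lambda D <= ((1 + (1 - q)^-1) * (224 + 1000 * 200 * 8 * I) `^ p^-1) `^ p.
Proof.
move=> uD; set A := 224 + _; have p12' := p12.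
have p0 : 0 < p by lra.
have pn0 : p != 0 by rewrite gt_eqF.
have I0 : 0 <= I by apply: sint_ge0 => t; exact: chi_density_ge0.
have A1 : 1 <= A by rewrite /A; lra.
have A1p : 1 <= A `^ p^-1.
  have e1 : 1 `^ p^-1 = 1 :> R by rewrite powR1.
  by rewrite -[leLHS]e1; apply: ge0_ler_powR; rewrite ?nnegrE ?invr_ge0 ?(ltW p0)//; lra.
have /andP[q0 q1] := power_ratio_bounds.
have qp : 0 < q by rewrite powR_gt0// invr_gt0.
pose cost j := A `^ p^-1 * q ^+ j.
have cost0 j : 0 < cost j by apply: mulr_gt0; [lra|rewrite exprn_gt0].
have costE j : cost j `^ p = A * (2^-1 ^+ j) `^ (p - 1).
  rewrite /cost powRM ?powR_ge0 ?exprn_ge0// power_ratioE -powRrM mulVf// powRr1//; lra.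
have costB j D' a : eps j -> uniq D' ->
    \sum_(k <- D') normc (coef (bump w h halve (lambda * 2^-1 ^+ j) (ms j) (us j)) (k%:~R - a)) `^ p <=
    cost j `^ p.
  move=> ej uD'; have [u0 u3 _] := inside ej; rewrite costE.
  have /andP[e0 e1] := exp_half_bounds R j.
  (* Since p - 1 < 1, the factor 2^-j of the resolved part is dominated by that of the other
     part. *)
  have E : 2^-1 ^+ j <= (2^-1 ^+ j) `^ (p - 1) :> R.
    have Ey : 2^-1 ^+ j = (2^-1 ^+ j) `^ (p - 1) * (2^-1 ^+ j) `^ (2 - p) :> R.
      rewrite -powRD ?(gt_eqF e0) ?implybT// (_ : p - 1 + (2 - p) = 1); last by ring.
      by rewrite powRr1// ltW.
    rewrite [leLHS]Ey -[leRHS]mulr1; apply: ler_wpM2l; first exact: powR_ge0.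
    have e2 : 1 `^ (2 - p) = 1 :> R by rewrite powR1.
    by rewrite -[leRHS]e2; apply: ge0_ler_powR; rewrite ?nnegrE ?(ltW e0)//; lra.
  have [n Hn] := bump_power_cost omega_pos w_gt0 wS h_gt0 hS w_le1 width_pow
    width_cvg h_omega omega_w lambda2 u0 u3 (h_small j) (w_small j) p12 a uD'.
  move=> /le_trans; apply.
  rewrite [leRHS](_ : _ = 224 * (2^-1 ^+ j) `^ (p - 1) + 1000 * 200 * 8 * I * (2^-1 ^+ j) `^ (p - 1)); last by rewrite /A; ring.
  apply: lerD; first exact: lexx.
  have H : (if x j < 1 then 0 else \sum_(l < n.+1) w l `^ (p - 1) / omega (w l)) <= 2 * I.
    case: Hn => Hn; first by rewrite /x Hn mulr_ge0.
    case: ifP => _; first by rewrite mulr_ge0.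
    exact: (scale_sum_le_integral_lambda omega_cont omega_ndecr omega_pos w_gt0 wS w_le1 h_omega omega_w lambda2 p0 Hn).
  suff Hs (K : R) : 0 <= K -> K * 4 * 2^-1 ^+ j *
      (if x j < 1 then 0 else \sum_(l < n.+1) w l `^ (p - 1) / omega (w l)) <=
      K * 8 * I * (2^-1 ^+ j) `^ (p - 1) by apply: Hs; lra.
  move=> K0; have c0 : 0 <= K * 4 * 2^-1 ^+ j by apply: mulr_ge0; [lra|exact: ltW].
  apply: le_trans (ler_wpM2l c0 H) _.
  rewrite [leLHS](_ : _ = K * 8 * I * 2^-1 ^+ j); last by ring.
  by apply: ler_wpM2l => //; apply: mulr_ge0 => //; lra.
have sumB i : 1 + \sum_(j < i) cost j <= (1 + (1 - q)^-1) * A `^ p^-1.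
  rewrite mulrDl mul1r; apply: lerD => //.
  rewrite -mulr_sumr mulrC; apply: ler_wpM2r; first exact: powR_ge0.
  by apply: geometric_sum_le; rewrite q0 q1.
have p1 : 1 <= p by lra.
exact: (series_lp w_gt0 wS h_gt0 hS tol_gt0 tolS hw_tol inside lnz p1 cost0 costB sumB series_cont uD).
Qed.
End power.
End fixed_lambda.

(** The identity r omega r = L^2 / |lambda| at r = chi_inv (L^2 / |lambda|) turns L / omega r into
    (|lambda| / L) r. The term of order L is absorbed because omega r is bounded. *)
Lemma series_log_bound : exists2 c : R, 0 < c & forall lambda, 2 <= `|lambda| -> forall D, uniq D ->
  lp_sum 1 lambda D <= c * (`|lambda| / ln `|lambda|) * chi_inv omega (ln `|lambda| ^+ 2 / `|lambda|).
Proof.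
pose M := omega (chi_inv omega 4).
have M0 : 0 < M by apply: omega_pos; apply: (chi_inv_gt0 omega_cont omega_ndecr omega_pos).
(* 898 = 2 + 224 * 4, as 1 <= 2 L. *)
exists (898 * M + 1000 * 200 * 12 * 2) => [|lambda l2 D uD]; first by lra.
apply: le_trans (series_log_bound_omega l2 uD) _.
set lam := `|lambda|; set L := ln lam; set r := chi_inv omega _.
have l0 : 0 < lam by apply: lt_le_trans l2.
have Lhalf : 2^-1 <= L by exact: ln_ge_half.
have L0 : 0 < L by lra.
have y0 : 0 < L ^+ 2 / lam by rewrite divr_gt0// exprn_gt0.
have r0 : 0 < r by exact: (chi_inv_gt0 omega_cont omega_ndecr omega_pos).
have o0 : 0 < omega r by exact: omega_pos.
have [_ rE] := chi_invP omega_cont omega_ndecr omega_pos (ltW y0).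
have E : lam / L * r = L / omega r.
  have : r * omega r * lam = L ^+ 2 by rewrite -/r /chi in rE; rewrite rE; field; rewrite gt_eqF.
  move=> E2; apply: (mulIf (x := L * omega r)); first by rewrite mulf_neq0// gt_eqF.
  rewrite [RHS](_ : _ = L ^+ 2); last by field; rewrite gt_eqF.
  by rewrite -E2; field; rewrite gt_eqF.
have oM : omega r <= M.
  apply: (omega_le omega_ndecr); first exact: ltW.
  apply: (chi_inv_le omega_cont omega_ndecr omega_pos); first exact: ltW.
  rewrite (ler_pdivrMr _ _ l0); apply: sqr_ln_le.
  by apply: le_trans l2; rewrite ler1n.
have LM : L <= M * (L / omega r).
  rewrite mulrCA -[leLHS]mulr1; apply: ler_wpM2l; first exact: ltW.
  by rewrite ler_pdivlMr// mul1r.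
rewrite -[leRHS]mulrA E.
rewrite [leRHS](_ : _ = 898 * (M * (L / omega r)) + 1000 * 200 * 12 * 2 * (L / omega r)); last by ring.
by apply: lerD; [lra|exact: lexx].
Qed.

Lemma series_power_bound p : 1 < p < 2 -> exists2 c : R, 0 < c &
  forall lambda, 2 <= `|lambda| -> forall D, uniq D ->
  lp_sum p lambda D <= (c * (sint 1 `|lambda| (chi_density omega p)) `^ (1 / p)) `^ p.
Proof.
move=> p12; have /andP[q0 q1] := power_ratio_bounds p12.
set q := _ `^ _ in q0 q1.
have p0 : 0 < p by lra.
(* A lower bound for the integrand on [[1, 2]], hence for the integral; it absorbs the additive
   constant 224. *)
pose c0 := chi_inv omega (2^-1) `^ p.
have c0_gt0 : 0 < c0 by rewrite powR_gt0//; apply: (chi_inv_gt0 omega_cont omega_ndecr omega_pos); lra.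
pose B := 224 / c0 + 1000 * 200 * 8.
have B0 : 0 < B.
  have : 0 < 224 / c0 by apply: divr_gt0; [lra|exact: c0_gt0].
  by rewrite /B; lra.
have qi : 0 < (1 - q)^-1 by rewrite invr_gt0; lra.
exists ((1 + (1 - q)^-1) * B `^ p^-1) => [|lambda l2 D uD].
  by apply: mulr_gt0; [lra|exact: powR_gt0].
apply: le_trans (series_power_bound_integral l2 p12 uD) _; rewrite -/q.
set I := sint _ _ _.
have cd := chi_density_cont omega_cont omega_ndecr omega_pos (p := p).
have I_ge : c0 <= I.
  rewrite /I (@sint_split R 1 2 `|lambda|)//; last by rewrite l2 andbT; lra.
  apply: (@le_trans _ _ (sint 1 2 (fun=> c0) + 0)).
    by rewrite addr0 sint_cst; lra.
  apply: lerD; last by apply: sint_ge0 => t; exact: chi_density_ge0.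
  apply: le_sint => [||t]; [exact: contC|exact: cd|].
  rewrite in_itv /= => /andP[t1 t2]; rewrite /c0 /chi_density max_l//.
  have i0 : 0 < 2^-1 :> R by lra.
  have ti : 2^-1 <= 1 / t by rewrite mul1r lef_pV2 ?posrE//; lra.
  apply: ge0_ler_powR; rewrite ?nnegrE ?(ltW p0)//.
  - exact/ltW/(chi_inv_gt0 omega_cont omega_ndecr omega_pos).
  - by apply/ltW/(chi_inv_gt0 omega_cont omega_ndecr omega_pos); lra.
  - by apply: (chi_inv_le omega_cont omega_ndecr omega_pos) => //; exact: ltW.
have I0 : 0 < I by lra.
have pi0 : 0 <= p^-1 by rewrite invr_ge0 ltW.
apply: ge0_ler_powR; first exact: ltW.
- by rewrite nnegrE; apply: mulr_ge0; [lra|exact: powR_ge0].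
- by rewrite nnegrE; apply: mulr_ge0; [apply: mulr_ge0; [lra|exact: powR_ge0]|exact: powR_ge0].
rewrite -[leRHS]mulrA div1r -(powRM _ (ltW B0) (ltW I0)); apply: ler_wpM2l; first lra.
apply: ge0_ler_powR; [exact: pi0|by rewrite nnegrE; lra|by rewrite nnegrE; exact/ltW/mulr_gt0|].
rewrite [leRHS](_ : _ = 224 * (I / c0) + 1000 * 200 * 8 * I); last by rewrite /B; ring.
have : 1 <= I / c0 by rewrite ler_pdivlMr// mul1r.
by move=> ?; apply: lerD; [lra|exact: lexx].
Qed.

End series_norms.

(** * From first-order expansions to derivatives *)

Section first_order_derivative.
Variable R : realType.
Implicit Types (s t : R).
Variables (omega : R -> R) (r C : R) (f g : R -> R).
Hypothesis omega_ndecr : {in `[0, +oo[ &, {homo omega : x y / x <= y}}.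
Hypothesis omega_small : forall e, 0 < e -> exists2 c, 0 < c & omega c <= e.
Hypothesis r_gt0 : 0 < r.
Hypothesis C_gt0 : 0 < C.
Hypothesis fg : first_order omega r C f g.

Lemma first_order_is_derive t : is_derive t (1 : R) f (g t).
Proof.
have D : (fun s => s^-1 *: ((f \o shift t) (s *: 1) - f t)) @ 0^' --> g t.
  apply/cvgrPdist_le => e e0; have [c c0 oc] := omega_small (divr_gt0 e0 C_gt0).
  near=> s.
  have s0 : s != 0 by near: s; exact: nbhs_dnbhs_neq.
  have sr : `|s| < r by near: s; apply: dnbhs0_lt.
  have sc : `|s| < c by near: s; apply: dnbhs0_lt.
  have := fg t (ltW sr).
  have p0 : 0 < `|s| by rewrite normr_gt0.
  have os : omega `|s| <= e / C.
    by apply: le_trans oc; apply: (omega_le omega_ndecr); exact: ltW.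
  rewrite /= (_ : s *: (1 : R) = s); last by rewrite /GRing.scale /= mulr1.
  rewrite /shift /= [s + t]addrC.
  have -> : g t - s^-1 *: (f (t + s) - f t) = - (s^-1 * (f (t + s) - f t - s * g t)).
    by rewrite /GRing.scale /=; field.
  rewrite normrN normrM normfV => H; rewrite mulrC ler_pdivrMr//.
  apply: le_trans H _; rewrite mulrAC mulrC mulrC; apply: ler_wpM2r; first exact: ltW.
  by rewrite mulrC -ler_pdivlMr.
have dv : derivable f t 1 by apply: (cvgP _ D).
by apply: DeriveDef => //; exact: cvg_lim D.
Unshelve. all: by end_near. Qed.

Lemma first_order_cont : continuous f.
Proof. by move=> t; have [+ _] := first_order_is_derive t; move=> /derivable1_diffP/differentiable_continuous. Qed.

(** Adding the expansions at t with step s - t and at s with step t - s cancels the increments of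
    [f] and leaves (s - t) (g s - g t). *)
Lemma first_order_derivative_osc s t : omega 0 = 0 -> `|s - t| <= r ->
  `|g s - g t| <= 2 * C * omega `|s - t|.
Proof.
move=> omega0 str; have [->|st] := eqVneq s t.
  by rewrite !subrr normr0 omega0 mulr0.
have p0 : 0 < `|s - t| by rewrite normr_gt0 subr_eq0.
have h1 := fg t str; rewrite [t + _]addrC subrK in h1.
have h2 := fg s (s := t - s); rewrite distrC str in h2.
have {}h2 := h2 isT; rewrite [s + _]addrC subrK in h2.
rewrite -(ler_pM2l p0) -normrM.
have -> : (s - t) * (g s - g t) = (f s - f t - (s - t) * g t) + (f t - f s - (t - s) * g s) by ring.
apply: le_trans (ler_normD _ _) _; lra.
Qed.
End first_order_derivative.

(** * The function on one period *)

Section base_function.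
Variable R : realType.
Local Notation tau := (2 * @pi R).

(* The junk value [(1, 2)] also lies inside the period. *)
Definition rational_interval (j : nat) : R * R :=
  if @unpickle (rat * rat)%type j is Some q then
    if [&& 0 < (ratr q.1 : R), (ratr q.1 : R) < ratr q.2 & (ratr q.2 : R) < tau]
    then (ratr q.1, ratr q.2) else (1, 2)
  else (1, 2).

Lemma tau_gt2 : 2 < tau.
Proof. by have := pi_ge2 R; lra. Qed.

Lemma rational_interval_valid j :
  [/\ 0 < (rational_interval j).1, (rational_interval j).1 < (rational_interval j).2 &
      (rational_interval j).2 < tau].
Proof.
have D : [/\ 0 < (1 : R), (1 : R) < 2 & 2 < tau] by split; [lra|lra|exact: tau_gt2].
rewrite /rational_interval; case: unpickle => [q|//].
by case: ifP => // /and3P[].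
Qed.

Lemma rational_interval_dense (u v : R) : 0 <= u -> u < v -> v <= tau ->
  exists j, u < (rational_interval j).1 /\ (rational_interval j).2 < v.
Proof.
move=> u0 uv vt; have [q1] := rat_in_itvoo uv; rewrite in_itv /= => /andP[h1 h2].
have [q2] := rat_in_itvoo h2; rewrite in_itv /= => /andP[h3 h4].
exists (pickle (q1, q2)); rewrite /rational_interval pickleK /=.
have e1 : 0 < (ratr q1 : R) by lra.
have e2 : (ratr q2 : R) < tau by lra.
by rewrite e1 h3 e2.
Qed.

Variable omega : R -> R.
Hypothesis omega_cont : {within `[0, +oo[, continuous omega}.
Hypothesis omega_ndecr : {in `[0, +oo[ &, {homo omega : x y / x <= y}}.
Hypothesis omega0 : omega 0 = 0.

Lemma omega_small e : 0 < e -> exists2 c : R, 0 < c & omega c <= e.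
Proof.
move=> e0; have [le1|lt1] := leP (omega 1) e; first by exists 1.
have sub : `[0, 1]%classic `<=` (`[0, +oo[%classic : set R).
  by move=> t /=; rewrite !in_itv /= andbT => /andP[].
have [] := @IVT R omega 0 1 e ler01 (continuous_subspaceW sub omega_cont).
  by rewrite omega0 ge_min (ltW e0) le_max (ltW lt1) orbT.
move=> c; rewrite in_itv /= => /andP[c0 c1] oc; exists c; last by rewrite oc.
rewrite lt_neqAle c0 andbT; apply/eqP => E.
by move: e0; rewrite -oc -E omega0 ltxx.
Qed.

Hypothesis omega_doubling : \forall d \near 0^'+, omega (2 * d) < 2 * omega d.

Lemma doubling_scale : exists d0 : R, [/\ 0 < d0, d0 <= 1, omega d0 <= 2^-1 &
  forall d, 0 < d <= d0 -> omega (2 * d) < 2 * omega d].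
Proof.
case: omega_doubling => e /= e0 He.
have i0 : 0 < 2^-1 :> R by rewrite invr_gt0.
have [c c0 oc] := omega_small i0.
(* Half of [e] because the neighbourhood is open and d0 itself must belong to it. The bounds d0 <= 1
   and omega d0 <= 1 / 2 keep all widths below 1 and all values of [chi] at the widths below 1 /
   2. *)
exists (Num.min (Num.min (e / 2) c) 1).
have m0 : 0 < Num.min (Num.min (e / 2) c) 1 by rewrite !lt_min divr_gt0 ?c0//=.
have m1 : Num.min (Num.min (e / 2) c) 1 <= 1 by rewrite ge_min lexx orbT.
have m2 : Num.min (Num.min (e / 2) c) 1 <= c by rewrite !ge_min lexx orbT.
have m3 : Num.min (Num.min (e / 2) c) 1 <= e / 2 by rewrite !ge_min lexx.
split=> // [|d /andP[d0 dm]].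
  by apply: le_trans oc; apply: (omega_le omega_ndecr) m2; exact: ltW.
by apply: He => //=; rewrite sub0r normrN gtr0_norm//; lra.
Qed.

Lemma base_function : exists Phi : R -> R,
  [/\ forall t, t <= 0 \/ tau <= t -> Phi t = 0,
      forall u v, 0 <= u -> u < v -> v <= tau ->
        ~ exists a b, forall t, u < t < v -> Phi t = a * t + b,
      exists r g, [/\ 0 < r, continuous Phi & first_order omega r 32 Phi g],
      exists2 c : R, 0 < c & forall lambda, 2 <= `|lambda| -> forall D, uniq D ->
        \sum_(k <- D) normc (coef (fun t => cis (lambda * Phi t)) k%:~R) `^ 1 <=
        c * (`|lambda| / ln `|lambda|) * chi_inv omega (ln `|lambda| ^+ 2 / `|lambda|) &
      forall p, 1 < p < 2 -> exists2 c : R, 0 < c &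
        forall lambda, 2 <= `|lambda| -> forall D, uniq D ->
        \sum_(k <- D) normc (coef (fun t => cis (lambda * Phi t)) k%:~R) `^ p <=
        (c * (sint 1 `|lambda| (chi_density omega p)) `^ (1 / p)) `^ p].
Proof.
have [d0 [d0_gt0 d0_le1 omega_d0 doubling]] := doubling_scale.
pose w := width d0; pose h := height omega d0; pose halve := halved omega d0.
have w_gt0 : forall m, 0 < w m by move=> m; exact: (width_gt0 d0_gt0).
have wS : forall m, w m.+1 = w m / 2 by move=> m; exact: widthS.
have h_gt0 : forall m, 0 < h m by move=> m; exact: (height_gt0 omega_ndecr omega0 d0_gt0 doubling).
have hS : forall m, h m.+1 = if halve m then h m / 2 else h m by move=> m; exact: heightS.
have wd0 : forall m, w m <= d0 by move=> m; exact: (width_le d0_gt0).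
have w_le1 : forall m, w m <= 1 by move=> m; exact: le_trans d0_le1.
have h_omega : forall m, omega (w m) / 2 <= h m <= omega (w m).
  by move=> m; exact: (height_bounds omega_ndecr omega0 d0_gt0 doubling).
have omega_w : forall m, omega (w m) <= 2^-1.
  by move=> m; apply: le_trans omega_d0; apply: (omega_le omega_ndecr); [exact: ltW|exact: wd0].
have width_pow : forall m, w m * 2 ^+ m <= 1.
  by move=> m; rewrite /w /width divfK ?gt_eqF ?exprn_gt0.
have width_cvg : forall m, (fun d => w (m + d)%N) @ \oo --> (0 : R) by move=> m; exact: width_cvg0.
have opos : forall x, 0 < x -> 0 < omega x.
  by move=> x; exact: (omega_gt0 omega_ndecr omega0 d0_gt0 doubling).
have oge : forall x, 0 <= x -> 0 <= omega x by move=> x; exact: (omega_ge0 omega_ndecr omega0).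
have small : forall e, 0 < e -> exists m, w m <= e /\ h m <= e.
  move=> e e0; have [c c0 oc] := omega_small e0.
  have m0 : 0 < Num.min c e by rewrite lt_min c0 e0.
  have [m Hm] := small_width d0_gt0 m0; exists m; have wm := Hm m (leqnn m).
  rewrite -/w in wm; rewrite le_min in wm; case/andP: wm => wc we; split=> //.
  have /andP[_ h2] := h_omega m; apply: le_trans h2 _; apply: le_trans oc.
  by apply: (omega_le omega_ndecr) wc; exact: ltW.
have blockfo := block_first_order omega_ndecr omega0 d0_gt0 doubling.
have [rr [tol [tol0 tol_gt0 rtol spec]]] :=
  insertion_sequence w_gt0 wS h_gt0 hS small rational_interval_valid.
pose ms j := (rr j).1.1.1; pose us j := (rr j).1.1.2; pose eps j := (rr j).1.2.
have S j : insertion_spec w h halve j (layers w h halve ms us eps j) (tol j)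
   (rational_interval j).1 (rational_interval j).2 (ms j, us j, eps j, tol j.+1).
  by have := spec j; rewrite -rtol /ms /us /eps; case: (rr j) => [[[m u] e] tl].
have h_small j : h (ms j) <= 2^-1 ^+ j by have [[]] := S j.
have w_small j : w (ms j) <= 2^-1 ^+ j by have [[]] := S j.
have hw_tol j : h (ms j) * w (ms j) <= tol j by have [[]] := S j.
have tolS j : tol j.+1 <= tol j / 4 by have [_ [[]]] := S j.
have tol_hw j : tol j.+1 <= h (ms j) * w (ms j) / 4 by have [_ [[]]] := S j.
have inside j : eps j -> [/\ 0 < us j, us j + 3 * w (ms j) < tau &
  exists A B, forall t, us j <= t <= us j + 3 * w (ms j) -> layers w h halve ms us eps j t = A * t + B].
  by have [_ [_ []]] := S j.
pose gb m u t := stair w h halve m (t - u) - 2 * stair w h halve m (t - (u + w m))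
    + stair w h halve m (t - (u + 2 * w m)).
have gb_le m u t : `|gb m u t| <= 4 * h m.
  have sb := stair_bounds w_gt0 wS h_gt0 hS m.
  have := sb (t - u); have := sb (t - (u + w m)); have := sb (t - (u + 2 * w m)).
  by rewrite /gb => b1 b2 b3; rewrite ler_norml; lra.
have [g fo] := series_first_order w_gt0 wS h_gt0 hS us eps tol_gt0 tolS hw_tol h_small oge blockfo gb_le.
have cont : continuous (series_sum w h halve ms us eps).
  exact: (first_order_cont omega_ndecr omega_small d0_gt0 _ fo).
exists (series_sum w h halve ms us eps); split.
- exact: (series_outside w_gt0 wS h_gt0 hS inside).
- move=> u v u0 uv vt [a [b lin]].
  (* The partial sum including layer j is quantitatively non-affine on the rational interval j, and
     the later tolerances preserve this in the limit. *)
  have [j [ju jv]] := rational_interval_dense u0 uv vt.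
  have [_ [_ [_ [x [y [z [xb yb zb D]]]]]]] := S j.
  have H : 100 * tol j.+1 <= `|det3 (layers w h halve ms us eps j.+1) x y z|.
    apply: le_trans D _; rewrite le_eqVlt; apply/orP; left; apply/eqP; congr (`|det3 _ _ _ _|).
    by apply/funext => t; rewrite /layers big_ord_recr.
  have xt : 0 < x < tau by lra.
  have yt : 0 < y < tau by lra.
  have zt : 0 < z < tau by lra.
  have := series_det3 w_gt0 wS h_gt0 hS tol_gt0 tolS hw_tol xt yt zt H.
  by rewrite /det3 !lin; [move=> /eqP; apply; ring|lra..].
- by exists d0, g.
- exact: (series_log_bound omega_cont omega_ndecr opos w_gt0 wS h_gt0 hS w_le1 width_pow width_cvg
     h_omega omega_w tol_gt0 tolS tol_hw hw_tol h_small inside cont).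
- move=> p p12.
  exact: (series_power_bound omega_cont omega_ndecr opos w_gt0 wS h_gt0 hS w_le1 width_pow width_cvg
     h_omega omega_w tol_gt0 tolS hw_tol h_small w_small inside cont p12).
Qed.
End base_function.

(** * Periodic extension *)

Section periodization.
Variable R : realType.
Implicit Types (s t : R).
Local Notation tau := (2 * @pi R).
Let t0 : 0 < tau. Proof. exact: tau_gt0. Qed.

Definition period_frac t := t - (Num.floor (t / tau))%:~R * tau.

Lemma period_frac_bounds t : 0 <= period_frac t < tau.
Proof.
have /andP[h1 h2] := floor_itv (t / tau).
rewrite ler_pdivlMr// in h1; rewrite ltr_pdivrMr// intrD mulrDl mul1r in h2.
by rewrite /period_frac; lra.
Qed.

Lemma period_fracD t (k : int) : period_frac (t + k%:~R * tau) = period_frac t.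
Proof.
have E : (t + k%:~R * tau) / tau = t / tau + k%:~R.
  by rewrite [LHS]mulrDl mulfK// gt_eqF.
by rewrite /period_frac E floorDrz ?intr_int// intrKfloor intrD; ring.
Qed.

Lemma period_frac_id t : 0 <= t < tau -> period_frac t = t.
Proof.
move=> /andP[h1 h2]; rewrite /period_frac (@floor_def _ _ 0) ?mul0r ?subr0//.
by rewrite add0r divr_ge0 ?(ltW t0)//= ltr_pdivrMr// mul1r.
Qed.

Variables (Phi : R -> R).
Hypothesis Phi_outside : forall t, t <= 0 \/ tau <= t -> Phi t = 0.

Definition periodize t := Phi (period_frac t).

Lemma periodizeD t (k : int) : periodize (t + k%:~R * tau) = periodize t.
Proof. by rewrite /periodize period_fracD. Qed.

Lemma periodize_periodic : periodic periodize tau.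
Proof. by move=> t; have := periodizeD t 1; rewrite mul1r. Qed.

Lemma periodizeE t : 0 <= t <= tau -> periodize t = Phi t.
Proof.
move=> /andP[h1]; rewrite le_eqVlt => /predU1P[->|h2]; last first.
  by rewrite /periodize period_frac_id// h1.
have := periodizeD 0 1; rewrite mul1r add0r => ->.
rewrite /periodize period_frac_id ?lexx ?t0// !Phi_outside//; [by right|by left].
Qed.

(** Near one period the extension is a sum of three translates, so first-order expansions add up
    across the junctions and no matching of derivatives at the end points is needed. *)
Lemma periodize_three t : - tau <= t <= 2 * tau ->
  periodize t = Phi t + Phi (t - tau) + Phi (t + tau).
Proof.
move=> /andP[h1 h2]; have t0' := t0.
have [tn|tp] := ltP t 0.
  rewrite -(periodizeD t 1) mul1r periodizeE; last lra.
  by rewrite (Phi_outside (t := t)) ?(Phi_outside (t := t - tau)) ?add0r//; left; lra.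
have [tt|tt] := leP t tau.
  rewrite periodizeE ?tp//.
  rewrite (Phi_outside (t := t - tau)); last by left; lra.
  by rewrite (Phi_outside (t := t + tau)) ?addr0//; right; lra.
rewrite -(periodizeD t (-1)) mulrN1z mulN1r periodizeE; last lra.
rewrite (Phi_outside (t := t)); last by right; lra.
by rewrite (Phi_outside (t := t + tau)) ?addr0 ?add0r//; right; lra.
Qed.

Lemma periodize_first_order omega r C g : 0 < r -> first_order omega r C Phi g ->
  exists G, first_order omega (Num.min r 1) (3 * C) periodize G.
Proof.
move=> r0 fo.
have shift3 c : first_order omega r C (fun t => Phi (t - c)) (fun t => g (t - c)).
  exact: first_order_shift.
have F := first_orderD (first_orderD fo (shift3 tau)) (shift3 (- tau)).
exists (fun t => g (period_frac t) + g (period_frac t - tau) + g (period_frac t + tau)) => t s.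
rewrite le_min => /andP[sr s1].
(* A step of length at most 1 < [tau] from a point of the period stays where the three-translate
   formula holds. *)
have /andP[f0 f1] := period_frac_bounds t; have tau2 := tau_gt2 R.
have E : t = period_frac t + (Num.floor (t / tau))%:~R * tau by rewrite /period_frac subrK.
have sb : - 1 <= s <= 1 by rewrite -ler_norml.
have -> : periodize (t + s) = periodize (period_frac t + s) by rewrite {1}E addrAC periodizeD.
have -> : periodize t = periodize (period_frac t) by rewrite {1}E periodizeD.
rewrite !periodize_three; [|lra..].
have := F (period_frac t) s sr; rewrite !opprK.
by rewrite (_ : C + C + C = 3 * C)//; ring.
Qed.

End periodization.

(** * From finite lists to [A_norm] *)

Section A_norms.
Variable R : realType.

Lemma fourier_coefE (f : R -> R[i]) (k : int) : fourier_coef f k = coef f k%:~R.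
Proof. by []. Qed.

(** The extended sum is a supremum over finite index sets, so a bound uniform over duplicate-free
    lists is enough. *)
Lemma A_norm_le (p B : R) (f : R -> R[i]) : 0 < p -> 0 <= B ->
  (forall D : seq int, uniq D -> \sum_(k <- D) normc (coef f k%:~R) `^ p <= B `^ p) ->
  (A_norm p f <= B%:E)%E.
Proof.
move=> p0 B0 H; rewrite /A_norm.
have pn0 : p != 0 by rewrite gt_eqF.
have -> : B%:E = ((B `^ p)%:E `^ p^-1)%E by rewrite poweR_EFin -powRrM mulfV// powRr1.
have i0 : 0 <= p^-1 by rewrite invr_ge0 ltW.
have term0 (k : int) : (0 <= (normc (fourier_coef f k) `^ p)%:E)%E by rewrite lee_fin powR_ge0.
apply: (gt0_ler_poweR i0).
- by rewrite in_itv /= leey andbT; apply: esum_ge0 => k _; exact: term0.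
- by rewrite in_itv /= leey andbT lee_fin powR_ge0.
apply: ge_ereal_sup => _ [A [finA _] <-].
rewrite fsbig_finite// sumEFin lee_fin.
under eq_bigr do rewrite fourier_coefE.
by apply: H; exact: finmap.fset_uniq.
Qed.
End A_norms.

Lemma nearW_at_right (R : realType) (P : R -> Prop) (r : R) : 0 < r ->
  (forall d, 0 < d <= r -> P d) -> \forall d \near 0^'+, P d.
Proof.
move=> r0 H; exists r => //= d; rewrite /ball_ /= sub0r normrN => dr d0.
by apply: H; rewrite d0 -(gtr0_norm d0) ltW.
Qed.

Theorem theorem2 (R : realType) (omega : R -> R)
  (omega_cont : {within `[0, +oo[, continuous omega})
  (omega_ndecr : {in `[0, +oo[ &, {homo omega : x y / x <= y}})
  (omega0 : omega 0 = 0)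
  (omega_doubling : \forall d \near 0^'+, omega (2 * d) < 2 * omega d) :
  exists phi : R -> R,
    [/\ nowhere_linear phi,
        C1_omega omega phi,
        exists2 c : R, 0 < c &
          forall lambda : R, 2 <= `|lambda| ->
            in_A 1 (fun t => cis (lambda * phi t)) /\
            (A_norm 1 (fun t => cis (lambda * phi t)) <=
              (c * (`|lambda| / ln `|lambda|)
                 * chi_inv omega ((ln `|lambda|) ^+ 2 / `|lambda|))%:E)%E &
        forall p : R, 1 < p < 2 ->
          exists2 c_p : R, 0 < c_p &
            forall lambda : R, 2 <= `|lambda| ->
              in_A p (fun t => cis (lambda * phi t)) /\
              (A_norm p (fun t => cis (lambda * phi t)) <=
                (c_p * (\int[lebesgue_measure]_(tau in `[1%R, `|lambda|])
                          (chi_inv omega (1 / tau) `^ p)) `^ (1 / p))%:E)%E].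
Proof.
have [Phi [out nlin [r [g [r0 Phic fo]]] logb powb]] :=
  base_function omega_cont omega_ndecr omega0 omega_doubling.
have [d0 [d0_gt0 _ _ doubling]] := doubling_scale omega_cont omega_ndecr omega0 omega_doubling.
have opos : forall x, 0 < x -> 0 < omega x.
  by move=> x; exact: (omega_gt0 omega_ndecr omega0 d0_gt0 doubling).
have osm := omega_small omega_cont omega0.
have [G foG] := periodize_first_order out r0 fo.
set phi := periodize Phi in foG.
have t0 := tau_gt0 R.
have C0 : 0 < 3 * 32 :> R by lra.
have m0 : 0 < Num.min r 1 by rewrite lt_min r0 ltr01.
have dphi := first_order_is_derive omega_ndecr osm m0 C0 foG.
have phic := first_order_cont omega_ndecr osm m0 C0 foG.
have fcont lambda : ccont (fun t => cis (lambda * phi t)).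
  by apply: ccont_cis; apply: contM; [exact: contC|exact: phic].
have coefE lambda (k : int) : coef (fun t => cis (lambda * phi t)) k%:~R =
    coef (fun t => cis (lambda * Phi t)) k%:~R.
  apply: eq_coef => t; rewrite in_itv /= => tt.
  by rewrite /phi periodizeE.
have per lambda : periodic (fun t => cis (lambda * phi t)) (2 * pi).
  by move=> t; rewrite /phi periodize_periodic.
exists phi; split.
- move=> u v uv [a [b lin]].
  (* The interval is translated so that it starts in the fundamental period and is cut at its right
     end; there [phi] agrees with [Phi]. *)
  pose k := Num.floor (u / (2 * pi)); pose q : R := k%:~R * (2 * pi).
  have /andP[f0 f1] := period_frac_bounds u.
  have uq : period_frac u = u - q by [].
  rewrite uq in f0 f1.
  apply: (nlin (u - q) (Num.min (v - q) (2 * pi))) => //.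
  + by rewrite lt_min f1 ltrD2r uv.
  + by rewrite ge_min lexx orbT.
  exists a, (a * q + b) => t; rewrite lt_min => /and3P[ut tv tt].
  rewrite -(periodizeE out); last by lra.
  rewrite -(periodizeD Phi t k) -/phi lin; first by rewrite -/q; ring.
  by rewrite in_itv /= -/q; lra.
- split; first exact: periodize_periodic.
  + by move=> t; have [] := dphi t.
  + exists (2 * (3 * 32)); apply: (nearW_at_right m0) => d /andP[d0' dr].
    apply: ge_ereal_sup => _ [[t1 t2] /= td <-].
    rewrite lee_fin.
    have E t : derive1 phi t = G t by rewrite derive1E; have [_ ->] := dphi t.
    rewrite !E.
    apply: le_trans (first_order_derivative_osc foG omega0 (le_trans td dr)) _.
    by apply: ler_wpM2l; [lra|apply: (omega_le omega_ndecr)].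
- have [c c0 H] := logb; exists c => // lambda l2.
  (* Nonnegativity of the bound is its case of the empty list. *)
  have B0 : 0 <= c * (`|lambda| / ln `|lambda|) * chi_inv omega (ln `|lambda| ^+ 2 / `|lambda|).
    have := H lambda l2 [::] isT; rewrite big_nil; exact.
  have N : (A_norm 1 (fun t => cis (lambda * phi t)) <= (c * (`|lambda| / ln `|lambda|)
                 * chi_inv omega ((ln `|lambda|) ^+ 2 / `|lambda|))%:E)%E.
    apply: A_norm_le => // D uD.
    under eq_bigr do rewrite coefE.
    by rewrite (powRr1 B0); exact: H.
  split; last exact: N.
  split; [exact: per| |exact: le_lt_trans N (ltry _)].
  by rewrite eqxx; exact: fcont.
- move=> p p12; have [c c0 H] := powb p p12; exists c => // lambda l2.
  have p0 : 0 < p by lra.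
  have E : \int[lebesgue_measure]_(t in `[1%R, `|lambda|]) (chi_inv omega (1 / t) `^ p) =
      sint 1 `|lambda| (chi_density omega p) by exact: chi_density_integral.
  have N : (A_norm p (fun t => cis (lambda * phi t)) <=
      (c * (\int[lebesgue_measure]_(tau in `[1%R, `|lambda|])
                          (chi_inv omega (1 / tau) `^ p)) `^ (1 / p))%:E)%E.
    rewrite E; apply: A_norm_le; [exact: p0| |move=> D uD].
      by apply: mulr_ge0; [exact: ltW|exact: powR_ge0].
    under eq_bigr do rewrite coefE.
    exact: H.
  split; last exact: N.
  split; [exact: per| |exact: le_lt_trans N (ltry _)].
  have -> : (p == 1) = false by apply/eqP; lra.
  have [f1 f2] := fcont lambda.
  by split; exact: cont_integrable.
Qed.
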